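(* (Local right properness.) Let $\mathcal{C}$ be a Grothendieck site. Let $F\to G$ be a local weak equivalence between simplicial presheaves on $\mathcal{C}$, and let $J\to G$ be a local-fibration. Then the map $J\times_G F\to J$ is also a local weak equivalence.
   Context: A simplicial presheaf on $\mathcal{C}$ is a functor from $\mathcal{C}^{op}$ to simplicial sets; fibre-products are objectwise. An object $X$ of $\mathcal{C}$ is identified with the presheaf it represents, and for a simplicial set $K$, $K\otimes X$ is the simplicial presheaf $U\mapsto K\times\mathrm{Hom}_{\mathcal{C}}(U,X)$, so maps $K\otimes X\to F$ correspond to maps $K\to F(X)$. A map $F\to G$ is a local-fibration if for every commutative square from $\Lambda^{n,k}\otimes X\to\Delta^n\otimes X$ ($X$ representable) to $F\to G$ there is a covering sieve of $X$ such that for each $U\to X$ in the sieve the square restricted to $\Lambda^{n,k}\otimes U\to\Delta^n\otimes U$ has a lift $\Delta^n\otimes U\to F$ (no compatibility for different $U$). For a pointed simplicial set $(K,x)$, $\pi_n(K,x)$ is the set of maps $(\Delta^n,\partial\Delta^n)\to(K,x)$ modulo the equivalence relation generated by simplicial homotopy relative to $\partial\Delta^n$. For $x\in F(X)_0$, $\pi_n(F,x)$ is the presheaf on $\mathcal{C}\downarrow X$ given by $(U\to X)\mapsto\pi_n(F(U),x|_U)$. $\mathrm{Ex}^\infty$ is Kan's fibrant-replacement functor, applied objectwise. A map $f\colon F\to G$ is a local weak equivalence if (1) $\pi_0F\to\pi_0G$ becomes an isomorphism upon sheafification, and (2) for every $X\in\mathcal{C}$, every $x\in F(X)_0$ and every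 $n\ge1$ the map $\pi_n(\mathrm{Ex}^\infty F,x)\to\pi_n(\mathrm{Ex}^\infty G,fx)$ of presheaves on $\mathcal{C}\downarrow X$ becomes an isomorphism upon sheafification. *)

(* Defs.v *)
From mathcomp Require Import all_boot.
From mathcomp Require Import boolp.
From Stdlib Require Import Relation_Operators.

Set Implicit Arguments.
Unset Strict Implicit.
Unset Printing Implicit Defensive.

(* The quotient of [T] by the equivalence relation generated by [R]; a point
   is an equivalence class, seen as a predicate on [T]. *)
Section Quotient.
Variables (T : Type) (R : T -> T -> Prop).

Definition quot : Type :=
  {A : T -> Prop | exists x, A = clos_refl_sym_trans T R x}.

Definition class (x : T) : quot := exist _ _ (ex_intro _ x erefl).

Definition repr (q : quot) : T := sval (cid (svalP q)).

Lemma sig_ext (U : Type) (P : U -> Prop) (a b : {x | P x}) :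
  sval a = sval b -> a = b.
Proof.
by case: a b => [a pa] [b pb] /= ab; subst b; rewrite (Prop_irrelevance pa pb).
Qed.

Lemma classP (x y : T) : class x = class y <-> clos_refl_sym_trans T R x y.
Proof.
split=> [/(congr1 sval) /= E|xy].
  by rewrite E; apply: rst_refl.
apply: sig_ext; apply: funext => z /=; apply: propext; split => h.
  exact: rst_trans (rst_sym _ _ _ _ xy) h.
exact: rst_trans xy h.
Qed.

Lemma reprK (q : quot) : class (repr q) = q.
Proof. by apply: sig_ext; rewrite /= /repr; case: cid => x /= ->. Qed.

Lemma class_rel (x y : T) : R x y -> class x = class y.
Proof. by move=> xy; apply/classP; apply: rst_step. Qed.

End Quotient.

Lemma quot_ind T (R : T -> T -> Prop) (P : quot R -> Prop) :
  (forall x, P (class R x)) -> forall q, P q.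
Proof. by move=> h q; rewrite -(reprK q). Qed.

Definition quot_map T T' (R : T -> T -> Prop) (R' : T' -> T' -> Prop)
  (f : T -> T') (q : quot R) : quot R' := class R' (f (repr q)).

Lemma quot_mapE T T' (R : T -> T -> Prop) (R' : T' -> T' -> Prop) (f : T -> T') :
  (forall x y, R x y -> R' (f x) (f y)) ->
  forall x, quot_map R' f (class R x) = class R' (f x).
Proof.
move=> fR x; apply/classP.
have : clos_refl_sym_trans T R (repr (class R x)) x by apply/classP; rewrite reprK.
rewrite /quot_map; move: (repr _) => y; elim=> [a b ab|a|a b _ h|a b c _ h1 _ h2].
- by apply: rst_step; apply: fR.
- exact: rst_refl.
- exact: rst_sym.
- exact: rst_trans h1 h2.
Qed.

(* Categories are small: presheaves take values in the universe of sets to which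
   the objects and arrows belong, or in a larger one. *)
Record category := Category {
  cob :> Type;
  hom : cob -> cob -> Type;
  idm : forall X, hom X X;
  comp : forall X Y Z, hom Y Z -> hom X Y -> hom X Z;
  comp1m : forall X Y (f : hom X Y), comp (idm Y) f = f;
  compm1 : forall X Y (f : hom X Y), comp f (idm X) = f;
  compA : forall X Y Z W (f : hom Z W) (g : hom Y Z) (h : hom X Y),
    comp f (comp g h) = comp (comp f g) h }.

Arguments hom {c}.
Arguments idm {c}.

Declare Scope cat_scope.
Delimit Scope cat_scope with cat.
Local Open Scope cat_scope.
Local Obligation Tactic := idtac.
Notation "f \c g" := (comp f g) (at level 50, left associativity) : cat_scope.

Record presheaf (C : category) := Presheaf {
  pob :> C -> Type;
  pres : forall U V, hom U V -> pob V -> pob U;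
  pres1 : forall U (x : pob U), pres (idm U) x = x;
  presM : forall U V W (g : hom V W) (h : hom U V) (x : pob W),
    pres (g \c h) x = pres h (pres g x) }.

Arguments pres {C} p {U V}.

Record pmap (C : category) (P Q : presheaf C) := PMap {
  pfun :> forall U, P U -> Q U;
  pfunE : forall U V (g : hom U V) (x : P V),
    pfun (pres P g x) = pres Q g (pfun x) }.

Lemma pmap_ext (C : category) (P Q : presheaf C) (f g : pmap P Q) :
  (forall U x, f U x = g U x) -> f = g.
Proof.
case: f g => [f pf] [g pg] /= fg.
have E : f = g by apply: functional_extensionality_dep => U; apply: funext.
by subst g; rewrite (Prop_irrelevance pf pg).
Qed.

Definition pmap_id (C : category) (P : presheaf C) : pmap P P :=
  @PMap C P P (fun _ x => x) (fun _ _ _ _ => erefl).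

Program Definition pmap_comp (C : category) (P Q R : presheaf C) (f : pmap Q R)
  (g : pmap P Q) : pmap P R := @PMap C P R (fun U x => f U (g U x)) _.
Next Obligation. by move=> *; rewrite /= !pfunE. Qed.

Definition piso (C : category) (P Q : presheaf C) (f : pmap P Q) : Prop :=
  exists g : pmap Q P,
    pmap_comp g f = pmap_id P /\ pmap_comp f g = pmap_id Q.

Record sieve (C : category) (X : C) := Sieve {
  sarr :> forall U, hom U X -> Prop;
  sarrM : forall U V (g : hom U X) (h : hom V U), sarr g -> sarr (g \c h) }.

Lemma sieve_ext (C : category) (X : C) (S S' : sieve X) :
  (forall U (g : hom U X), S U g <-> S' U g) -> S = S'.
Proof.
case: S S' => [S pS] [S' pS'] /= SS'.
have E : S = S'.
  apply: functional_extensionality_dep => U; apply: funext => g.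
  exact: propext.
by subst S'; rewrite (Prop_irrelevance pS pS').
Qed.

Definition sieve_max (C : category) (X : C) : sieve X :=
  @Sieve C X (fun _ _ => True) (fun _ _ _ _ _ => I).

Program Definition sieve_pull (C : category) (X Y : C) (h : hom Y X) (S : sieve X) : sieve Y :=
  @Sieve C Y (fun U g => S U (h \c g)) _.
Next Obligation. by move=> *; rewrite /= compA; apply: sarrM. Qed.

Record site := Site {
  scat :> category;
  cov : forall X : scat, sieve X -> Prop;
  cov_max : forall X : scat, cov (sieve_max X);
  cov_pull : forall (X Y : scat) (h : hom Y X) (S : sieve X),
    cov S -> cov (sieve_pull h S);
  cov_trans : forall (X : scat) (S R : sieve X), cov S ->
    (forall U (g : hom U X), S U g -> cov (sieve_pull g R)) -> cov R }.

Section Slice.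
Variables (C : site) (X : C).

Record slice_ob := SliceOb { sdom : C; sto : hom sdom X }.

Definition slice_hom (a b : slice_ob) :=
  {g : hom (sdom a) (sdom b) | sto b \c g = sto a}.

Program Definition slice_cat : category :=
  @Category slice_ob slice_hom (fun a => exist _ (idm (sdom a)) (compm1 _))
    (fun a b c g h => exist _ (sval g \c sval h) _) _ _ _.
Next Obligation. by move=> a b c [g pg] [h ph] /=; rewrite compA pg ph. Qed.
Next Obligation. by move=> *; apply: sig_ext; rewrite /= comp1m. Qed.
Next Obligation. by move=> *; apply: sig_ext; rewrite /= compm1. Qed.
Next Obligation. by move=> *; apply: sig_ext; rewrite /= compA. Qed.

Lemma slice_sieve_eq (a : slice_cat) (S : sieve a) (V : C)
  (g : hom V (sdom a)) (b : hom V X) (e : sto a \c g = b) :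
  S (SliceOb (sto a \c g)) (exist _ g erefl) <-> S (SliceOb b) (exist _ g e).
Proof. by case: _ / e. Qed.

Program Definition slice_push (a : slice_cat) (S : sieve a) : sieve (sdom a) :=
  @Sieve C (sdom a)
    (fun V g => S (SliceOb (sto a \c g)) (exist _ g erefl)) _.
Next Obligation.
move=> a S U V g h Sg.
have e : sto a \c g \c h = sto a \c (g \c h) by rewrite compA.
pose h' : slice_hom (SliceOb (sto a \c (g \c h))) (SliceOb (sto a \c g)) := exist _ h e.
have := @sarrM slice_cat a S _ _ _ h' Sg.
by congr (S _ _); apply: sig_ext.
Qed.

Lemma slice_pushP (a b : slice_cat) (S : sieve a) (g : hom b a) :
  S b g <-> slice_push S (sdom b) (sval g).
Proof. by case: b g => [V b] [g e]; exact: iff_sym (slice_sieve_eq S e). Qed.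

Lemma slice_push_pull (a b : slice_cat) (h : hom b a) (S : sieve a) :
  slice_push (sieve_pull h S) = sieve_pull (sval h) (slice_push S).
Proof.
apply: sieve_ext => V g.
pose c : slice_cat := SliceOb (sto b \c g).
exact: (@slice_pushP a c S (h \c (exist _ g erefl : @hom slice_cat c b))).
Qed.

(* A sieve on [U -> X] is covering when the sieve of [U] formed by the underlying
   arrows is covering in [C]. *)
Program Definition slice : site :=
  @Site slice_cat (fun a S => cov (slice_push S)) _ _ _.
Next Obligation.
move=> a; suff -> : slice_push (sieve_max a) = sieve_max (sdom a) by apply: cov_max.
exact: sieve_ext.
Qed.
Next Obligation. by move=> a b h S cS; rewrite /= slice_push_pull; apply: cov_pull. Qed.
Next Obligation.
move=> a S R cS SR; apply: cov_trans cS _ => V g Sg.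
by have := SR _ _ Sg; rewrite slice_push_pull.
Qed.

End Slice.

Section Plus.
Variable C : site.

Record matching (P : presheaf C) (X : C) (S : sieve X) := Matching {
  mfun :> forall U (g : hom U X), S U g -> P U;
  mfunE : forall U V (g : hom U X) (h : hom V U)
    (Sg : S U g) (Sgh : S V (g \c h)), pres P h (mfun Sg) = mfun Sgh }.

Lemma mfun_eq (P : presheaf C) (X : C) (S : sieve X) (m : matching P S) U
  (g g' : hom U X) (Sg : S U g) (Sg' : S U g') : g = g' -> m U g Sg = m U g' Sg'.
Proof. by move=> E; subst g'; rewrite (Prop_irrelevance Sg Sg'). Qed.

Record local_section (P : presheaf C) (X : C) := LocalSection {
  ls_sieve : sieve X;
  ls_cov : cov ls_sieve;
  ls_match :> matching P ls_sieve }.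

Definition ls_rel (P : presheaf C) (X : C) (s t : local_section P X) : Prop :=
  exists2 R : sieve X, cov R & forall U (g : hom U X), R U g ->
    exists (Sg : ls_sieve s U g) (Tg : ls_sieve t U g), s U g Sg = t U g Tg.

Program Definition ls_pull (P : presheaf C) (X Y : C) (h : hom Y X)
    (s : local_section P X) : local_section P Y :=
  LocalSection (cov_pull h (ls_cov s))
    (@Matching P Y (sieve_pull h (ls_sieve s)) (fun U g Sg => s U (h \c g) Sg) _).
Next Obligation.
move=> P X Y h s U V g k Sg Sgk.
have Sgk' : ls_sieve s V (h \c g \c k) by rewrite -compA.
by rewrite (@mfunE _ _ _ s _ _ _ _ Sg Sgk'); apply: mfun_eq; rewrite compA.
Qed.

Lemma ls_pull_rel P (X Y : C) (h : hom Y X) (s t : local_section P X) :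
  ls_rel s t -> ls_rel (ls_pull h s) (ls_pull h t).
Proof.
by case=> R cR st; exists (sieve_pull h R) => [|U g]; [exact: cov_pull|exact: st].
Qed.

(* [P^+ X] is the colimit, over the covering sieves [S] of [X], of the sets of
   matching families for [S]. *)
Program Definition plus (P : presheaf C) : presheaf C :=
  @Presheaf C (fun X => quot (@ls_rel P X))
    (fun X Y h => quot_map _ (ls_pull h)) _ _.
Next Obligation.
move=> P U; elim/quot_ind => s; rewrite quot_mapE; last exact: ls_pull_rel.
apply: class_rel; exists (ls_sieve s) => [|V g Sg]; first exact: ls_cov.
have Sg' : ls_sieve s V (idm U \c g) by rewrite comp1m.
by exists Sg', Sg; apply: (@mfun_eq _ _ _ s); rewrite comp1m.
Qed.
Next Obligation.
move=> P U V W g h; elim/quot_ind => s.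
rewrite !quot_mapE; try exact: ls_pull_rel.
apply: class_rel; exists (sieve_pull (g \c h) (ls_sieve s)) => [|Z k Sk].
  by apply: cov_pull; apply: ls_cov.
have Sk' : ls_sieve s Z (g \c (h \c k)) by rewrite compA.
by exists Sk, Sk'; apply: (@mfun_eq _ _ _ s); rewrite compA.
Qed.

Program Definition ls_map (P Q : presheaf C) (f : pmap P Q) (X : C)
    (s : local_section P X) : local_section Q X :=
  LocalSection (ls_cov s)
    (@Matching Q X (ls_sieve s) (fun U g Sg => f U (s U g Sg)) _).
Next Obligation. by move=> *; rewrite -pfunE; congr (pfun _ _); apply: mfunE. Qed.

Lemma ls_map_rel P Q (f : pmap P Q) (X : C) (s t : local_section P X) :
  ls_rel s t -> ls_rel (ls_map f s) (ls_map f t).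
Proof.
case=> R cR st; exists R => // U g Rg.
by have [Sg [Tg E]] := st U g Rg; exists Sg, Tg; rewrite /= E.
Qed.

Program Definition plus_map (P Q : presheaf C) (f : pmap P Q) :
    pmap (plus P) (plus Q) :=
  @PMap C (plus P) (plus Q) (fun X => quot_map _ (@ls_map P Q f X)) _.
Next Obligation.
move=> P Q f U V g; elim/quot_ind => s /=.
rewrite !quot_mapE; try exact: ls_pull_rel; try exact: ls_map_rel.
apply: class_rel; exists (sieve_pull g (ls_sieve s)) => [|W k Sk].
  by apply: cov_pull; apply: ls_cov.
by exists Sk, Sk.
Qed.

Definition sheafify (P : presheaf C) : presheaf C := plus (plus P).

Definition sheafify_map (P Q : presheaf C) (f : pmap P Q) :
  pmap (sheafify P) (sheafify Q) := plus_map (plus_map f).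

(* [f] becomes an isomorphism upon sheafification. *)
Definition sheaf_iso (P Q : presheaf C) (f : pmap P Q) : Prop :=
  piso (sheafify_map f).

End Plus.

Definition monotone m n (f : {ffun 'I_m.+1 -> 'I_n.+1}) : bool :=
  [forall i : 'I_m.+1, forall j : 'I_m.+1, (i <= j) ==> (f i <= f j)].

Definition dhom m n := {f : {ffun 'I_m.+1 -> 'I_n.+1} | monotone f}.

Definition dfun m n (s : dhom m n) (i : 'I_m.+1) : 'I_n.+1 := sval s i.
Coercion dfun : dhom >-> Funclass.

Lemma monotoneP m n (f : {ffun 'I_m.+1 -> 'I_n.+1}) :
  reflect (forall i j : 'I_m.+1, i <= j -> f i <= f j) (monotone f).
Proof.
apply: (iffP forallP) => [h i j|h i]; last by apply/forallP => j; apply/implyP/h.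
by have /forallP/(_ j)/implyP := h i.
Qed.

Lemma dfun_mono m n (s : dhom m n) (i j : 'I_m.+1) : i <= j -> s i <= s j.
Proof. by apply: (monotoneP (sval s) (svalP s)). Qed.

Lemma dhom_ext m n (s t : dhom m n) : (forall i, s i = t i) -> s = t.
Proof. by move=> st; apply: val_inj; apply/ffunP. Qed.

Lemma dmk_subproof m n (f : 'I_m.+1 -> 'I_n.+1) :
  (forall i j : 'I_m.+1, i <= j -> f i <= f j) -> monotone (finfun f).
Proof. by move=> h; apply/monotoneP => i j ij; rewrite !ffunE h. Qed.

Definition dmk m n (f : 'I_m.+1 -> 'I_n.+1)
  (h : forall i j : 'I_m.+1, i <= j -> f i <= f j) : dhom m n :=
  exist (fun f => is_true (monotone f)) (finfun f) (dmk_subproof h).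

Lemma dmkE m n f h i : @dmk m n f h i = f i.
Proof. by rewrite /dfun ffunE. Qed.

Definition did n : dhom n n := @dmk n n id (fun _ _ ij => ij).

Definition dcomp l m n (s : dhom m n) (t : dhom l m) : dhom l n :=
  @dmk l n (fun i => s (t i)) (fun _ _ ij => dfun_mono s (dfun_mono t ij)).

Definition dcst m n (k : 'I_n.+1) : dhom m n :=
  @dmk m n (fun=> k) (fun _ _ _ => leqnn k).

(* The object [n] of the category [Delta] is the ordinal {0 < ... < n}. *)
Program Definition Delta : category := @Category nat dhom did dcomp _ _ _.
Next Obligation. by move=> *; apply: dhom_ext => i; rewrite !dmkE. Qed.
Next Obligation. by move=> *; apply: dhom_ext => i; rewrite !dmkE. Qed.
Next Obligation. by move=> *; apply: dhom_ext => i; rewrite !dmkE. Qed.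

Definition sset := presheaf Delta.

Definition simplex (n : nat) : sset :=
  @Presheaf Delta (fun m => dhom m n) (fun l m t s => dcomp s t)
    (fun m s => @compm1 Delta m n s)
    (fun l m k g h s => @compA Delta l m k n s g h).

(* The simplices of the boundary of [simplex n] are the non-surjective maps; those
   of the [k]-th horn are the maps that miss some element other than [k]. *)
Definition boundary n m (s : dhom m n) : Prop :=
  exists j : 'I_n.+1, forall i, s i <> j.

Definition in_horn n (k : 'I_n.+1) m (s : dhom m n) : Prop :=
  exists j : 'I_n.+1, j <> k /\ forall i, s i <> j.

Lemma in_horn_res n k l m (t : dhom l m) (s : simplex n m) :
  in_horn k s -> in_horn k (pres (simplex n) t s).
Proof. by case=> j [jk h]; exists j; split=> // i; rewrite dmkE. Qed.

Program Definition horn n (k : 'I_n.+1) : sset :=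
  @Presheaf Delta (fun m => {s : simplex n m | in_horn k s})
    (fun l m t s => exist _ (pres (simplex n) t (sval s)) (in_horn_res t (svalP s))) _ _.
Next Obligation. by move=> *; apply: sig_ext; apply: pres1. Qed.
Next Obligation. by move=> *; apply: sig_ext; apply: presM. Qed.

Definition horn_incl n (k : 'I_n.+1) : pmap (horn k) (simplex n) :=
  @PMap Delta (horn k) (simplex n) (fun m s => sval s) (fun _ _ _ _ => erefl).

Program Definition sprod (K L : sset) : sset :=
  @Presheaf Delta (fun m => (K m * L m)%type)
    (fun l m t x => (pres K t x.1, pres L t x.2)) _ _.
Next Obligation. by move=> K L m [x y]; rewrite /= !pres1. Qed.
Next Obligation. by move=> *; rewrite /= !presM. Qed.

(* The [m]-simplex of [K] which is totally degenerate on the vertex [x]. *)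
Definition degen (K : sset) (x : K 0) m : K m := pres K (dcst m ord0 : dhom m 0) x.

Lemma degen_map (K L : sset) (f : pmap K L) (x : K 0) m :
  f m (degen x m) = degen (f 0 x) m.
Proof. exact: pfunE. Qed.

Definition pi0_rel (K : sset) (x y : K 0) : Prop :=
  exists e : K 1, pres K (dcst 0 (ord0 : 'I_2)) e = x /\
                  pres K (dcst 0 (ord_max : 'I_2)) e = y.

Definition pi0 (K : sset) : Type := quot (@pi0_rel K).

Definition pi0_map (K L : sset) (f : pmap K L) : pi0 K -> pi0 L :=
  quot_map _ (f 0).

Lemma pi0_mapE (K L : sset) (f : pmap K L) x :
  pi0_map f (class _ x) = class _ (f 0 x).
Proof.
apply: quot_mapE => {}x y [e [ex ey]].
by exists (f 1 e); rewrite -ex -ey !pfunE.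
Qed.

(* Maps of pairs from (Delta^n, its boundary) to (K, x). *)
Definition sphere n (K : sset) (x : K 0) : Type :=
  {s : pmap (simplex n) K | forall m (a : simplex n m), boundary a -> s m a = degen x m}.

Definition homotopic n (K : sset) (x : K 0) (s t : sphere n x) : Prop :=
  exists H : pmap (sprod (simplex n) (simplex 1)) K,
  [/\ forall m (a : simplex n m), H m (a, dcst m (ord0 : 'I_2)) = sval s m a,
      forall m (a : simplex n m), H m (a, dcst m (ord_max : 'I_2)) = sval t m a
    & forall m (a : simplex n m) (b : simplex 1 m), boundary a ->
        H m (a, b) = degen x m].

Definition pi n (K : sset) (x : K 0) : Type := quot (@homotopic n K x).

Program Definition sphere_map n (K L : sset) (f : pmap K L) (x : K 0) (y : L 0)
    (e : f 0 x = y) (s : sphere n x) : sphere n y :=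
  exist _ (pmap_comp f (sval s)) _.
Next Obligation. by move=> n K L f x y e [s hs] m a ha; rewrite /= hs // degen_map e. Qed.

Definition pi_map n (K L : sset) (f : pmap K L) (x : K 0) (y : L 0)
  (e : f 0 x = y) : pi n x -> pi n y := quot_map _ (sphere_map e).

Lemma pi_mapE n (K L : sset) (f : pmap K L) (x : K 0) (y : L 0)
  (e : f 0 x = y) (s : sphere n x) :
  pi_map e (class _ s) = class _ (sphere_map e s).
Proof.
apply: quot_mapE => {}s t [H [H0 H1 Hx]].
exists (pmap_comp f H); split=> [m a|m a|m a b ab] /=.
- by rewrite H0.
- by rewrite H1.
- by rewrite Hx // degen_map e.
Qed.

(* The nerve of the poset of nonempty subsets of {0, ..., n}, that is, the
   barycentric subdivision of [simplex n]. *)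
Definition sd_chain n m (c : {ffun 'I_m.+1 -> {set 'I_n.+1}}) : bool :=
  [forall i, c i != set0] &&
  [forall i : 'I_m.+1, forall j : 'I_m.+1, (i <= j) ==> (c i \subset c j)].

Lemma sd_chainP n m (c : {ffun 'I_m.+1 -> {set 'I_n.+1}}) :
  reflect ((forall i, c i != set0) /\
           (forall i j : 'I_m.+1, i <= j -> c i \subset c j)) (sd_chain c).
Proof.
apply: (iffP andP) => [[/forallP h /forallP k]|[h k]].
  by split=> // i j; have /forallP/(_ j)/implyP := k i.
by split; apply/forallP => // i; apply/forallP => j; apply/implyP/k.
Qed.

Definition sd_ob n m := {c : {ffun 'I_m.+1 -> {set 'I_n.+1}} | sd_chain c}.

Lemma sd_ext n m (c d : sd_ob n m) : (forall i, sval c i = sval d i) -> c = d.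
Proof. by move=> cd; apply: val_inj; apply/ffunP. Qed.

Program Definition sd_res n l m (t : dhom l m) (c : sd_ob n m) : sd_ob n l :=
  exist _ [ffun i => sval c (t i)] _.
Next Obligation.
move=> n l m t [c /= /sd_chainP [h k]]; apply/sd_chainP.
by split=> [i|i j ij]; rewrite !ffunE // k // dfun_mono.
Qed.

Program Definition sd (n : nat) : sset := @Presheaf Delta (sd_ob n) (@sd_res n) _ _.
Next Obligation. by move=> *; apply: sd_ext => i; rewrite ffunE dmkE. Qed.
Next Obligation. by move=> *; apply: sd_ext => i; rewrite !ffunE dmkE. Qed.

Program Definition sd_push n n' m (t : dhom n n') (c : sd_ob n m) : sd_ob n' m :=
  exist _ [ffun i => [set t x | x in sval c i]] _.
Next Obligation.
move=> n n' m t [c /= /sd_chainP [h k]]; apply/sd_chainP.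
split=> [i|i j ij]; rewrite !ffunE; last by apply: imsetS; apply: k.
by have /set0Pn[x xc] := h i; apply/set0Pn; exists (t x); apply: imset_f.
Qed.

Program Definition sd_map n n' (t : dhom n n') : pmap (sd n) (sd n') :=
  @PMap Delta (sd n) (sd n') (fun m => @sd_push n n' m t) _.
Next Obligation. by move=> *; apply: sd_ext => i; rewrite !ffunE. Qed.

(* The maximum of [A], when [A] is nonempty. *)
Definition set_last n (A : {set 'I_n.+1}) : 'I_n.+1 := inord (\max_(i in A) i).

Lemma set_last_val n (A : {set 'I_n.+1}) : set_last A = \max_(i in A) i :> nat.
Proof. by rewrite inordK // ltnS; apply/bigmax_leqP => i _; rewrite -ltnS. Qed.

Lemma set_lastS n (A B : {set 'I_n.+1}) : A \subset B -> set_last A <= set_last B.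
Proof.
move=> /subsetP AB; rewrite !set_last_val; apply/bigmax_leqP => i iA.
by apply: (bigmax_sup i) => //; apply: AB.
Qed.

Lemma set_last_in n (A : {set 'I_n.+1}) : A != set0 -> set_last A \in A.
Proof.
case/set0Pn => x xA.
have cA : 0 < #|A| by apply/card_gt0P; exists x.
have [i iA E] := eq_bigmax_cond (fun i : 'I_n.+1 => i : nat) cA.
by have -> : set_last A = i by apply: val_inj; rewrite /= set_last_val E.
Qed.

Lemma set_last_max n (A : {set 'I_n.+1}) i : i \in A -> i <= set_last A.
Proof.
by move=> iA; rewrite set_last_val; apply: (bigmax_sup i).
Qed.

Lemma set_last_imset n n' (t : dhom n n') (A : {set 'I_n.+1}) :
  A != set0 -> set_last [set t x | x in A] = t (set_last A).
Proof.
move=> A0; apply: val_inj; apply/eqP; rewrite eqn_leq; apply/andP; split.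
  rewrite [X in X <= _]set_last_val; apply/bigmax_leqP => _ /imsetP[x xA ->].
  by apply: dfun_mono; apply: set_last_max.
by apply: set_last_max; apply: imset_f; apply: set_last_in.
Qed.

Program Definition last_vertex_fun n m (c : sd_ob n m) : dhom m n :=
  @dmk m n (fun i => set_last (sval c i)) _.
Next Obligation.
by move=> n m [c /= /sd_chainP [h k]] i j ij; apply: set_lastS; apply: k.
Qed.

Program Definition last_vertex n : pmap (sd n) (simplex n) :=
  @PMap Delta (sd n) (simplex n) (fun m => @last_vertex_fun n m) _.
Next Obligation. by move=> *; apply: dhom_ext => i; rewrite !dmkE ffunE. Qed.

Lemma last_vertex_nat n n' (t : dhom n n') m (c : sd n m) :
  last_vertex n' m (sd_map t m c) = dcomp t (last_vertex n m c).
Proof.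
apply: dhom_ext => i; rewrite !dmkE ffunE set_last_imset //.
by case: c => [c /= /sd_chainP [h k]].
Qed.

Program Definition Ex (K : sset) : sset :=
  @Presheaf Delta (fun n => pmap (sd n) K)
    (fun m n t f => pmap_comp f (sd_map t)) _ _.
Next Obligation.
move=> K n f; apply: pmap_ext => m c /=; congr (f m _); apply: sd_ext => i.
rewrite ffunE; apply/setP => x; apply/imsetP/idP => [[y yc ->]|xc].
  by rewrite dmkE.
by exists x => //; rewrite dmkE.
Qed.
Next Obligation.
move=> K n1 n2 n3 g h f; apply: pmap_ext => m c /=; congr (f m _); apply: sd_ext => i.
rewrite !ffunE -imset_comp; apply: eq_imset => x /=; exact: dmkE.
Qed.

Program Definition Ex_map (K L : sset) (f : pmap K L) : pmap (Ex K) (Ex L) :=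
  @PMap Delta (Ex K) (Ex L) (fun n g => pmap_comp f g) _.
Next Obligation. by move=> *; apply: pmap_ext. Qed.

(* [x : K n] is sent to the composite of the last vertex map [sd n -> Delta^n]
   and of the map [Delta^n -> K] classifying [x]. *)
Program Definition Ex_unit_fun (K : sset) n (x : K n) : Ex K n :=
  @PMap Delta (sd n) K (fun m c => pres K (last_vertex n m c : @hom Delta m n) x) _.
Next Obligation.
move=> K n x U V g c; rewrite -presM; congr (pres K _ x).
exact: (pfunE (last_vertex n) g c).
Qed.

Program Definition Ex_unit (K : sset) : pmap K (Ex K) :=
  @PMap Delta K (Ex K) (fun n => @Ex_unit_fun K n) _.
Next Obligation.
move=> K U V g x; apply: pmap_ext => m c /=.
rewrite -presM; congr (pres K _ x); exact: esym (last_vertex_nat g c).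
Qed.

Lemma Ex_unit_nat (K L : sset) (f : pmap K L) n (x : K n) :
  Ex_map f n (Ex_unit K n x) = Ex_unit L n (f n x).
Proof. by apply: pmap_ext => m c /=; rewrite pfunE. Qed.

Fixpoint Ex_iter_map (K L : sset) (f : pmap K L) k : pmap (iter k Ex K) (iter k Ex L) :=
  if k is k'.+1 then Ex_map (Ex_iter_map f k') else f.

(* [Ex_inf K] is the colimit of [K -> Ex K -> Ex (Ex K) -> ...]. *)
Definition tower (K : sset) n : Type := {k : nat & iter k Ex K n}.

Definition tow (K : sset) n k (x : iter k Ex K n) : tower K n :=
  existT (fun k => iter k Ex K n) k x.

Definition tower_rel (K : sset) n (a b : tower K n) : Prop :=
  exists k (x : iter k Ex K n), a = tow x /\ b = @tow K n k.+1 (Ex_unit (iter k Ex K) n x).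

Definition tower_res (K : sset) m n (t : dhom m n) (a : tower K n) : tower K m :=
  tow (pres (iter (tag a) Ex K) (t : @hom Delta m n) (tagged a)).

Lemma tower_res_rel (K : sset) m n (t : dhom m n) (a b : tower K n) :
  tower_rel a b -> tower_rel (tower_res t a) (tower_res t b).
Proof.
case=> k [x [-> ->]]; exists k, (pres (iter k Ex K) (t : @hom Delta m n) x).
split=> //; apply: (congr1 (@tow K m k.+1)).
exact: esym (pfunE (Ex_unit (iter k Ex K)) (t : @hom Delta m n) x).
Qed.

Program Definition Ex_inf (K : sset) : sset :=
  @Presheaf Delta (fun n => quot (@tower_rel K n))
    (fun m n t => quot_map _ (tower_res t)) _ _.
Next Obligation.
move=> K n; elim/quot_ind => [[k x]]; rewrite quot_mapE; last exact: tower_res_rel.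
by congr class; rewrite /tower_res /= (pres1 x).
Qed.
Next Obligation.
move=> K n1 n2 n3 g h; elim/quot_ind => [[k x]].
rewrite !quot_mapE; try exact: tower_res_rel.
by congr class; rewrite /tower_res /= (presM g h x).
Qed.

Definition tower_map (K L : sset) (f : pmap K L) n (a : tower K n) : tower L n :=
  tow (Ex_iter_map f (tag a) n (tagged a)).

Lemma tower_map_rel (K L : sset) (f : pmap K L) n (a b : tower K n) :
  tower_rel a b -> tower_rel (tower_map f a) (tower_map f b).
Proof.
case=> k [x [-> ->]]; exists k, (Ex_iter_map f k n x); split=> //; apply: (congr1 (@tow L n k.+1)).
exact: (Ex_unit_nat (Ex_iter_map f k) x).
Qed.

Program Definition Ex_inf_map (K L : sset) (f : pmap K L) : pmap (Ex_inf K) (Ex_inf L) :=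
  @PMap Delta (Ex_inf K) (Ex_inf L) (fun n => quot_map _ (@tower_map K L f n)) _.
Next Obligation.
move=> K L f m n t; elim/quot_ind => [[k x]] /=.
rewrite !quot_mapE; try exact: tower_res_rel; try exact: tower_map_rel.
by congr class; rewrite /tower_map /tower_res /= pfunE.
Qed.

Program Definition Ex_inf_unit (K : sset) : pmap K (Ex_inf K) :=
  @PMap Delta K (Ex_inf K) (fun n x => class _ (@tow K n 0 x)) _.
Next Obligation. by move=> K m n t x; rewrite /= quot_mapE //; apply: tower_res_rel. Qed.

Lemma Ex_inf_unit_nat (K L : sset) (f : pmap K L) n (x : K n) :
  Ex_inf_map f n (Ex_inf_unit K n x) = Ex_inf_unit L n (f n x).
Proof. by rewrite /= quot_mapE //; apply: tower_map_rel. Qed.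

Lemma Ex_iter_map_id (K : sset) k n (x : iter k Ex K n) :
  Ex_iter_map (pmap_id K) k n x = x.
Proof.
elim: k n x => [|k IH] n x //=; apply: pmap_ext => m c /=; exact: IH.
Qed.

Lemma Ex_iter_map_comp (K L M : sset) (f : pmap L M) (g : pmap K L) k n
  (x : iter k Ex K n) :
  Ex_iter_map (pmap_comp f g) k n x = Ex_iter_map f k n (Ex_iter_map g k n x).
Proof.
elim: k n x => [|k IH] n x //=; apply: pmap_ext => m c /=; exact: IH.
Qed.

Lemma Ex_inf_map_id (K : sset) : Ex_inf_map (pmap_id K) = pmap_id (Ex_inf K).
Proof.
apply: pmap_ext => n; elim/quot_ind => [[k x]] /=.
rewrite quot_mapE; last exact: tower_map_rel.
by congr class; rewrite /tower_map /= Ex_iter_map_id.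
Qed.

Lemma Ex_inf_map_comp (K L M : sset) (f : pmap L M) (g : pmap K L) :
  Ex_inf_map (pmap_comp f g) = pmap_comp (Ex_inf_map f) (Ex_inf_map g).
Proof.
apply: pmap_ext => n; elim/quot_ind => [[k x]] /=.
rewrite !quot_mapE; try exact: tower_map_rel.
by congr class; rewrite /tower_map /= Ex_iter_map_comp.
Qed.

Record spresheaf (C : category) := SPresheaf {
  spob :> C -> sset;
  spres : forall U V, hom U V -> pmap (spob V) (spob U);
  spres1 : forall U, spres (idm U) = pmap_id (spob U);
  spresM : forall U V W (g : hom V W) (h : hom U V),
    spres (g \c h) = pmap_comp (spres h) (spres g) }.

Arguments spres {C} s {U V}.

Record spmap (C : category) (F G : spresheaf C) := SPMap {
  spfun :> forall U, pmap (F U) (G U);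
  spfunE : forall U V (g : hom U V),
    pmap_comp (spfun U) (spres F g) = pmap_comp (spres G g) (spfun V) }.

Lemma spfunEx (C : category) (F G : spresheaf C) (f : spmap F G) U V (g : hom U V) n (x : F V n) :
  f U n (spres F g n x) = spres G g n (f V n x).
Proof. by have := congr1 (fun h : pmap (F V) (G U) => h n x) (spfunE f g). Qed.

Lemma spresMx (C : category) (F : spresheaf C) U V W (g : hom V W) (h : hom U V) n (x : F W n) :
  spres F (g \c h) n x = spres F h n (spres F g n x).
Proof. by rewrite spresM. Qed.

Lemma spres1x (C : category) (F : spresheaf C) (U : C) n (x : F U n) : spres F (idm U) n x = x.
Proof. by rewrite spres1. Qed.

Program Definition spmap_comp (C : category) (F G H : spresheaf C) (f : spmap G H)
  (g : spmap F G) : spmap F H := @SPMap C F H (fun U => pmap_comp (f U) (g U)) _.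
Next Obligation. by move=> *; apply: pmap_ext => n x /=; rewrite !spfunEx. Qed.

Program Definition fprod_ob (K L M : sset) (p : pmap K M) (f : pmap L M) : sset :=
  @Presheaf Delta (fun n => {x : K n * L n | p n x.1 = f n x.2})
    (fun m n t x => exist _ (pres K t (sval x).1, pres L t (sval x).2) _) _ _.
Next Obligation. by move=> K L M p f m n t [[x y] /= e]; rewrite !pfunE e. Qed.
Next Obligation. by move=> K L M p f n [[x y] e]; apply: sig_ext; rewrite /= !pres1. Qed.
Next Obligation. by move=> K L M p f n1 n2 n3 g h [[x y] e]; apply: sig_ext; rewrite /= !presM. Qed.

(* The objectwise fibre product of [J -> G <- F]. *)
Section FibreProduct.
Variables (C : category) (J F G : spresheaf C) (p : spmap J G) (f : spmap F G).

Program Definition fprod_res U V (g : hom U V) :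
    pmap (fprod_ob (p V) (f V)) (fprod_ob (p U) (f U)) :=
  @PMap Delta (fprod_ob (p V) (f V)) (fprod_ob (p U) (f U))
    (fun n x => exist _ (spres J g n (sval x).1, spres F g n (sval x).2) _) _.
Next Obligation. by move=> U V g n [[x y] /= e]; rewrite !spfunEx e. Qed.
Next Obligation. by move=> U V g m n t [[x y] e]; apply: sig_ext; rewrite /= !pfunE. Qed.

Program Definition fprod : spresheaf C :=
  @SPresheaf C (fun U => fprod_ob (p U) (f U)) fprod_res _ _.
Next Obligation.
by move=> U; apply: pmap_ext => n [[x y] e]; apply: sig_ext; rewrite /= !spres1x.
Qed.
Next Obligation.
by move=> U V W g h; apply: pmap_ext => n [[x y] e]; apply: sig_ext; rewrite /= !spresMx.
Qed.

Program Definition fprod_fst : spmap fprod J :=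
  @SPMap C fprod J (fun U =>
    @PMap Delta (fprod_ob (p U) (f U)) (J U) (fun n x => (sval x).1) _) _.
Next Obligation. by []. Qed.
Next Obligation. by move=> *; apply: pmap_ext. Qed.

End FibreProduct.

(* [tensor K X] is the simplicial presheaf [U |-> K * Hom(U, X)]. *)
Section Tensor.
Variable C : category.

Program Definition tensor_ob (K : sset) (T : Type) : sset :=
  @Presheaf Delta (fun n => (K n * T)%type) (fun m n t x => (pres K t x.1, x.2)) _ _.
Next Obligation. by move=> K T n [x y]; rewrite /= pres1. Qed.
Next Obligation. by move=> *; rewrite /= presM. Qed.

Program Definition tensor_res (K : sset) (X U V : C) (g : hom U V) :
    pmap (tensor_ob K (hom V X)) (tensor_ob K (hom U X)) :=
  @PMap Delta (tensor_ob K (hom V X)) (tensor_ob K (hom U X))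
    (fun n x => (x.1, x.2 \c g)) _.
Next Obligation. by []. Qed.

Program Definition tensor (K : sset) (X : C) : spresheaf C :=
  @SPresheaf C (fun U => tensor_ob K (hom U X)) (@tensor_res K X) _ _.
Next Obligation. by move=> K X U; apply: pmap_ext => n [x y]; rewrite /= compm1. Qed.
Next Obligation. by move=> *; apply: pmap_ext => n [x y]; rewrite /= compA. Qed.

Program Definition tensor_map (K L : sset) (i : pmap K L) (U X : C) (g : hom U X) :
    spmap (tensor K U) (tensor L X) :=
  @SPMap C (tensor K U) (tensor L X) (fun V =>
    @PMap Delta (tensor_ob K (hom V U)) (tensor_ob L (hom V X))
      (fun n x => (i n x.1, g \c x.2)) _) _.
Next Obligation. by move=> *; rewrite /= pfunE. Qed.
Next Obligation. by move=> *; apply: pmap_ext => n [x y]; rewrite /= compA. Qed.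

End Tensor.

(* Horns are taken in dimension at least 1 only: with the definition above,
   [horn] in dimension 0 is empty. *)
Definition local_fibration (C : site) (F G : spresheaf C) (f : spmap F G) : Prop :=
  forall (n : nat) (k : 'I_n.+1) (X : C), 0 < n ->
  forall (u : spmap (tensor (horn k) X) F) (v : spmap (tensor (simplex n) X) G),
    spmap_comp f u = spmap_comp v (tensor_map (horn_incl k) (idm X)) ->
  exists2 S : sieve X, cov S &
  forall (U : C) (g : hom U X), S U g ->
  exists l : spmap (tensor (simplex n) U) F,
    spmap_comp l (tensor_map (horn_incl k) (idm U)) =
      spmap_comp u (tensor_map (pmap_id (horn k)) g) /\
    spmap_comp f l = spmap_comp v (tensor_map (pmap_id (simplex n)) g).

Program Definition Ex_inf_sp (C : category) (F : spresheaf C) : spresheaf C :=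
  @SPresheaf C (fun U => Ex_inf (F U)) (fun U V g => Ex_inf_map (spres F g)) _ _.
Next Obligation. by move=> C F U; rewrite /= spres1 Ex_inf_map_id. Qed.
Next Obligation. by move=> *; rewrite /= spresM Ex_inf_map_comp. Qed.

Program Definition Ex_inf_spmap (C : category) (F G : spresheaf C) (f : spmap F G) :
    spmap (Ex_inf_sp F) (Ex_inf_sp G) :=
  @SPMap C (Ex_inf_sp F) (Ex_inf_sp G) (fun U => Ex_inf_map (f U)) _.
Next Obligation. by move=> *; rewrite /= -!Ex_inf_map_comp spfunE. Qed.

Program Definition pi0_psh (C : category) (F : spresheaf C) : presheaf C :=
  @Presheaf C (fun U => pi0 (F U)) (fun U V g => pi0_map (spres F g)) _ _.
Next Obligation. by move=> C F U; elim/quot_ind => x; rewrite pi0_mapE spres1x. Qed.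
Next Obligation.
by move=> C F U V W g h; elim/quot_ind => x; rewrite !pi0_mapE spresMx.
Qed.

Program Definition pi0_pmap (C : category) (F G : spresheaf C) (f : spmap F G) :
    pmap (pi0_psh F) (pi0_psh G) :=
  @PMap C (pi0_psh F) (pi0_psh G) (fun U => pi0_map (f U)) _.
Next Obligation.
by move=> C F G f U V g; elim/quot_ind => x; rewrite /= !pi0_mapE spfunEx.
Qed.

Section PiPresheaf.
Variables (C : site) (n : nat) (X : C).

Lemma base_res (F : spresheaf C) (x : F X 0) (a b : slice X) (g : hom a b) :
  spres F (sval g) 0 (spres F (sto b) 0 x) = spres F (sto a) 0 x.
Proof. by rewrite -spresMx (svalP g). Qed.

Program Definition pi_psh (F : spresheaf C) (x : F X 0) : presheaf (slice X) :=
  @Presheaf (slice X) (fun a : slice X => pi n (spres F (sto a) 0 x))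
    (fun a b g => pi_map (base_res x g)) _ _.
Next Obligation.
move=> F x a; elim/quot_ind => s; rewrite pi_mapE; congr class.
by apply: sig_ext; apply: pmap_ext => m c /=; rewrite spres1x.
Qed.
Next Obligation.
move=> F x a b c g h; elim/quot_ind => s; rewrite !pi_mapE; congr class.
by apply: sig_ext; apply: pmap_ext => m d /=; rewrite spresMx.
Qed.

Program Definition pi_pmap (F G : spresheaf C) (f : spmap F G) (x : F X 0) :
    pmap (pi_psh x) (pi_psh (f X 0 x)) :=
  @PMap (slice X) (pi_psh x) (pi_psh (f X 0 x))
    (fun a => pi_map (spfunEx f (sto a) x)) _.
Next Obligation.
move=> F G f x a b g; elim/quot_ind => s; rewrite /= !pi_mapE; congr class.
by apply: sig_ext; apply: pmap_ext => m d /=; rewrite spfunEx.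
Qed.

End PiPresheaf.

(* The vertex [x] of [F X] is seen in [Ex_inf (F X)] through the unit; its image
   by [Ex_inf_spmap f] is the image of [f X 0 x] by the unit, by
   [Ex_inf_unit_nat]. *)
Definition local_weq (C : site) (F G : spresheaf C) (f : spmap F G) : Prop :=
  sheaf_iso (pi0_pmap f) /\
  forall (X : C) (x : F X 0) (n : nat), 0 < n ->
    sheaf_iso (pi_pmap n (Ex_inf_spmap f) (Ex_inf_unit (F X) 0 x)).

(* Main.v *)
(* Locally, a weak equivalence of presheaves of Kan complexes is an isomorphism on
   components and on homotopy groups, and the pullback P of F -> G along a local
   fibration J -> G is treated directly in these terms. A sphere of J maps to G, where
   it is locally homotopic to the image of a sphere of F; lifting this homotopy to J
   moves the given sphere to one that comes from P. If two spheres of P become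
   homotopic in J, their images in F are locally homotopic as well, but the two
   homotopies need not agree in G; surjectivity on homotopy groups one dimension
   higher corrects the homotopy in F so that its image is homotopic to the other one
   relative to the boundary, and lifting that homotopy to J gives a homotopy in P.

   The passage to Ex^infty is harmless: it makes every presheaf objectwise Kan, commutes
   with pullbacks, does not change components, and preserves local fibrations. Every
   extension problem that occurs is the inclusion of a subcomplex in the nerve of a
   finite poset, the missing chains of which are matched by adding or removing one
   vertex, so that it is a composite of pushouts of horns; finitely many horn fillings,
   each after refining the cover, solve it locally. *)

From mathcomp Require Import all_boot.
From mathcomp Require Import boolp zify.
From Stdlib Require Import Relation_Operators.
Require Import Defs.

Set Implicit Arguments.
Unset Strict Implicit.
Unset Printing Implicit Defensive.

Local Open Scope cat_scope.
Local Obligation Tactic := idtac.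

(** * Local truth and sheafification *)

(** The lifts that a local fibration provides over different arrows of a sieve need not be
    compatible, so they never assemble into a map over the whole object. Every intermediate
    statement is therefore of the form [locally], and each refinement of the cover is absorbed by
    [locally_bind]; sheafified isomorphisms are first rewritten as local injectivity plus local
    surjectivity.

    Homotopies relative to the boundary are taken between arbitrary simplices, not only between
    spheres. A homotopy of [m]-spheres can then be traded for a simplex of dimension [m + 1] with
    prescribed boundary, and one lifting lemma serves both for spheres and for these simplices. In
    the same way the correction of a homotopy, classically a subtraction in the homotopy group of
    dimension [m + 1], becomes a statement on two simplices with the same boundary, one in [F] and
    one in [G]. Its proof moves along contractions to the last vertex and composes homotopies by
    filling prisms over a triangle. *)

Definition locally (C : site) (X : C) (P : forall U : C, hom U X -> Prop) : Prop :=
  exists2 S : sieve X, cov S & forall U (g : hom U X), S U g -> P U g.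

Lemma locally_triv (C : site) (X : C) (P : forall U : C, hom U X -> Prop) :
  (forall U (g : hom U X), P U g) -> locally P.
Proof. by move=> h; exists (sieve_max X) => [|U g _]; [exact: cov_max|exact: h]. Qed.

Program Definition sieve_bind (C : site) (X : C) (S : sieve X)
    (T : forall U (g : hom U X), S U g -> sieve U) : sieve X :=
  @Sieve C X (fun V k => exists U (g : hom U X) (Sg : S U g) (h : hom V U),
    T U g Sg V h /\ k = g \c h) _.
Next Obligation.
move=> C X S T U V _ h [W [g [Sg [k [Tk ->]]]]].
by exists W, g, Sg, (k \c h); split; [exact: sarrM|rewrite compA].
Qed.

(** This is the transitivity axiom of the topology; the second covers are chosen independently for
    each arrow of the first, by the axiom of choice. *)
Lemma locally_bind (C : site) (X : C) (P Q : forall U : C, hom U X -> Prop) :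
  locally P ->
  (forall U (g : hom U X), P U g -> locally (fun V (h : hom V U) => Q V (g \c h))) ->
  locally Q.
Proof.
case=> S cS SP PQ.
have T U g (Sg : S U g) : {T : sieve U | cov T /\ forall V h, T V h -> Q V (g \c h)}.
  by apply/cid; have [R cR RQ] := PQ U g (SP U g Sg); exists R.
exists (sieve_bind (fun U g Sg => sval (T U g Sg))) => [|V _ [U [g [Sg [h [Th ->]]]]]].
  apply: cov_trans cS _ => U g Sg.
  apply: (@cov_trans C U (sval (T U g Sg))) => [|V h Th].
    by have [] := svalP (T U g Sg).
  suff -> : sieve_pull h (sieve_pull g (sieve_bind (fun U g Sg => sval (T U g Sg)))) =
    sieve_max V by apply: cov_max.
  apply: sieve_ext => W k; split=> // _ /=.
  by exists U, g, Sg, (h \c k); split=> //; apply: sarrM.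
by have [_] := svalP (T U g Sg); apply.
Qed.

Lemma locally_mono (C : site) (X : C) (P Q : forall U : C, hom U X -> Prop) :
  locally P -> (forall U (g : hom U X), P U g -> Q U g) -> locally Q.
Proof. by case=> S cS SP PQ; exists S => // U g /SP/PQ. Qed.

Section LocalIso.
Variable C : site.
Implicit Types P Q : presheaf C.

Definition loc_inj P Q (f : pmap P Q) : Prop := forall (X : C) (a b : P X),
  f X a = f X b -> locally (fun U (g : hom U X) => pres P g a = pres P g b).

Definition loc_surj P Q (f : pmap P Q) : Prop := forall (X : C) (b : Q X),
  locally (fun U (g : hom U X) => exists a : P U, f U a = pres Q g b).

(** [ls_rel] is already an equivalence relation, so the generated one adds nothing; for transitivity
    the two covering sieves are intersected. *)
Lemma ls_class P (X : C) (s t : local_section P X) :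
  class (@ls_rel C P X) s = class (@ls_rel C P X) t <-> ls_rel s t.
Proof.
split; last exact: class_rel.
move/classP; elim=> [//|{}s|{}s {}t _ [R cR h]|s1 s2 s3 _ [R cR h] _ [R' cR' h']].
- by exists (ls_sieve s) => [|U g Sg]; [exact: ls_cov|exists Sg, Sg].
- by exists R => // U g /h[Sg [Tg e]]; exists Tg, Sg.
have : locally (fun U (g : hom U X) => R U g /\ R' U g).
  apply: (@locally_bind _ _ (fun U g => R U g)); first by exists R.
  move=> U g Rg; exists (sieve_pull g R') => [|V k R'k]; first exact: cov_pull.
  by split=> //; apply: sarrM.
case=> T cT TR; exists T => // U g /TR[/h[S1 [S2 e]] /h'[S2' [S3 e']]].
exists S1, S3; rewrite e -e'; exact: mfun_eq.
Qed.

Program Definition ls_unit P (X : C) (a : P X) : local_section P X :=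
  LocalSection (cov_max X) (@Matching C P X (sieve_max X) (fun U g _ => pres P g a) _).
Next Obligation. by move=> *; rewrite /= presM. Qed.

Program Definition plus_unit P : pmap P (plus P) :=
  @PMap C P (plus P) (fun X a => class _ (ls_unit a)) _.
Next Obligation.
move=> P U V g x /=; rewrite quot_mapE; last exact: ls_pull_rel.
apply: class_rel; exists (sieve_max U) => [|W k _]; first exact: cov_max.
by exists I, I; rewrite /= presM.
Qed.

Lemma plus_unit_loc P (X : C) (q : plus P X) :
  locally (fun U (g : hom U X) => exists a, plus_unit P U a = pres (plus P) g q).
Proof.
elim/quot_ind: q => s; exists (ls_sieve s) => [|U g Sg]; first exact: ls_cov.
exists (s U g Sg); rewrite /= quot_mapE; last exact: ls_pull_rel.
apply: class_rel; exists (sieve_max U) => [|V k _]; first exact: cov_max.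
exists I; have Sgk : ls_sieve s V (g \c k) by apply: sarrM.
by exists Sgk; rewrite /= (@mfunE _ _ _ _ s _ _ _ _ _ Sgk).
Qed.

Lemma plus_unit_inj P : loc_inj (plus_unit P).
Proof.
move=> X a b /ls_class[R cR h]; exists R => // U g /h[? [? e]]; exact: e.
Qed.

Lemma plus_map_unit P Q (f : pmap P Q) X (a : P X) :
  plus_map f X (plus_unit P X a) = plus_unit Q X (f X a).
Proof.
rewrite /= quot_mapE; last exact: ls_map_rel.
apply: class_rel; exists (sieve_max X) => [|V k _]; first exact: cov_max.
by exists I, I; rewrite /= pfunE.
Qed.

Lemma plus_separated P (X : C) (q r : plus P X) :
  locally (fun U (g : hom U X) => pres (plus P) g q = pres (plus P) g r) -> q = r.
Proof.
elim/quot_ind: q => s; elim/quot_ind: r => t qr; apply/ls_class.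
have [R cR RR] : locally (fun U (g : hom U X) =>
    exists (Sg : ls_sieve s U g) (Tg : ls_sieve t U g), s U g Sg = t U g Tg).
  apply: (locally_bind qr) => U g /=.
  rewrite !quot_mapE; try exact: ls_pull_rel.
  by move=> /ls_class[R cR h]; exists R.
by exists R.
Qed.

(** An equality in [plus Q] descends locally to [Q], then locally to [P] by hypothesis; [plus P] is
    separated, so the local equality is an equality. *)
Lemma plus_map_inj P Q (f : pmap P Q) : loc_inj f ->
  forall X (q r : plus P X), plus_map f X q = plus_map f X r -> q = r.
Proof.
move=> fi X q r E; apply: plus_separated.
apply: (@locally_bind _ _ (fun U g => (exists a, plus_unit P U a = pres (plus P) g q) /\
    exists b, plus_unit P U b = pres (plus P) g r)).
  apply: (locally_bind (plus_unit_loc q)) => U g [a ea].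
  apply: (locally_mono (plus_unit_loc (pres (plus P) g r))) => V h [b eb].
  by split; [exists (pres P h a); rewrite pfunE ea|exists b; rewrite eb]; rewrite presM.
move=> U g [[a ea] [b eb]].
have E2 : plus_unit Q U (f U a) = plus_unit Q U (f U b).
  by rewrite -!plus_map_unit ea eb !pfunE E.
apply: (locally_bind (plus_unit_inj E2)) => V h; rewrite -!pfunE => /fi.
by move=> /locally_mono; apply=> W k e; rewrite !presM -ea -eb -!pfunE e.
Qed.

Lemma plus_map_surj P Q (f : pmap P Q) : loc_surj f -> loc_surj (plus_map f).
Proof.
move=> fs X q; apply: (locally_bind (plus_unit_loc q)) => U g [b eb].
apply: locally_mono (fs U b) _ => V k [a ea]; exists (plus_unit P V a).
by rewrite plus_map_unit ea pfunE eb presM.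
Qed.

(** Injectivity makes local preimages unique, hence compatible: they form a matching family on the
    sieve of all arrows over which the section has a preimage. *)
Lemma plus_map_bij P Q (f : pmap P Q) : (forall X (a b : P X), f X a = f X b -> a = b) ->
  loc_surj f -> forall X (q : plus Q X), exists r, plus_map f X r = q.
Proof.
move=> fi fs X; elim/quot_ind => t.
pose R : sieve X := @Sieve C X (fun U g => exists (Sg : ls_sieve t U g) a, f U a = t U g Sg)
  (fun U V g h => ltac:(by case=> Sg [a e]; exists (sarrM h Sg), (pres P h a);
     rewrite pfunE e; exact: mfunE)).
have cR : cov R.
  have [T cT TR] : locally (fun U (g : hom U X) => R U g).
    apply: (@locally_bind _ _ (fun U g => ls_sieve t U g)).
      by exists (ls_sieve t) => //; exact: ls_cov.
    move=> U g Sg; apply: (locally_mono (fs U (t U g Sg))) => V h [a ea].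
    by exists (sarrM h Sg), a; rewrite ea; exact: mfunE.
  apply: cov_trans cT _ => U g Tg; suff -> : sieve_pull g R = sieve_max U by exact: cov_max.
  by apply: sieve_ext => V h; split=> // _; apply: TR; apply: sarrM.
have key U g (Rg : R U g) : {a : P U | exists Sg : ls_sieve t U g, f U a = t U g Sg}.
  by apply: cid; case: Rg => Sg [a e]; exists a, Sg.
have mE U V (g : hom U X) (h : hom V U) (Rg : R U g) (Rgh : R V (g \c h)) :
  pres P h (sval (key U g Rg)) = sval (key V (g \c h) Rgh).
  apply: fi; rewrite pfunE.
  have [Sg ->] := svalP (key U g Rg); have [Sgh ->] := svalP (key V (g \c h) Rgh).
  exact: mfunE.
exists (class _ (LocalSection cR (Matching mE))).
rewrite /= quot_mapE; last exact: ls_map_rel.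
apply: class_rel; exists R => // U g Rg; exists Rg.
by have [Sg e] := svalP (key U g Rg); exists Sg.
Qed.

Lemma piso_bij P Q (f : pmap P Q) :
  (forall X (a b : P X), f X a = f X b -> a = b) ->
  (forall X (b : Q X), exists a, f X a = b) -> piso f.
Proof.
move=> fi fs; pose h X b := sval (cid (fs X b)).
have hK X b : f X (h X b) = b by rewrite /h; case: cid.
have hE U V (g : hom U V) (x : Q V) : h U (pres Q g x) = pres P g (h V x).
  by apply: fi; rewrite hK pfunE hK.
exists (PMap hE); split; apply: pmap_ext => U x //=.
exact: fi.
Qed.

(** The first plus construction turns local injectivity into injectivity, and the second then turns
    local surjectivity into surjectivity. Conversely, the two units lose nothing locally. *)
Lemma sheaf_isoP P Q (f : pmap P Q) : sheaf_iso f <-> loc_inj f /\ loc_surj f.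
Proof.
split=> [[h [hf fh]]|[fi fs]]; last first.
  have fi1 := plus_map_inj fi; have fs1 := plus_map_surj fs.
  apply: piso_bij; last exact: plus_map_bij.
  apply: plus_map_inj => X a b /fi1 ->; exact: locally_triv.
have eP X x : h X (sheafify_map f X x) = x.
  exact: (congr1 (fun k : pmap (sheafify P) (sheafify P) => k X x) hf).
have eQ X x : sheafify_map f X (h X x) = x.
  exact: (congr1 (fun k : pmap (sheafify Q) (sheafify Q) => k X x) fh).
pose uP := plus_unit (plus P); pose uQ := plus_unit (plus Q).
have E X a : sheafify_map f X (uP X (plus_unit P X a)) = uQ X (plus_unit Q X (f X a)).
  by rewrite /sheafify_map /uP /uQ !plus_map_unit.
split=> X.
- move=> a b ab.
  have e : uP X (plus_unit P X a) = uP X (plus_unit P X b) by rewrite -[LHS]eP -[RHS]eP !E ab.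
  apply: (locally_bind (plus_unit_inj e)) => U g.
  by rewrite -!pfunE => /plus_unit_inj /locally_mono; apply=> V k; rewrite !presM.
- move=> b; pose c := h X (uQ X (plus_unit Q X b)).
  apply: (locally_bind (plus_unit_loc c)) => U g [c1 e1].
  apply: (locally_bind (plus_unit_loc c1)) => V k [a e2].
  have e3 : uQ V (plus_unit Q V (f V a)) = uQ V (plus_unit Q V (pres Q (g \c k) b)).
    rewrite -E e2 /uP pfunE e1.
    rewrite -(@presM _ (sheafify P)) pfunE eQ.
    by rewrite (pfunE (plus_unit Q)) (pfunE uQ).
  apply: (locally_bind (plus_unit_inj e3)) => W l; rewrite -!pfunE.
  move=> /plus_unit_inj /locally_mono; apply=> Z o e4; exists (pres P (l \c o) a).
  by rewrite presM pfunE e4 -!presM !compA.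
Qed.

End LocalIso.

(** * Horn lifting *)

Notation res K t x := (@pres Delta K _ _ (t : dhom _ _) x).

Lemma resM (K : sset) l m n (s : dhom m n) (t : dhom l m) (x : K n) :
  res K (dcomp s t) x = res K t (res K s x).
Proof. exact: (@presM Delta K l m n s t x). Qed.

Lemma dcompE l m n (s : dhom m n) (t : dhom l m) i : dcomp s t i = s (t i).
Proof. exact: dmkE. Qed.

Lemma dcompA k l m n (s : dhom m n) (t : dhom l m) (u : dhom k l) :
  dcomp s (dcomp t u) = dcomp (dcomp s t) u.
Proof. by apply: dhom_ext => i; rewrite !dmkE. Qed.

Lemma resE (K L : sset) (f : pmap K L) m n (t : dhom m n) (x : K n) :
  f m (res K t x) = res L t (f n x).
Proof. exact: (@pfunE Delta K L f m n t x). Qed.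

Lemma spmap_ext (C : category) (F G : spresheaf C) (f g : spmap F G) :
  (forall U n x, f U n x = g U n x) -> f = g.
Proof.
case: f g => [f pf] [g pg] /= fg.
have E : f = g by apply: functional_extensionality_dep => U; apply: pmap_ext; exact: fg.
by subst g; rewrite (Prop_irrelevance pf pg).
Qed.

(** Local fibrations with the tensors removed by adjunction and the simplex of [G] by the Yoneda
    lemma. In this form the condition can be passed through [Ex]. *)
Definition horn_lifting (C : site) (J G : spresheaf C) (p : spmap J G) : Prop :=
  forall (n : nat) (k : 'I_n.+1) (X : C), 0 < n ->
  forall (u : pmap (horn k) (J X)) (w : G X n),
    (forall m (a : horn k m), p X m (u m a) = res (G X) (sval a) w) ->
  locally (fun U (g : hom U X) => exists l : J U n,
    (forall m (a : horn k m), res (J U) (sval a) l = spres J g m (u m a)) /\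
    p U n l = spres G g n w).

Program Definition tensor_adj (C : category) (F : spresheaf C) (K : sset) (X : C)
    (u : pmap K (F X)) : spmap (tensor K X) F :=
  @SPMap C (tensor K X) F (fun U =>
    @PMap Delta (tensor_ob K (hom U X)) (F U) (fun n x => spres F x.2 n (u n x.1)) _) _.
Next Obligation. by move=> *; rewrite /= !pfunE. Qed.
Next Obligation. by move=> *; apply: pmap_ext => n x; rewrite /= spresMx. Qed.

Program Definition yoneda (K : sset) n (x : K n) : pmap (simplex n) K :=
  @PMap Delta (simplex n) K (fun m a => res K a x) _.
Next Obligation. by move=> K n x U V g a; exact: (@resM K U V n a g x). Qed.

Lemma yonedaE (K : sset) n (f : pmap (simplex n) K) m a :
  f m a = res K a (f n (did n)).
Proof.
rewrite -resE; congr (f m _); apply: dhom_ext => i.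
by rewrite !dmkE.
Qed.

Lemma yonedaK (K : sset) n (f : pmap (simplex n) K) : yoneda (f n (did n)) = f.
Proof. by apply: pmap_ext => m a; rewrite /= -yonedaE. Qed.

Lemma yoneda_id (K : sset) n (x : K n) : yoneda x n (did n) = x.
Proof. exact: (@pres1 Delta K n x). Qed.

Lemma yoneda_map (K L : sset) (f : pmap K L) n (x : K n) :
  pmap_comp f (yoneda x) = yoneda (f n x).
Proof. by apply: pmap_ext => m a; rewrite /= resE. Qed.

Lemma local_fibration_horn_lifting (C : site) (J G : spresheaf C) (p : spmap J G) :
  local_fibration p -> horn_lifting p.
Proof.
move=> hp n k X n0 u w uw.
have [|S cS SP] := hp n k X n0 (tensor_adj u) (tensor_adj (yoneda w)).
  by apply: spmap_ext => U m [a g] /=; rewrite comp1m spfunEx uw.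
exists S => // U g /SP[l [l1 l2]]; exists (l U n (did n, idm U)); split=> [m a|].
  have := congr1 (fun h : spmap (tensor (horn k) U) J => h U m (a, idm U)) l1.
  rewrite /= !compm1 => <-; rewrite -resE /=; congr (l U m (_, _)).
  exact: (@comp1m Delta m n _).
have := congr1 (fun h : spmap (tensor (simplex n) U) G => h U n (did n, idm U)) l2.
by rewrite /= compm1 => ->; congr (spres G g n _); exact: (@pres1 Delta (G X) n w).
Qed.

(** * Filling along a collapse *)

(* A family of functions defined on all simplices of [B], of which only the values
   on the subcomplex [D] matter. *)
Definition nat_on (B : sset) (D : forall m, B m -> Prop) (K : sset)
    (f : forall m, B m -> K m) : Prop :=
  forall l m (t : dhom l m) (c : B m), D m c -> f l (res B t c) = res K t (f m c).

Definition glue (B : sset) (D : forall m, B m -> Prop) (K : sset)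
    (f g : forall m, B m -> K m) m (c : B m) : K m :=
  if pselect (D m c) then f m c else g m c.

Lemma glue_in (B : sset) (D : forall m, B m -> Prop) (K : sset)
    (f g : forall m, B m -> K m) m (c : B m) : D m c -> glue D f g c = f m c.
Proof. by rewrite /glue => d; case: pselect. Qed.

Lemma glue_out (B : sset) (D : forall m, B m -> Prop) (K : sset)
    (f g : forall m, B m -> K m) m (c : B m) :
  (D m c -> f m c = g m c) -> glue D f g c = g m c.
Proof. by rewrite /glue; case: pselect => // d ->. Qed.

Lemma nat_on_glue (B : sset) (D D' : forall m, B m -> Prop) (K : sset)
    (f g : forall m, B m -> K m) :
  (forall l m (t : dhom l m) c, D m c -> D l (res B t c)) ->
  (forall l m (t : dhom l m) c, D' m c -> D' l (res B t c)) ->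
  nat_on D f -> nat_on D' g -> (forall m c, D m c -> D' m c -> f m c = g m c) ->
  nat_on (fun m c => D m c \/ D' m c) (glue D f g).
Proof.
move=> cD cD' nf ng fg l m t c Dc.
have [d|nd] := pselect (D m c).
  by rewrite !glue_in //; [exact: nf|exact: cD].
have {Dc} d' : D' m c by case: Dc.
have -> : glue D f g c = g m c by apply: glue_out => /nd.
by rewrite glue_out ?ng // => d; rewrite -ng // fg //; exact: cD'.
Qed.

Lemma nat_on_pmap (B : sset) (D : forall m, B m -> Prop) (K : sset) (f : pmap B K) :
  nat_on D f.
Proof. by move=> l m t c _; rewrite resE. Qed.

(* [B] is the simplicial set of nonempty weakly increasing sequences for [r], which
   need not be reflexive: [vt m c i] is the [i]-th vertex of [c]. *)
Record chain_model (T : finType) (r : rel T) (B : sset)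
    (vt : forall m, B m -> 'I_m.+1 -> T) : Prop := ChainModel {
  r_trans : transitive r;
  r_anti : forall x y, r x y -> r y x -> x = y;
  vt_res : forall l m (t : dhom l m) (c : B m) i, vt _ (res B t c) i = vt _ c (t i);
  vt_inj : forall m (c d : B m), (forall i, vt _ c i = vt _ d i) -> c = d;
  vt_mono : forall m (c : B m) (i j : 'I_m.+1), i <= j -> r (vt _ c i) (vt _ c j);
  vt_make : forall m (h : 'I_m.+1 -> T), (forall i j : 'I_m.+1, i <= j -> r (h i) (h j)) ->
    exists c : B m, forall i, vt _ c i = h i }.

Definition chain (T : finType) (r : rel T) (S : {set T}) : bool :=
  [forall x in S, forall y in S, r x y || r y x].

Lemma chainP (T : finType) (r : rel T) (S : {set T}) :
  reflect {in S &, forall x y, r x y || r y x} (chain r S).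
Proof.
apply: (iffP forall_inP) => [h x y xS yS|h x xS].
  by have /forall_inP := h x xS; apply.
by apply/forall_inP => y yS; exact: h.
Qed.

Lemma chain_sub (T : finType) (r : rel T) (S S' : {set T}) :
  S' \subset S -> chain r S -> chain r S'.
Proof. by move=> /subsetP ss /chainP h; apply/chainP => x y /ss xS /ss; exact: h. Qed.

(** [r] is total and reflexive only on [S], so the sorting lemmas relative to a subset are used. The
    result presents [S] as a nondegenerate simplex of dimension [#|S|.-1]. *)
Lemma chain_enum (T : finType) (r : rel T) (S : {set T}) :
  transitive r -> (forall x y, r x y -> r y x -> x = y) ->
  chain r S -> 0 < #|S| ->
  exists s : 'I_#|S|.-1.+1 -> T, [/\ injective s, forall i, s i \in S,
    forall x, x \in S -> exists i, s i = x & forall i j, r (s i) (s j) = (i <= j)].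
Proof.
move=> rt ra /chainP cS S0; pose e := sort r (enum S).
have [x0 x0S] : exists x0, x0 \in S by apply/card_gt0P.
have se : size e = #|S|.-1.+1 by rewrite size_sort -cardE prednK.
have me x : (x \in e) = (x \in S) by rewrite mem_sort mem_enum.
have ue : uniq e by rewrite sort_uniq enum_uniq.
have ae : all (mem S) (enum S) by apply/allP => x; rewrite mem_enum.
have so : sorted r e.
  by apply: (@sort_sorted_in T (mem S) r) => // x y; exact: cS.
have ho (i j : 'I_#|S|.-1.+1) : i <= j -> r (nth x0 e i) (nth x0 e j).
  move=> ij; apply: (@sorted_leq_nth_in T (mem S) r _ _ x0 e) => //.
  - by move=> x y z _ _ _; exact: rt.
  - by move=> x xS; have := cS x x xS xS; rewrite orbb.
  - by rewrite all_sort.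
  - by rewrite inE se.
  - by rewrite inE se.
exists (fun i => nth x0 e i); split=> [i j /eqP|i|x xS|i j].
- by rewrite nth_uniq ?se // => /eqP /val_inj.
- by rewrite -me mem_nth // se.
- have ix : index x e < #|S|.-1.+1 by rewrite -se index_mem me.
  by exists (Ordinal ix); rewrite /= nth_index // me.
- case: leqP => [/ho //|ji]; apply/negbTE/negP => rij.
  have /eqP := ra _ _ rij (ho _ _ (ltnW ji)).
  by rewrite nth_uniq ?se // => /eqP E; rewrite E ltnn in ji.
Qed.

Section Collapse.
Variables (T : finType) (r : rel T) (B : sset) (vt : forall m, B m -> 'I_m.+1 -> T).
Hypothesis model : chain_model r vt.

Definition vertices m (c : B m) : {set T} := [set vt c i | i : 'I_m.+1].

Lemma vertices_res l m (t : dhom l m) (c : B m) : vertices (res B t c) \subset vertices c.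
Proof. by apply/subsetP => _ /imsetP[i _ ->]; rewrite (vt_res model) imset_f. Qed.

Lemma chain_vertices m (c : B m) : chain r (vertices c).
Proof.
apply/chainP => _ _ /imsetP[i _ ->] /imsetP[j _ ->].
by case: (leqP i j) => [|/ltnW] /(vt_mono model) -> //; rewrite orbT.
Qed.

Variables (A : pred {set T}) (W : {set T}) (v : {set T} -> T).
Hypothesis A_sub : forall S S' : {set T}, S' \subset S -> A S -> A S'.
Hypothesis A0 : A set0.

(* Outside [A], adding or removing the vertex [v (S :&: W)] is a perfect matching
   of the chains [S]; the chains are attached in pairs, by horn fillings. *)
Hypothesis pivot : forall S, chain r S -> ~~ A S ->
  [/\ v (S :&: W) \notin W, chain r (v (S :&: W) |: S) & ~~ A (S :\ v (S :&: W))].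

Variables (C : site) (J G : spresheaf C) (p : spmap J G).
Hypothesis p_lift : horn_lifting p.

Let on (D : {set {set T}}) m (c : B m) : Prop := vertices c \in D.

Lemma pivotI S : chain r S -> ~~ A S -> (v (S :&: W) |: S) :&: W = S :&: W.
Proof.
move=> cS nA; have [vW _ _] := pivot cS nA; apply/setP => x; rewrite !inE.
by case: eqP => //= ->; rewrite (negbTE vW) andbF.
Qed.

Let extends (X : C) (D : {set {set T}}) :=
  forall (phi : forall m, B m -> J X m) (psi : pmap B (G X)),
  nat_on (on D) phi -> (forall m c, on D c -> p X m (phi m c) = psi m c) ->
  locally (fun U (g : hom U X) => exists Phi : pmap B (J U),
    (forall m (c : B m), on D c -> Phi m c = spres J g m (phi m c)) /\
    (forall m (c : B m), p U m (Phi m c) = spres G g m (psi m c))).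

(** A stage of the attaching process: a subcomplex containing [A] which, outside [A], contains a
    chain without its pivot only together with its partner. *)
Record admissible (D : {set {set T}}) : Prop := Admissible {
  ad_sub : forall S S' : {set T}, S' \subset S -> S \in D -> S' \in D;
  ad_A : forall S, A S -> S \in D;
  ad_pivot : forall S, chain r S -> ~~ A S -> S \in D -> v (S :&: W) |: S \in D }.

(** [S] minimises [#|S| + #|S :&: W|] among the missing chains that contain their pivot. If [S :\ b]
    were missing too, adding its pivot would give a smaller candidate. For [b] in [W] the new pivot
    costs at most the vertex gained by deleting [b], and the second term drops; for [b] outside [W]
    the pivot is unchanged and already present, and the first term drops. *)
Lemma upper_chain D S0 : admissible D -> chain r S0 -> S0 \notin D ->
  exists S, [/\ chain r S, S \notin D, v (S :&: W) \in S &
    forall b, b \in S -> b != v (S :&: W) -> S :\ b \in D].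
Proof.
case=> dS dA dP cS0 nD0.
pose up S := [&& chain r S, S \notin D & v (S :&: W) \in S].
have nA S : S \notin D -> ~~ A S by apply: contra => /dA.
have upv S : chain r S -> S \notin D -> up (v (S :&: W) |: S).
  move=> cS nD; have [_ cv _] := pivot cS (nA _ nD).
  rewrite /up cv pivotI ?setU11 ?nA // andbT /=.
  by apply: contra nD; apply: dS; exact: subsetUr.
have [S [/and3P[cS nD vS] mS]] : exists S : {set T}, up S /\
    forall S' : {set T}, up S' -> #|S| + #|S :&: W| <= #|S'| + #|S' :&: W|.
  have [S uS mS] := @arg_minnP _ (v (S0 :&: W) |: S0) up
    (fun S : {set T} => #|S| + #|S :&: W|) (upv _ cS0 nD0).
  by exists S.
exists S; split=> // b bS bv; apply/negPn/negP => nDb.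
have cb : chain r (S :\ b) by apply: chain_sub cS; exact: subD1set.
have := mS _ (upv _ cb nDb); rewrite leqNgt => /negP; apply.
rewrite pivotI ?nA // cardsU1 (cardsD1 b S) bS.
have E : (S :\ b) :&: W = (S :&: W) :\ b by apply/setP => x; rewrite !inE andbA.
have [bW|bW] := boolP (b \in W).
  have -> : #|S :&: W| = #|(S :\ b) :&: W|.+1 by rewrite (cardsD1 b (S :&: W)) in_setI bS bW E.
  by rewrite addnS ltnS leq_add2r leq_add2r leq_b1.
have E' : (S :\ b) :&: W = S :&: W.
  by rewrite E; apply/setDidPl; rewrite disjoint_sym disjoints1 inE (negbTE bW) andbF.
by rewrite E' in_setD1 eq_sym bv vS !addSn !add0n ltnS.
Qed.

(* One horn filling attaches [S] and [S] minus its pivot. *)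
Lemma attach D S (X : C) (phi : forall m, B m -> J X m) (psi : pmap B (G X)) :
  admissible D -> chain r S -> S \notin D -> v (S :&: W) \in S ->
  (forall b, b \in S -> b != v (S :&: W) -> S :\ b \in D) ->
  nat_on (on D) phi -> (forall m c, on D c -> p X m (phi m c) = psi m c) ->
  locally (fun U (g : hom U X) => exists phi' : forall m, B m -> J U m,
    [/\ nat_on (on (S |: (S :\ v (S :&: W) |: D))) phi',
      (forall m c, on D c -> phi' m c = spres J g m (phi m c)) &
      (forall m c, on (S |: (S :\ v (S :&: W) |: D)) c ->
        p U m (phi' m c) = spres G g m (psi m c))]).
Proof.
move=> [dS dA dP] cS nD; set v0 := v _ => vS hb nphi pphi.
have nA : ~~ A S by apply: contra nD => /dA.
have [vW _ nAv] := pivot cS nA; rewrite -/v0 in vW nAv.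
(* The partner is missing as well: otherwise [ad_pivot] would put [S] into [D]. *)
have nDv : S :\ v0 \notin D.
  have E : (S :\ v0) :&: W = S :&: W.
    by apply/setP => x; rewrite !inE; case: eqP => //= ->; rewrite (negbTE vW) andbF.
  apply: contra nD => /(dP _ (chain_sub (subD1set _ _) cS) nAv).
  by rewrite E -/v0 setD1K.
have S1 : 1 < #|S|.
  rewrite (cardsD1 v0) vS ltnS card_gt0; apply: contra nAv => /eqP ->; exact: A0.
have [s [si sS sM sr]] := chain_enum (r_trans model) (r_anti model) cS (ltnW S1).
set d := #|S|.-1 in s si sS sM sr.
have [sB sBE] : exists c : B d, forall i, vt c i = s i.
  by apply: (vt_make model) => i j; rewrite sr.
have [k kE] := sM v0 vS.
have vsB l (a : dhom l d) : vertices (res B a sB) = [set s (a i) | i : 'I_l.+1].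
  by apply: eq_imset => i; rewrite (vt_res model) sBE.
have hornD l (a : dhom l d) : in_horn k a -> on D (res B a sB).
  case=> j [jk ja]; apply: (dS (S :\ s j)); last first.
    by apply: hb => //; rewrite -kE; apply/eqP => /si.
  rewrite vsB; apply/subsetP => _ /imsetP[i _ ->].
  by rewrite !inE sS andbT; apply/eqP => /si; exact: ja.
(* All faces of the simplex [sB] on [S] lie in [D], except the one opposite to the pivot, which is
   vertex number [k]. *)
pose uf m (a : horn k m) : J X m := phi m (res B (sval a) sB).
have ufE l m (t : dhom l m) (a : horn k m) : uf l (res (horn k) t a) = res (J X) t (uf m a).
  rewrite /uf -nphi; last by apply: hornD; exact: svalP a.
  by congr (phi l _); rewrite -resM.
pose u : pmap (horn k) (J X) := @PMap Delta (horn k) (J X) uf ufE.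
have uw m (a : horn k m) : p X m (u m a) = res (G X) (sval a) (psi d sB).
  rewrite /= /uf pphi ?resE //; by apply: hornD; exact: svalP a.
have d0 : 0 < d by rewrite /d -ltnS prednK // ltnW.
apply: (locally_mono (p_lift d0 uw)) => U g [x [xu xw]].
have inj l (a b : dhom l d) : res B a sB = res B b sB -> a = b.
  move=> E; apply: dhom_ext => i; apply: si.
  by rewrite -!sBE -!(vt_res model) E.
have fact m (c : B m) : vertices c \subset S -> exists a : dhom m d, c = res B a sB.
  move=> /subsetP cs; pose f i := sval (cid (sM _ (cs _ (imset_f (vt c) (isT : i \in 'I_m.+1))))).
  have fE i : s (f i) = vt c i by rewrite /f; case: cid.
  have fm (i j : 'I_m.+1) : i <= j -> f i <= f j.
    by move=> ij; rewrite -sr !fE; exact: (vt_mono model).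
  exists (dmk fm); apply: (vt_inj model) => i.
  by rewrite (vt_res model) sBE dmkE fE.
pose phi' m (c : B m) : J U m := if vertices c \in D then spres J g m (phi m c) else
  if pselect (exists a : dhom m d, c = res B a sB) is left h
  then res (J U) (sval (cid h)) x else spres J g m (phi m c).
have phi'D m (c : B m) : on D c -> phi' m c = spres J g m (phi m c).
  by rewrite /on /phi' => ->.
have phi'S m (a : dhom m d) : phi' m (res B a sB) = res (J U) a x.
  rewrite /phi'; case: ifPn => Da; last first.
    by case: pselect => [h|[]]; [case: cid => b /= /inj ->|exists a].
  (* A simplex over [S] outside the horn has all of [S :\ v0] among its vertices, hence is not in
     [D]: the old and the new values meet only on the horn. *)
  have ha : in_horn k a.
    apply: contrapT => nh; move: nDv; rewrite (dS _ _ _ Da) //.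
    apply/subsetP => y /setD1P[yv yS]; have [j jy] := sM y yS; rewrite vsB.
    apply: contrapT => ny; apply: nh; exists j; split.
      by move=> jk; move: yv; rewrite -jy jk kE eqxx.
    by move=> i aij; apply: ny; rewrite -jy -aij; apply: imset_f.
  have := xu m (exist _ a ha); rewrite /= => ->; by rewrite /uf.
have cases m (c : B m) : on (S |: (S :\ v0 |: D)) c ->
    on D c \/ exists a : dhom m d, c = res B a sB.
  rewrite /on !inE => /or3P[/eqP E|/eqP E|]; last by left.
    by right; apply: fact; rewrite E.
  by right; apply: fact; rewrite E subD1set.
exists phi'; split=> // [l m t c /cases[Dc|[a ->]]|m c /cases[Dc|[a ->]]].
- rewrite !phi'D //; last by apply: dS Dc; exact: vertices_res.
  by rewrite nphi // resE.
- by rewrite -resM !phi'S resM.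
- by rewrite phi'D // spfunEx pphi.
- by rewrite phi'S resE xw !resE.
Qed.

Lemma extend D X : admissible D -> extends X D.
Proof.
have [n] := ubnP #|[set S | chain r S && (S \notin D)]|.
elim: n D X => // n IH D X; rewrite ltnS => hn aD phi psi nphi pphi.
have [/set0Pn[S0]|] := boolP ([set S | chain r S && (S \notin D)] != set0).
  rewrite inE => /andP[cS0 nD0].
  have [S [cS nD vS hb]] := upper_chain aD cS0 nD0.
  have := attach aD cS nD vS hb nphi pphi; set v0 := v (S :&: W) in vS hb *.
  set D' := S |: _ => /locally_bind; apply => U g [phi' [n' e' p']].
  have nA : ~~ A S by apply: contra nD; exact: ad_A.
  have [vW _ nAv] := pivot cS nA; rewrite -/v0 in vW nAv.
  have aD' : admissible D'.
    split=> [S1 S2 S21|S1 A1|S1 c1 nA1]; rewrite !inE.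
    (* A proper subset of [S] omits some [b]. If [b] is not the pivot, [hb] applies; if it is, the
       subset is [S :\ v0] or omits a further vertex, to which [hb] applies. *)
    - have sub (S3 : {set T}) : S3 \subset S -> [|| S3 == S, S3 == S :\ v0 | S3 \in D].
        move=> S3S; have [->|ne] := eqVneq S3 S; first by [].
        have /set0Pn[b] : S :\: S3 != set0.
          by rewrite setD_eq0; apply: contra ne => SS3; rewrite eqEsubset S3S.
        rewrite inE => /andP[b3 bS].
        have Sb : S3 \subset S :\ b.
          apply/subsetP => y y3; rewrite !inE (subsetP S3S) // andbT.
          by apply: contra b3 => /eqP <-.
        have [bv|bv] := eqVneq b v0.
          rewrite /= -bv; have [//|ne3 /=] := eqVneq S3 (S :\ b).
          have /set0Pn[b'] : (S :\ b) :\: S3 != set0.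
            by rewrite setD_eq0; apply: contra ne3 => SS3; rewrite eqEsubset Sb.
          rewrite !inE => /and3P[b'3 b'b b'S].
          have : S :\ b' \in D by apply: hb => //; rewrite -bv.
          apply: (ad_sub aD); apply/subsetP => y y3; rewrite !inE (subsetP S3S) // andbT.
          by apply: contra b'3 => /eqP <-.
        by rewrite (ad_sub aD Sb (hb _ bS bv)) !orbT.
      case/or3P=> [/eqP E|/eqP E|D1].
      + by apply: sub; rewrite -E.
      + by apply: sub; apply: (subset_trans S21); rewrite E subD1set.
      + by rewrite (ad_sub aD S21 D1) !orbT.
    - by rewrite (ad_A aD A1) !orbT.
    - case/or3P=> [/eqP E|/eqP E|D1].
      + by rewrite E -/v0 (setUidPr _) ?sub1set ?eqxx.
      + have E2 : S1 :&: W = S :&: W.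
          rewrite E; apply/setP => x; rewrite !inE; case: eqP => //= ->.
          by rewrite (negbTE vW) andbF.
        by rewrite E2 -/v0 E setD1K ?eqxx.
      + by rewrite (ad_pivot aD c1 nA1 D1) !orbT.
  have lt : #|[set S | chain r S && (S \notin D')]| < n.
    apply: leq_trans hn; apply: proper_card; apply/properP; split.
      apply/subsetP => y; rewrite !inE => /andP[-> /=].
      by rewrite !negb_or => /and3P[].
    by exists S; rewrite !inE ?cS ?nD // eqxx.
  have [|] := IH D' U lt aD' phi' (pmap_comp (spres G g) psi) n'.
    by move=> m c /p'.
  move=> R cR RP; exists R => // V k /RP[Phi [Phi1 Phi2]]; exists Phi; split=> m c.
    move=> Dc; rewrite Phi1 ?e' ?spresMx //.
    by rewrite /on !inE; apply/or3P/Or33.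
  by rewrite Phi2 /= spresMx.
move/negPn/eqP => all0.
have onD m (c : B m) : on D c.
  apply: contrapT => /negP nD; have : vertices c \in [set S | chain r S && (S \notin D)].
    by rewrite inE nD chain_vertices.
  by rewrite all0 inE.
have phiE l m (t : dhom l m) c : phi l (res B t c) = res (J X) t (phi m c).
  exact: nphi.
apply: locally_triv => U g.
exists (pmap_comp (spres J g) (@PMap Delta B (J X) phi phiE)); split=> // m c.
by rewrite /= spfunEx pphi.
Qed.

Lemma collapse_lift (X : C) (phi : forall m, B m -> J X m) (psi : pmap B (G X)) :
  nat_on (fun m c => A (vertices c)) phi ->
  (forall m c, A (vertices c) -> p X m (phi m c) = psi m c) ->
  locally (fun U (g : hom U X) => exists Phi : pmap B (J U),
    (forall m (c : B m), A (vertices c) -> Phi m c = spres J g m (phi m c)) /\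
    (forall m (c : B m), p U m (Phi m c) = spres G g m (psi m c))).
Proof.
move=> nphi pphi; pose D := [set S | A S].
have aD : admissible D.
  split=> [S S' SS|S|S cS nA]; rewrite !inE //; first exact: A_sub.
  by rewrite (negbTE nA).
have [||R cR RP] := @extend D X aD phi psi.
- by move=> l m t c; rewrite /on inE; exact: nphi.
- by move=> m c; rewrite /on inE; exact: pphi.
exists R => // U g /RP[Phi [P1 P2]]; exists Phi; split=> // m c Ac.
by apply: P1; rewrite /on inE.
Qed.

End Collapse.

Definition kan (K : sset) : Prop :=
  forall n (k : 'I_n.+1), 0 < n -> forall u : pmap (horn k) K,
  exists l : K n, forall m (a : horn k m), res K (sval a) l = u m a.

(* A Kan complex is a local fibration over the point on the one-arrow site, where
   local existence is existence. *)
Section OneArrowSite.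

Lemma unit_eq (a b : unit) : a = b.
Proof. by case: a; case: b. Qed.

Program Definition one_cat : category :=
  @Category unit (fun _ _ => unit) (fun _ => tt) (fun _ _ _ _ _ => tt) _ _ _.
Next Obligation. by move=> ? ? []. Qed.
Next Obligation. by move=> ? ? []. Qed.
Next Obligation. by []. Qed.

Program Definition one_site : site :=
  @Site one_cat (fun X S => S tt (tt : @hom one_cat tt X)) _ _ _.
Next Obligation. by []. Qed.
Next Obligation. by move=> [] [] [] S. Qed.
Next Obligation. by move=> [] S R h /(_ _ _ h). Qed.

Program Definition const_sp (K : sset) : spresheaf one_cat :=
  @SPresheaf one_cat (fun _ => K) (fun _ _ _ => pmap_id K) _ _.
Next Obligation. by []. Qed.
Next Obligation. by move=> *; apply: pmap_ext. Qed.

Program Definition point : sset := @Presheaf Delta (fun _ => unit) (fun _ _ _ _ => tt) _ _.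
Next Obligation. by move=> ? []. Qed.
Next Obligation. by []. Qed.

Program Definition to_point (K : sset) : pmap K point :=
  @PMap Delta K point (fun _ _ => tt) _.
Next Obligation. by []. Qed.

Program Definition const_to_point (K : sset) : spmap (const_sp K) (const_sp point) :=
  @SPMap one_cat (const_sp K) (const_sp point) (fun _ => to_point K) _.
Next Obligation. by move=> *; apply: pmap_ext. Qed.

Lemma kan_horn_lifting (K : sset) : kan K ->
  @horn_lifting one_site (const_sp K) (const_sp point) (const_to_point K).
Proof.
move=> hK n k X n0 u w _; apply: locally_triv => U g.
have [l hl] := hK n k n0 u; exists l; split; [exact: hl|exact: unit_eq].
Qed.

End OneArrowSite.

Lemma collapse_fill (T : finType) (r : rel T) (B : sset)
    (vt : forall m, B m -> 'I_m.+1 -> T) (A : pred {set T}) (W : {set T})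
    (v : {set T} -> T) (K : sset) (phi : forall m, B m -> K m) :
  chain_model r vt -> (forall S S' : {set T}, S' \subset S -> A S -> A S') -> A set0 ->
  (forall S, chain r S -> ~~ A S -> [/\ v (S :&: W) \notin W,
    chain r (v (S :&: W) |: S) & ~~ A (S :\ v (S :&: W))]) ->
  kan K -> nat_on (fun m c => A (vertices vt c)) phi ->
  exists Phi : pmap B K, forall m c, A (vertices vt c) -> Phi m c = phi m c.
Proof.
move=> model As A0 piv /kan_horn_lifting hK nphi.
have [|S cS SP] := @collapse_lift T r B vt model A W v As A0 piv one_site _ _ _ hK tt phi
  (to_point B) nphi.
  by move=> *; exact: unit_eq.
by have [Phi [h _]] := SP tt tt cS; exists Phi.
Qed.

(** * Prisms *)

Section Prism.
Variables (m k : nat) (i : 'I_k.+1).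

Definition prism : sset := sprod (simplex m) (simplex k).
Let T : finType := ('I_m.+1 * 'I_k.+1)%type.

Definition prism_le : rel T := fun x y => (x.1 <= y.1) && (x.2 <= y.2).

Definition prism_vt n (c : prism n) (j : 'I_n.+1) : T := (dfun c.1 j, dfun c.2 j).

Lemma prism_model : chain_model prism_le prism_vt.
Proof.
split.
- move=> y x z /andP[h1 h2] /andP[h3 h4].
  by apply/andP; split; [exact: leq_trans h3|exact: leq_trans h4].
- move=> [x x'] [y y'] /andP[/= h1 h2] /andP[/= h3 h4]; congr pair; apply: val_inj.
    by apply/eqP; rewrite eqn_leq h1.
  by apply/eqP; rewrite eqn_leq h2.
- by move=> l n t [a b] j; rewrite /prism_vt /= !dmkE.
- move=> n [a b] [a' b'] h; congr pair; apply: dhom_ext => j;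
    by have [] := h j.
- by move=> n [a b] j j' jj; rewrite /prism_le /= !dfun_mono.
- move=> n h hm.
  have h1 (j j' : 'I_n.+1) : j <= j' -> (h j).1 <= (h j').1 by move=> /hm/andP[].
  have h2 (j j' : 'I_n.+1) : j <= j' -> (h j).2 <= (h j').2 by move=> /hm/andP[].
  by exists (dmk h1, dmk h2) => j; rewrite /prism_vt /= !dmkE; case: (h j).
Qed.

(** The chains of $\partial\Delta^m\times\Delta^k\cup\Delta^m\times\Lambda^{k,i}$. *)
Definition prism_horn (S : {set T}) : bool :=
  [exists j, forall x in S, x.1 != j] || [exists j, (j != i) && [forall x in S, x.2 != j]].

Lemma prism_hornP n (c : prism n) :
  prism_horn (vertices prism_vt c) <-> boundary c.1 \/ in_horn i c.2.
Proof.
rewrite /prism_horn; split.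
  case/orP=> [/existsP[j /forall_inP h]|/existsP[j /andP[/eqP ji /forall_inP h]]].
    left; exists j => x xj; have := h _ (imset_f (prism_vt c) (isT : x \in 'I_n.+1)).
    by rewrite /= xj eqxx.
  right; exists j; split=> // x xj; have := h _ (imset_f (prism_vt c) (isT : x \in 'I_n.+1)).
  by rewrite /= xj eqxx.
case=> [[j h]|[j [/eqP ji h]]]; apply/orP; [left|right]; apply/existsP; exists j.
  by apply/forall_inP => _ /imsetP[x _ ->]; apply/eqP; exact: h.
by rewrite ji; apply/forall_inP => _ /imsetP[x _ ->]; apply/eqP; exact: h.
Qed.

Lemma prism_horn_sub (S S' : {set T}) : S' \subset S -> prism_horn S -> prism_horn S'.
Proof.
move=> /subsetP ss /orP[/existsP[j /forall_inP h]|/existsP[j /andP[ji /forall_inP h]]];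
  apply/orP; [left|right]; apply/existsP; exists j; rewrite ?ji; apply/forall_inP => x /ss;
  exact: h.
Qed.

Lemma prism_horn0 : prism_horn set0.
Proof. by apply/orP; left; apply/existsP; exists ord0; apply/forall_inP => x; rewrite inE. Qed.

Lemma prism_hornN S : ~~ prism_horn S ->
  (forall j, exists2 x, x \in S & x.1 = j) /\
  (forall j, j != i -> exists2 x, x \in S & x.2 = j).
Proof.
rewrite negb_or => /andP[/existsPn h1 /existsPn h2]; split=> j.
  by have /forall_inPn[x xS /negPn/eqP xj] := h1 j; exists x.
by have := h2 j => /nandP[/negPf -> //|/forall_inPn[x xS /negPn/eqP xj] _]; exists x.
Qed.

(* The vertex toggled in a chain sits on level [i], over the element of the chain
   closest to level [i] among those on the chosen side of that level. *)
Lemma prism_pivot_cond (side : pred 'I_k.+1) (v : {set T} -> T) :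
  ~~ side i -> (exists j, side j) -> (forall P, (v P).2 = i) ->
  (forall S, chain prism_le S -> (exists2 x, x \in S & side x.2) ->
    exists2 x, x \in S :&: [set x | side x.2] & x.1 = (v (S :&: [set x | side x.2])).1) ->
  (forall S x, chain prism_le S -> x \in S -> (exists2 x, x \in S & side x.2) ->
    prism_le x (v (S :&: [set x | side x.2])) || prism_le (v (S :&: [set x | side x.2])) x) ->
  forall S, chain prism_le S -> ~~ prism_horn S ->
  let W := [set x | side x.2] in [/\ v (S :&: W) \notin W,
    chain prism_le (v (S :&: W) |: S) & ~~ prism_horn (S :\ v (S :&: W))].
Proof.
move=> si [j0 sj0] vi v1 v2 S cS nS W.
have [h1 h2] := prism_hornN nS.
have neq x : x.2 != i -> x != v (S :&: W) by apply: contra => /eqP ->; rewrite vi.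
have nes j : side j -> j != i by move=> sj; apply/eqP => E; move: si; rewrite -E sj.
have ne : exists2 x, x \in S & side x.2.
  by have [x xS xj] := h2 _ (nes _ sj0); exists x => //; rewrite xj.
split.
- by rewrite inE vi.
- apply/chainP => x y /setU1P[->|xS] /setU1P[->|yS].
  + by rewrite /prism_le !leqnn.
  + by rewrite orbC; exact: v2.
  + exact: v2.
  + by move/chainP: cS; apply.
- rewrite negb_or; apply/andP; split; apply/existsPn => j.
    have [x xS xj] := h1 j; apply/forall_inPn.
    have [xv|xv] := eqVneq x (v (S :&: W)); last first.
      by exists x; rewrite ?xj ?eqxx // !inE xv.
    have [y] := v1 S cS ne; rewrite !inE => /andP[yS sy] y1; exists y.
      by rewrite !inE yS neq // nes.
    by rewrite y1 -xv xj eqxx.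
  apply/nandP; have [->|ji] := eqVneq j i; [by left|right].
  have [x xS xj] := h2 j ji; apply/forall_inPn; exists x; last by rewrite xj eqxx.
  by rewrite !inE xS neq // xj.
Qed.

Definition up_side : pred 'I_k.+1 := fun j => i < j.
Definition down_side : pred 'I_k.+1 := fun j => j < i.

Definition up_pivot (P : {set T}) : T :=
  (if [pick x in P] is Some x0 then [arg min_(x < x0 in P) (x.1 : nat)].1 else ord0, i).

Definition down_pivot (P : {set T}) : T :=
  (if [pick x in P] is Some x0 then [arg max_(x > x0 in P) (x.1 : nat)].1 else ord0, i).

Lemma up_pivot_min P : P != set0 ->
  exists2 x, x \in P & x.1 = (up_pivot P).1 /\ forall y, y \in P -> x.1 <= y.1.
Proof.
rewrite /up_pivot; case: pickP => [x0 x0P|P0] /=; last first.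
  by case/set0Pn => x; rewrite P0.
by case: arg_minnP => // x xP xm _; exists x.
Qed.

Lemma down_pivot_max P : P != set0 ->
  exists2 x, x \in P & x.1 = (down_pivot P).1 /\ forall y, y \in P -> y.1 <= x.1.
Proof.
rewrite /down_pivot; case: pickP => [x0 x0P|P0] /=; last first.
  by case/set0Pn => x; rewrite P0.
by case: arg_maxnP => // x xP xm _; exists x.
Qed.

Lemma prism_pivot : 0 < k -> exists (W : {set T}) (v : {set T} -> T),
  forall S, chain prism_le S -> ~~ prism_horn S -> [/\ v (S :&: W) \notin W,
    chain prism_le (v (S :&: W) |: S) & ~~ prism_horn (S :\ v (S :&: W))].
Proof.
move=> k0.
have ne0 (side : pred 'I_k.+1) (S : {set T}) : (exists2 x, x \in S & side x.2) ->
    S :&: [set x | side x.2] != set0.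
  by case=> x xS sx; apply/set0Pn; exists x; rewrite !inE xS.
have [ik|ki] := ltnP i k.
  exists [set x | up_side x.2], up_pivot; apply: prism_pivot_cond => //.
  - by rewrite /up_side ltnn.
  - by exists ord_max.
  - by move=> S _ /ne0/up_pivot_min[x xP [e _]]; exists x.
  - move=> S y /chainP cS yS /ne0/up_pivot_min[x xP [e xm]].
    move: xP; rewrite !inE /up_side => /andP[xS xi].
    rewrite /prism_le -e /=; have [yi|iy] := leqP y.2 i.
      have := cS _ _ xS yS; rewrite /prism_le [x.2 <= _]leqNgt (leq_ltn_trans yi xi) /= andbF /=.
      by case/andP=> ->.
    by rewrite xm ?(ltnW iy) ?orbT // !inE yS.
have {k0} i0 : 0 < i by apply: leq_trans ki.
exists [set x | down_side x.2], down_pivot; apply: prism_pivot_cond => //.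
- by rewrite /down_side ltnn.
- by exists ord0.
- by move=> S _ /ne0/down_pivot_max[x xP [e _]]; exists x.
- move=> S y /chainP cS yS /ne0/down_pivot_max[x xP [e xm]].
  move: xP; rewrite !inE /down_side => /andP[xS xi].
  rewrite /prism_le -e /=; have [iy|yi] := leqP i y.2.
    have := cS _ _ xS yS; rewrite /prism_le [y.2 <= _]leqNgt (leq_trans xi iy) /= andbF orbF.
    by case/andP=> ->; rewrite orbT.
  by rewrite xm ?(ltnW yi) // !inE yS.
Qed.

Definition in_prism_horn n (c : prism n) : Prop := boundary c.1 \/ in_horn i c.2.

Lemma prism_lift (C : site) (J G : spresheaf C) (p : spmap J G) (X : C)
    (phi : forall n, prism n -> J X n) (psi : pmap prism (G X)) :
  horn_lifting p -> 0 < k -> nat_on in_prism_horn phi ->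
  (forall n c, in_prism_horn c -> p X n (phi n c) = psi n c) ->
  locally (fun U (g : hom U X) => exists Phi : pmap prism (J U),
    (forall n (c : prism n), in_prism_horn c -> Phi n c = spres J g n (phi n c)) /\
    (forall n (c : prism n), p U n (Phi n c) = spres G g n (psi n c))).
Proof.
move=> hp k0 nphi pphi; have [W [v piv]] := prism_pivot k0.
have [||S cS SP] := @collapse_lift _ _ _ _ prism_model prism_horn W v prism_horn_sub
  prism_horn0 piv _ _ _ _ hp X phi psi.
- by move=> l n t c /prism_hornP; exact: nphi.
- by move=> n c /prism_hornP; exact: pphi.
exists S => // U g /SP[Phi [h1 h2]]; exists Phi; split=> // n c hc.
by apply: h1; apply/prism_hornP.
Qed.

Lemma prism_fill (K : sset) (phi : forall n, prism n -> K n) :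
  kan K -> 0 < k -> nat_on in_prism_horn phi ->
  exists Phi : pmap prism K, forall n (c : prism n), in_prism_horn c -> Phi n c = phi n c.
Proof.
move=> hK k0 nphi; have [W [v piv]] := prism_pivot k0.
have [|Phi h] := collapse_fill prism_model prism_horn_sub prism_horn0 piv hK (phi := phi).
  by move=> l n t c /prism_hornP; exact: nphi.
by exists Phi => n c hc; apply: h; apply/prism_hornP.
Qed.

End Prism.

(** * Homotopies relative to the boundary *)

Definition face n (j : 'I_n.+2) : dhom n n.+1 :=
  @dmk n n.+1 (lift j) (fun x y xy => ltac:(rewrite /= leq_bump2; exact xy)).

Lemma codegen_bound n (j : 'I_n.+2) (x : 'I_n.+2) : minn (unbump j x) n < n.+1.
Proof. by rewrite ltnS geq_minr. Qed.

Lemma codegen_mono n (j : 'I_n.+2) (x y : 'I_n.+2) :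
  x <= y -> Ordinal (codegen_bound j x) <= Ordinal (codegen_bound j y).
Proof.
move=> xy /=; rewrite leq_min geq_minr andbT geq_min; apply/orP; left.
rewrite /unbump leq_subLR addnC.
by case: (ltnP j x) => jx; case: (ltnP j y) => jy; lia.
Qed.

(** The degeneracy $s^j$, or $s^n$ when [j] is the last vertex [n.+1]; the truncation by [minn] acts
    in that last case only. It is a retraction of [face j]. *)
Definition codegen n (j : 'I_n.+2) : dhom n.+1 n :=
  @dmk n.+1 n (fun x => Ordinal (codegen_bound j x)) (@codegen_mono n j).

Lemma codegenK n (j x : 'I_n.+2) : x != j -> face j (codegen j x) = x.
Proof.
move=> xj; apply: val_inj; rewrite !dmkE /= /bump /unbump /=.
have xn := ltn_ord x; have jn := ltn_ord j.
have {xj} : nat_of_ord x <> j by move=> e; case/eqP: xj; exact: val_inj.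
by case: (ltnP j x); case: leqP; lia.
Qed.

Lemma faceK n (j : 'I_n.+2) : dcomp (codegen j) (face j) = did n.
Proof.
apply: dhom_ext => x; apply: val_inj; rewrite !dmkE /= bumpK.
by apply/minn_idPl; rewrite -ltnS.
Qed.

Lemma codegen_faceK n l (j : 'I_n.+2) (a : dhom l n.+1) :
  (forall x, a x <> j) -> dcomp (face j) (dcomp (codegen j) a) = a.
Proof.
by move=> aj; apply: dhom_ext => x; rewrite !dcompE codegenK //; apply/eqP.
Qed.

Lemma dcomp_cst l m n (s : dhom m n) (v : 'I_m.+1) : dcomp s (dcst l v) = dcst l (s v).
Proof. by apply: dhom_ext => i; rewrite !dmkE. Qed.

Lemma cst_dcomp l m n (t : dhom l m) (v : 'I_n.+1) : dcomp (dcst m v) t = dcst l v.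
Proof. by apply: dhom_ext => i; rewrite !dmkE. Qed.

Lemma dcomp_id l m (t : dhom l m) : dcomp (did m) t = t.
Proof. by apply: dhom_ext => i; rewrite !dmkE. Qed.

Program Definition prism_map m k k' (t : dhom k k') : pmap (prism m k) (prism m k') :=
  @PMap Delta (prism m k) (prism m k') (fun n c => (c.1, dcomp t c.2)) _.
Next Obligation. by move=> m k k' t l n s [a b] /=; congr pair; rewrite dcompA. Qed.

Program Definition prism_fst m k : pmap (prism m k) (simplex m) :=
  @PMap Delta (prism m k) (simplex m) (fun n c => c.1) _.
Next Obligation. by []. Qed.

Program Definition at_vertex m k (K : sset) (H : pmap (prism m k) K) (v : 'I_k.+1) :
  pmap (simplex m) K := @PMap Delta (simplex m) K (fun n a => H n (a, dcst n v)) _.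
Next Obligation.
by move=> m k K H v l n t a; rewrite -resE /= cst_dcomp.
Qed.

(** No base point is involved: the common boundary of [s] and [t] may be arbitrary, as is needed for
    the simplices that encode homotopies. *)
Definition relhom n (K : sset) (s t : pmap (simplex n) K) : Prop :=
  exists H : pmap (prism n 1) K, [/\ at_vertex H ord0 = s, at_vertex H ord_max = t &
    forall l (c : prism n 1 l), boundary c.1 -> H l c = s l c.1].

Lemma boundary_res n l m (t : dhom l m) (a : dhom m n) : boundary a -> boundary (dcomp a t).
Proof. by case=> j h; exists j => i; rewrite dmkE. Qed.

Lemma relhom_boundary n (K : sset) (s t : pmap (simplex n) K) l (a : simplex n l) :
  relhom s t -> boundary a -> s l a = t l a.
Proof. by case=> H [_ <- h] ba; rewrite /= h. Qed.

Lemma relhom_refl n (K : sset) (s : pmap (simplex n) K) : relhom s s.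
Proof. by exists (pmap_comp s (prism_fst n 1)); split=> //; apply: pmap_ext. Qed.

Lemma relhom_comp n (K L : sset) (f : pmap K L) (s t : pmap (simplex n) K) :
  relhom s t -> relhom (pmap_comp f s) (pmap_comp f t).
Proof.
by case=> H [<- <- h]; exists (pmap_comp f H); split=> // [||l c bc];
  [apply: pmap_ext|apply: pmap_ext|rewrite /= h].
Qed.

Lemma horn1 (i : 'I_2) l (b : dhom l 1) : in_horn i b -> b = dcst l i.
Proof.
case=> j [ji h]; apply: dhom_ext => x; rewrite dmkE; move: (h x) ji => {h}.
move: (b x) i j => [[|[|//]] xb] [[|[|//]] ib] [[|[|//]] jb] // h1 h2;
  try exact: val_inj; [case: h1|case: h2|case: h2|case: h1]; exact: val_inj.
Qed.

Lemma in_horn1 (i : 'I_2) l : in_horn i (dcst l i : dhom l 1).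
Proof.
exists (rev_ord i); split=> [|j]; rewrite ?dmkE; case: i => [[|[|//]] ?] //;
  by move/(congr1 val).
Qed.

Definition over_boundary m k n (c : prism m k n) : Prop := boundary c.1.

Lemma over_boundary_res m k l n (t : dhom l n) (c : prism m k n) :
  over_boundary c -> over_boundary (res (prism m k) t c).
Proof. exact: boundary_res. Qed.

Section HomotopyExtension.
Variables (m : nat) (i : 'I_2) (K : sset) (s : pmap (simplex m) K)
  (base : forall n, prism m 1 n -> K n).
Hypothesis base_nat : nat_on (@over_boundary m 1) base.
Hypothesis base_s : forall n (a : simplex m n), boundary a -> base (a, dcst n i) = s n a.

Definition hep_data : forall n, prism m 1 n -> K n :=
  glue (@over_boundary m 1) base (pmap_comp s (prism_fst m 1)).

Lemma hep_data_boundary n (c : prism m 1 n) : boundary c.1 -> hep_data c = base c.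
Proof. by move=> bc; rewrite /hep_data glue_in. Qed.

Lemma hep_data_vertex n (a : simplex m n) : hep_data (a, dcst n i) = s n a.
Proof. by rewrite /hep_data glue_out // => ba; exact: base_s. Qed.

Lemma hep_data_nat : nat_on (@in_prism_horn m 1 i) hep_data.
Proof.
apply: nat_on_glue => //.
- by move=> l n t c; exact: over_boundary_res.
- by move=> l n t c; exact: in_horn_res.
- exact: nat_on_pmap.
- by move=> n [a b] ba /horn1 /= ->; exact: base_s.
Qed.

(** Homotopy extension from either end of the interval: it is a prism filling with [k = 1], where
    the horn at [i] consists of the vertex [i] only. *)
Lemma hep_fill : kan K -> exists Phi : pmap (prism m 1) K, at_vertex Phi i = s /\
  forall n (c : prism m 1 n), boundary c.1 -> Phi n c = base c.
Proof.
move=> hK; have [Phi h] := prism_fill hK (ltn0Sn 0) hep_data_nat.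
exists Phi; split=> [|n c bc].
  apply: pmap_ext => n a /=; rewrite h ?hep_data_vertex //.
  by right; exact: in_horn1.
by rewrite h ?hep_data_boundary //; left.
Qed.

End HomotopyExtension.

Lemma hep_lift (C : site) (J G : spresheaf C) (p : spmap J G) (m : nat) (i : 'I_2) (X : C)
    (s : pmap (simplex m) (J X)) (base : forall n, prism m 1 n -> J X n)
    (psi : pmap (prism m 1) (G X)) :
  horn_lifting p -> nat_on (@over_boundary m 1) base ->
  (forall n (a : simplex m n), boundary a -> base n (a, dcst n i) = s n a) ->
  (forall n (a : simplex m n), p X n (s n a) = psi n (a, dcst n i)) ->
  (forall n c, boundary c.1 -> p X n (base n c) = psi n c) ->
  locally (fun U (g : hom U X) => exists Phi : pmap (prism m 1) (J U),
    [/\ at_vertex Phi i = pmap_comp (spres J g) s,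
      forall n c, boundary c.1 -> Phi n c = spres J g n (base n c) &
      pmap_comp (p U) Phi = pmap_comp (spres G g) psi]).
Proof.
move=> hp nb bs ps pb.
have [|S cS SP] := prism_lift (phi := hep_data s base) (psi := psi) hp (ltn0Sn 0)
  (hep_data_nat nb bs).
  move=> n [a b] [ba|/horn1 /= ->]; first by rewrite hep_data_boundary // pb.
  by rewrite hep_data_vertex.
exists S => // U g /SP[Phi [h1 h2]]; exists Phi; split=> [|n c bc|].
- apply: pmap_ext => n a /=; rewrite h1 ?hep_data_vertex //.
  by right; exact: in_horn1.
- by rewrite h1 ?hep_data_boundary //; left.
- by apply: pmap_ext => n c; exact: h2.
Qed.

(* [E j] is a homotopy along the edge of [Delta^2] opposite to [j]. *)
Lemma triangle_fill (K : sset) (m : nat) (i : 'I_3) (E : 'I_3 -> pmap (prism m 1) K)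
    (base : pmap (prism m 2) K) (w : pmap (simplex m) K) :
  kan K ->
  (forall j, j != i -> forall n (c : prism m 1 n), boundary c.1 ->
    E j n c = base n (c.1, dcomp (face j) c.2)) ->
  (forall j e, j != i -> face j e = i -> at_vertex (E j) e = w) ->
  exists Phi : pmap (prism m 2) K,
    (forall n c, boundary c.1 -> Phi n c = base n c) /\
    (forall j, j != i -> pmap_comp Phi (prism_map m (face j)) = E j).
Proof.
move=> hK Eb Ew.
have [j1 [j2 [j1i j2i j12 jall]]] : exists j1 j2 : 'I_3, [/\ j1 != i, j2 != i, j1 != j2 &
    forall j, j != i -> j = j1 \/ j = j2].
  exists (lift i ord0), (lift i ord_max); split; rewrite ?neq_lift ?[_ == i]eq_sym ?neq_lift //.
    by rewrite (inj_eq lift_inj).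
  move=> j; rewrite eq_sym => /unlift_some[[[|[|//]] h] -> _]; [left|right]; congr (lift _ _);
    exact: val_inj.
pose missing (j : 'I_3) n (c : prism m 2 n) := forall x, dfun c.2 x <> j.
have missing_res j l n (t : dhom l n) (c : prism m 2 n) : missing j n c ->
    missing j l (res (prism m 2) t c) by move=> h x; rewrite /= dcompE; exact: h.
(* The homotopy on the edge opposite to [j], extended to the whole prism by the retraction onto that
   edge; only its values on the edge are used. *)
pose f j := pmap_comp (E j) (prism_map m (codegen j)).
have fb j n (c : prism m 2 n) : j != i -> boundary c.1 -> missing j n c -> f j n c = base n c.
  move=> ji bc jc; rewrite /f /= Eb //= codegen_faceK //; by case: c {bc jc}.
have both n (c : prism m 2 n) : missing j1 n c -> missing j2 n c -> f j1 n c = f j2 n c.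
  move=> h1 h2; have ci x : dfun c.2 x = i.
    by apply: contrapT => /eqP /jall[]; [exact: h1|exact: h2].
  have fw j : j != i -> f j n c = w n c.1.
    move=> ji; have ij : i != j by rewrite eq_sym.
    have <- := Ew j (codegen j i) ji (codegenK ij).
    rewrite /=; congr (E j n (_, _)); apply: dhom_ext => x.
    by rewrite dcompE ci [RHS]dmkE.
  by rewrite !fw.
pose phi := glue (@over_boundary m 2) base (glue (missing j1) (f j1) (f j2)).
have phi_b n c : over_boundary c -> phi n c = base n c by move=> bc; rewrite /phi glue_in.
have phi_m j n c : j != i -> missing j n c -> phi n c = f j n c.
  move=> ji hj.
  have e : glue (missing j1) (f j1) (f j2) c = f j n c.
    case: (jall j ji) hj => -> hj; first by rewrite glue_in.
    by rewrite glue_out // => h; exact: both.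
  by rewrite /phi glue_out e // => bc; rewrite fb.
have nphi : nat_on (@in_prism_horn m 2 i) phi.
  move=> l n t c ic; have {ic} [bc|mc] : over_boundary c \/ exists2 j, j != i & missing j n c.
  - by case: ic => [|[j [/eqP ji h]]]; [left|right; exists j].
  - by rewrite !phi_b ?resE //; exact: over_boundary_res.
  - case: mc => j ji mj; rewrite !(@phi_m j) ?resE //; exact: missing_res.
have [Phi h] := prism_fill hK (ltn0Sn 1) nphi; exists Phi; split=> [n c bc|j ji].
  by rewrite h ?phi_b //; left.
apply: pmap_ext => n [a b] /=.
have mj : missing j n (a, dcomp (face j) b).
  by move=> x; rewrite /= dcompE dmkE => /eqP; rewrite eq_sym (negbTE (neq_lift _ _)).
rewrite h; last by right; exists j; split=> //; apply/eqP.
by rewrite (phi_m j) // /f /= dcompA faceK dcomp_id.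
Qed.

Lemma at_vertex_map m k k' (K : sset) (H : pmap (prism m k') K) (t : dhom k k') v :
  at_vertex (pmap_comp H (prism_map m t)) v = at_vertex H (t v).
Proof. by apply: pmap_ext => n a /=; rewrite dcomp_cst. Qed.

Lemma face_val n (j : 'I_n.+2) (x : 'I_n.+1) : face j x = bump j x :> nat.
Proof. by rewrite dmkE. Qed.

Definition vx0 : 'I_3 := ord0.
Definition vx1 : 'I_3 := lift ord0 ord0.
Definition vx2 : 'I_3 := ord_max.

Lemma ord2_val (e : 'I_2) : (e = ord0 /\ e = 0 :> nat) \/ (e = ord_max /\ e = 1 :> nat).
Proof. by case: e => [[|[|//]] ?]; [left|right]; split=> //; exact: val_inj. Qed.

Lemma ord3_val (e : 'I_3) : [\/ e = vx0, e = vx1 | e = vx2].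
Proof.
by case: e => [[|[|[|//]]] ?]; [apply: Or31|apply: Or32|apply: Or33]; exact: val_inj.
Qed.

(** The two homotopies are placed on the edges 01 and 02 of a triangle, constant over the boundary;
    the edge 12 of the filling is the answer. With reflexivity, this one horn gives symmetry and
    transitivity. *)
Lemma relhom_euclid n (K : sset) (s t u : pmap (simplex n) K) : kan K ->
  relhom s t -> relhom s u -> relhom t u.
Proof.
move=> hK [H [H0 H1 Hb]] [H' [H'0 H'1 H'b]].
pose E j := if j == vx2 then H else H'.
have Eb j l (c : prism n 1 l) : boundary c.1 -> E j l c = s l c.1.
  by move=> bc; rewrite /E; case: ifP; [rewrite Hb|rewrite H'b].
have [||Phi [Pb PE]] := @triangle_fill K n vx0 E (pmap_comp s (prism_fst n 2)) s hK.
- by move=> j _ l c /Eb ->.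
- move=> j e _ /(congr1 val); rewrite /= face_val /bump.
  by have [[-> _]|[_ ->]] := ord2_val e; [rewrite /E; case: ifP|case: leqP].
exists (pmap_comp Phi (prism_map n (face vx0))); rewrite !at_vertex_map; split.
- have -> : face vx0 ord0 = face vx2 ord_max by apply: val_inj; rewrite /= !face_val.
  by rewrite -at_vertex_map PE.
- have -> : face vx0 ord_max = face vx1 ord_max by apply: val_inj; rewrite /= !face_val.
  by rewrite -at_vertex_map PE.
- by move=> l c bc; rewrite /= Pb //= -H1 /= Hb.
Qed.

Lemma relhom_sym n (K : sset) (s t : pmap (simplex n) K) : kan K -> relhom s t -> relhom t s.
Proof. by move=> hK st; apply: (relhom_euclid hK st); exact: relhom_refl. Qed.

Lemma relhom_trans n (K : sset) (s t u : pmap (simplex n) K) : kan K ->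
  relhom s t -> relhom t u -> relhom s u.
Proof. by move=> hK /(relhom_sym hK); exact: relhom_euclid. Qed.

(** * Homotopies as simplices of one dimension higher *)

Section HomotopySimplex.
Variables (n : nat) (K : sset).
Implicit Types s t : pmap (simplex n) K.

(* [vlast] and [vpen] are the vertices [n + 1] and [n] of [Delta^(n+1)]; [codegen vlast]
   identifies them, and is a retraction of both faces opposite to them. *)
Definition vlast : 'I_n.+2 := ord_max.
Definition vpen : 'I_n.+2 := lift vlast ord_max.

Lemma vpen_val : bump n.+1 n = n.
Proof. by rewrite /bump ltnn. Qed.

Lemma codegen_pen : codegen vpen = codegen vlast.
Proof.
apply: dhom_ext => x; apply: val_inj; rewrite !dmkE /= vpen_val /unbump.
have := ltn_ord x; lia.
Qed.

Definition missing m (j : 'I_m.+1) k (a : simplex m k) : Prop := forall x, dfun a x <> j.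

(* The faces of [bd s t] opposite to [vpen] and [vlast] are [t] and [s]. *)
Definition bd s t : forall k, simplex n.+1 k -> K k :=
  glue (@missing n.+1 vpen) (fun k a => t k (dcomp (codegen vlast) a))
    (fun k a => s k (dcomp (codegen vlast) a)).

(** Where the face opposite to [vpen] meets another face, collapsing [n.+1] onto [n] lands in the
    boundary, on which [s] and [t] agree. If the other missed vertex is [vlast], the image misses
    [n]; otherwise that vertex is below [n] and stays missed. *)
Lemma boundary_codegen k (a : dhom k n.+1) : missing vpen a ->
  (exists2 j, j <> vpen & missing j a) -> boundary (dcomp (codegen vlast) a).
Proof.
move=> mp [j jp mj]; have [jl|/eqP jl] := eqVneq j vlast.
  exists ord_max => x /(congr1 val); rewrite dcompE dmkE /= /unbump => E.
  have h1 := ltn_ord (a x).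
  have h2 : a x <> n.+1 :> nat by move=> e; apply: (mj x); rewrite jl; exact: val_inj.
  have h3 : a x <> n :> nat.
    by move=> e; apply: (mp x); apply: val_inj; rewrite /= e vpen_val.
  by move: E; case: (ltnP n.+1 (a x)); lia.
have jn : j < n.
  have h1 := ltn_ord j.
  have h2 : j <> n.+1 :> nat by move=> e; apply: jl; exact: val_inj.
  have h3 : j <> n :> nat.
    by move=> e; apply: jp; apply: val_inj; rewrite /= e vpen_val.
  by lia.
exists (Ordinal (ltnW jn : j < n.+1)) => x /(congr1 val); rewrite dcompE dmkE /= /unbump => E.
apply: (mj x); apply: val_inj => /=; move: E.
have h1 := ltn_ord (a x); case: (ltnP n.+1 (a x)); lia.
Qed.

(** The degenerate simplex [s] composed with [codegen vlast] has boundary [bd s s]. Homotopy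
    extension moves its face opposite to [vpen] along [H], from [s] to [t], and keeps the other
    faces fixed. *)
Lemma homotopy_simplex s t : kan K -> relhom s t ->
  exists w : pmap (simplex n.+1) K, forall k a, boundary a -> w k a = bd s t a.
Proof.
move=> hK [H [H0 H1 Hb]].
pose f0 : pmap (simplex n.+1) (simplex n) := yoneda (codegen vlast : simplex n n.+1).
pose f1 := pmap_comp H (@PMap Delta (prism n.+1 1) (prism n 1)
  (fun k c => (dcomp (codegen vlast) c.1, c.2))
  (fun k l g c => ltac:(rewrite /= -dcompA; reflexivity))).
pose f2 := pmap_comp s (pmap_comp f0 (prism_fst n.+1 1)).
pose base := glue (fun k (c : prism n.+1 1 k) => missing vpen c.1) f1 f2.
pose D' k (c : prism n.+1 1 k) := exists2 j, j <> vpen & missing j c.1.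
have agree k c : missing vpen c.1 -> D' k c -> f1 k c = f2 k c.
  by move=> h1 h2; rewrite /= Hb //; exact: boundary_codegen.
have nb : nat_on (@over_boundary n.+1 1) base.
  have := @nat_on_glue _ (fun k (c : prism n.+1 1 k) => missing vpen c.1) D' K f1 f2.
  move=> /(_ _ _ (nat_on_pmap f1) (nat_on_pmap f2) agree) h k l g c [j bc].
  apply: h => //.
  - by move=> k' l' g' c' h x; rewrite /= dcompE; exact: h.
  - by move=> k' l' g' c' [i ij h]; exists i => // x; rewrite /= dcompE; exact: h.
  - by have [e|/eqP ne] := eqVneq j vpen; [left; rewrite -e|right; exists j].
have [|Phi [Phi0 Phib]] := @hep_fill n.+1 ord0 K (pmap_comp s f0) base nb _ hK.
  move=> k a _; rewrite /base /glue; case: pselect => //= h.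
  by rewrite -H0.
exists (at_vertex Phi ord_max) => k a ba; rewrite /= Phib // /base /bd /glue.
by case: pselect => //= h; rewrite -H1.
Qed.

(** [w] is composed with the map [c] from the prism to $\Delta^{n+1}$ that slides the face opposite
    to [vlast] onto the face opposite to [vpen]: only the last vertex moves, from [n] to [n.+1]. As
    [codegen vlast] collapses this motion, the homotopy is stationary over the boundary. *)
Lemma simplex_homotopy s t (w : pmap (simplex n.+1) K) :
  (forall k a, boundary a -> s k a = t k a) ->
  (forall k a, boundary a -> w k a = bd s t a) -> relhom s t.
Proof.
move=> st wb.
pose cv k (a : dhom k n) (b : dhom k 1) (x : 'I_k.+1) : 'I_n.+2 :=
  if b x == ord0 then lift vlast (a x) else lift vpen (a x).
have cm k a b (x y : 'I_k.+1) : x <= y -> cv k a b x <= cv k a b y.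
  move=> xy; have := dfun_mono a xy; have := dfun_mono b xy; rewrite /cv.
  have h1 := ltn_ord (a x); have h2 := ltn_ord (a y).
  have [[-> _]|[-> _]] := ord2_val (b x); have [[-> _]|[-> _]] := ord2_val (b y) => //=;
    rewrite /bump /=; lia.
pose c : pmap (prism n 1) (simplex n.+1) := @PMap Delta (prism n 1) (simplex n.+1)
  (fun k c => dmk (@cm k c.1 c.2)) (fun k l g c => ltac:(by apply: dhom_ext => x;
     rewrite !dmkE /cv !dcompE)).
have cE k a b (x : 'I_k.+1) : dfun (c k (a, b)) x = cv k a b x by rewrite [LHS]dmkE.
have codegen_face j (x : 'I_n.+1) : codegen j (lift j x) = x.
  by have := congr1 (fun h : dhom n n => h x) (faceK j); rewrite dcompE !dmkE.
have cK k a b : dcomp (codegen vlast) (c k (a, b)) = a.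
  apply: dhom_ext => x; rewrite dcompE cE /cv; case: ifP => _; first exact: codegen_face.
  by rewrite -codegen_pen codegen_face.
have c0 k a : c k (a, dcst k ord0) = dcomp (face vlast) a.
  by apply: dhom_ext => x; rewrite dcompE cE /cv !dmkE.
have c1 k a : c k (a, dcst k ord_max) = dcomp (face vpen) a.
  by apply: dhom_ext => x; rewrite dcompE cE /cv !dmkE.
exists (pmap_comp w c); split.
- apply: pmap_ext => k a; change (w k (c k (a, dcst k ord0)) = s k a).
  rewrite wb; last first.
    by exists vlast => x; rewrite c0 dcompE dmkE => /eqP; rewrite eq_sym (negbTE (neq_lift _ _)).
  rewrite /bd /glue cK; case: pselect => // mp; rewrite st //.
  exists ord_max => x ax; apply: (mp x); rewrite c0 dcompE dmkE ax //.
- apply: pmap_ext => k a; change (w k (c k (a, dcst k ord_max)) = t k a).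
  rewrite wb.
    rewrite /bd glue_in ?cK // => x; rewrite c1 dcompE dmkE => /eqP.
    by rewrite eq_sym (negbTE (neq_lift _ _)).
  by exists vpen => x; rewrite c1 dcompE dmkE => /eqP; rewrite eq_sym (negbTE (neq_lift _ _)).
- move=> k [a b] ba; change (w k (c k (a, b)) = s k a); rewrite wb; last first.
    case: ba => j aj; have [e|jn] := eqVneq j ord_max.
      exists vpen => x; rewrite cE /cv /vpen; case: ifP => _ /eqP; last first.
        by rewrite eq_sym (negbTE (neq_lift _ _)).
      by rewrite (inj_eq lift_inj) -e => /eqP; exact: aj.
    exists (lift vlast j) => x; rewrite cE /cv; case: ifP => _ /eqP.
      by rewrite (inj_eq lift_inj) => /eqP; exact: aj.
    move=> /eqP /(congr1 val) /= E; apply: (aj x); apply: val_inj; move: E => /=.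
    have h1 := ltn_ord (dfun a x); have h2 := ltn_ord j.
    have h3 : j <> n :> nat by move=> e; case/eqP: jn; exact: val_inj.
    by rewrite /bump /=; lia.
  have [mp|np] := pselect (missing vpen (c k (a, b))).
    by rewrite /bd glue_in // cK st.
  by rewrite /bd glue_out ?cK // => /np.
Qed.

End HomotopySimplex.

Definition bd_const n (K : sset) (x : K 0) (s : pmap (simplex n) K) : Prop :=
  forall l (a : simplex n l), boundary a -> s l a = degen x l.

Lemma degen_cst (K : sset) n (s : pmap (simplex n) K) l (v : 'I_n.+1) :
  s l (dcst l v) = degen (s 0 (dcst 0 v)) l.
Proof. by rewrite /degen -resE /= cst_dcomp. Qed.

Section PiLocalIso.
Variables (C : site) (F G : spresheaf C) (f : spmap F G).

Definition pi0_loc_surj : Prop := forall (X : C) (b : pmap (simplex 0) (G X)),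
  locally (fun U (g : hom U X) => exists s : pmap (simplex 0) (F U),
    relhom (pmap_comp (f U) s) (pmap_comp (spres G g) b)).

Definition pi_loc_surj m : Prop := forall (X : C) (x : F X 0) (b : pmap (simplex m) (G X)),
  bd_const (f X 0 x) b ->
  locally (fun U (g : hom U X) => exists2 s : pmap (simplex m) (F U),
    bd_const (spres F g 0 x) s & relhom (pmap_comp (f U) s) (pmap_comp (spres G g) b)).

Definition pi_loc_inj m : Prop := forall (X : C) (x : F X 0) (s t : pmap (simplex m) (F X)),
  bd_const x s -> bd_const x t -> relhom (pmap_comp (f X) s) (pmap_comp (f X) t) ->
  locally (fun U (g : hom U X) =>
    relhom (pmap_comp (spres F g) s) (pmap_comp (spres F g) t)).

(* In dimension 0 the boundary is empty and relative homotopies are edges, so that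
   [pi_loc_inj 0] concerns the components; [pi_loc_surj 0] would presuppose a vertex
   of [F]. *)
Record pi_local_iso : Prop := PiLocalIso {
  pi_surj0 : pi0_loc_surj;
  pi_surj : forall m, 0 < m -> pi_loc_surj m;
  pi_inj : forall m, pi_loc_inj m }.

End PiLocalIso.

(** * Contraction to the last vertex and correction of simplices *)

Section Contraction.
Variable m : nat.

Let cfun k (c : prism m 1 k) (x : 'I_k.+1) : 'I_m.+1 :=
  if dfun c.2 x == ord0 then dfun c.1 x else ord_max.

Lemma contraction_mono k (c : prism m 1 k) (x y : 'I_k.+1) : x <= y -> cfun c x <= cfun c y.
Proof.
case: c => a b xy; rewrite /cfun /=; have := dfun_mono b xy; have := dfun_mono a xy.
have h1 := ltn_ord (dfun a x); have h2 := ltn_ord (dfun a y).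
by have [[-> _]|[-> _]] := ord2_val (dfun b x);
  have [[-> _]|[-> _]] := ord2_val (dfun b y) => //=; lia.
Qed.

Program Definition contraction : pmap (prism m 1) (simplex m) :=
  @PMap Delta (prism m 1) (simplex m) (fun k c => dmk (@contraction_mono k c)) _.
Next Obligation. by move=> l k t [a b]; apply: dhom_ext => x; rewrite !dmkE /cfun /= !dmkE. Qed.

Lemma contraction0 k (a : simplex m k) : contraction k (a, dcst k ord0) = a.
Proof. by apply: dhom_ext => x; rewrite dmkE /cfun /= dmkE. Qed.

Lemma contraction1 k (a : simplex m k) : contraction k (a, dcst k ord_max) = dcst k ord_max.
Proof. by apply: dhom_ext => x; rewrite !dmkE /cfun /= dmkE. Qed.

End Contraction.

Section Correction.
Variables (C : site) (F G : spresheaf C) (f : spmap F G).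
Hypotheses (kF : forall U, kan (F U)) (kG : forall U, kan (G U)) (hf : pi_local_iso f).

(* Contracting [c] to its last vertex deforms [b] to a sphere, which is locally the
   image of a sphere of [F]; the contraction is then run backwards from the latter. *)
Lemma correction m (X : C) (c : pmap (simplex m) (F X)) (b : pmap (simplex m) (G X)) :
  0 < m -> (forall l a, boundary a -> f X l (c l a) = b l a) ->
  locally (fun U (g : hom U X) => exists2 c' : pmap (simplex m) (F U),
    (forall l a, boundary a -> c' l a = spres F g l (c l a)) &
    relhom (pmap_comp (spres G g) b) (pmap_comp (f U) c')).
Proof.
move=> m0 cb; pose Cc := pmap_comp c (contraction m).
have Cc0 l a : Cc l (a, dcst l ord0) = c l a.
  by change (c l (contraction m l (a, dcst l ord0)) = c l a); rewrite contraction0.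
pose x := c 0 (dcst 0 ord_max).
have Cc1 l a : Cc l (a, dcst l ord_max) = degen x l.
  change (c l (contraction m l (a, dcst l ord_max)) = degen x l).
  by rewrite contraction1 degen_cst.
have [|B [B0 Bb]] := @hep_fill m ord0 (G X) b (pmap_comp (f X) Cc) (nat_on_pmap _) _ (@kG X).
  by move=> l a ba; change (f X l (Cc l (a, dcst l ord0)) = b l a); rewrite Cc0 cb.
pose b' := at_vertex B ord_max.
have b'x : bd_const (f X 0 x) b'.
  move=> l a ba; rewrite /b' /= Bb //.
  by change (f X l (Cc l (a, dcst l ord_max)) = degen (f X 0 x) l); rewrite Cc1 degen_map.
apply: (locally_mono (pi_surj hf m0 b'x)) => U g [d dx /(relhom_sym (@kG U)) [H [H0 H1 Hb]]].
have [|D [D1 Db]] := @hep_fill m ord_max (F U) d (pmap_comp (spres F g) Cc)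
    (nat_on_pmap _) _ (@kF U).
  move=> l a ba; rewrite dx //.
  by change (spres F g l (Cc l (a, dcst l ord_max)) = degen (spres F g 0 x) l);
    rewrite Cc1 degen_map.
exists (at_vertex D ord0) => [l a ba|].
  rewrite /= Db //.
  by change (spres F g l (Cc l (a, dcst l ord0)) = spres F g l (c l a)); rewrite Cc0.
have [gC gCE] : exists gC : pmap (prism m 1) (G U),
    forall l z, gC l z = spres G g l (f X l (Cc l z)).
  by exists (pmap_comp (f U) (pmap_comp (spres F g) Cc)) => l z; rewrite -spfunEx.
have [gB gBE] : exists gB : pmap (prism m 1) (G U), forall l z, gB l z = spres G g l (B l z).
  by exists (pmap_comp (spres G g) B).
have gBb l (z : prism m 1 l) : boundary z.1 -> gB l z = gC l z.
  by move=> bz; rewrite gCE gBE Bb.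
have Hb' l (z : prism m 1 l) : boundary z.1 -> H l z = degen (f U 0 (spres F g 0 x)) l.
  move=> bz; rewrite Hb //; change (spres G g l (b' l z.1) = degen (f U 0 (spres F g 0 x)) l).
  by rewrite b'x // degen_map -spfunEx.
have gC1 l a : gC l (a, dcst l ord_max) = degen (f U 0 (spres F g 0 x)) l.
  by rewrite gCE Cc1 !degen_map -spfunEx.
(* Composition of [gB] on the edge 01, from [b] to [b'], with [H] on the edge 12, from [b'] to the
   image of [d]. Over the boundary, [codegen vx1] makes the prism follow [gC] along 01 and 02 and
   stay constant along 12. *)
have [||Phi [Pb PE]] := @triangle_fill (G U) m vx1 (fun j => if j == vx2 then gB else H)
  (pmap_comp gC (prism_map m (codegen vx1))) (pmap_comp (spres G g) b') (@kG U).
- move=> j j1 l z bz; have [->|j2] := eqVneq j vx2.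
    rewrite gBb //= dcompA; congr (gC l _); case: z {bz} => z1 z2 /=; congr pair.
    rewrite -[LHS]dcomp_id; congr dcomp; apply: dhom_ext => v; apply: val_inj.
    by rewrite dcompE !dmkE /=; have [[-> _]|[-> _]] := ord2_val v.
  have -> : j = vx0 by have [] := ord3_val j => E; move: j1 j2; rewrite E ?eqxx.
  rewrite Hb' // -(gC1 l z.1) /=; congr (gC l _); congr pair.
  rewrite dcompA -(cst_dcomp z.2); congr dcomp; apply: dhom_ext => v; apply: val_inj.
  by rewrite dcompE !dmkE /=; have [[-> _]|[-> _]] := ord2_val v.
- move=> j e j1 /(congr1 val); rewrite /= face_val.
  have [] := ord3_val j => E; move: j1; rewrite E ?eqxx //= => _;
    have [[-> _]|[-> _]] := ord2_val e => // _.
  by apply: pmap_ext => l a /=; rewrite gBE.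
pose B' := pmap_comp Phi (prism_map m (face vx1)).
have B'0 : at_vertex B' ord0 = pmap_comp (spres G g) b.
  rewrite at_vertex_map.
  have -> : face vx1 ord0 = face vx2 ord0 by apply: val_inj; rewrite /= !face_val.
  by rewrite -at_vertex_map PE //= -B0; apply: pmap_ext => l a /=; rewrite gBE.
have B'1 : at_vertex B' ord_max = pmap_comp (f U) d.
  rewrite at_vertex_map.
  have -> : face vx1 ord_max = face vx0 ord_max by apply: val_inj; rewrite /= !face_val.
  by rewrite -at_vertex_map PE //= H1.
have B'b l (z : prism m 1 l) : boundary z.1 -> B' l z = gC l z.
  move=> bz; rewrite /B' /= Pb //= dcompA; congr (gC l _); case: z {bz} => z1 z2 /=; congr pair.
  rewrite -[RHS]dcomp_id; congr dcomp; apply: dhom_ext => v; apply: val_inj.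
  by rewrite dcompE !dmkE /=; have [[-> _]|[-> _]] := ord2_val v.
have fDb l (z : prism m 1 l) : boundary z.1 -> pmap_comp (f U) D l z = gC l z.
  by move=> bz; rewrite gCE -spfunEx /= Db.
(* Both [B'] on the edge 02 and the image of [D] on the edge 12 end at the image of [d]. Over the
   boundary [codegen vx0] makes the edge 01 constant, so that this edge is a homotopy relative to
   the boundary from [b] to the image of the end [ord0] of [D]. *)
have [||Psi [Qb QE]] := @triangle_fill (G U) m vx2
  (fun j => if j == vx1 then B' else pmap_comp (f U) D)
  (pmap_comp gC (prism_map m (codegen vx0))) (pmap_comp (f U) d) (@kG U).
- move=> j j2 l z bz; have -> : (if j == vx1 then B' else pmap_comp (f U) D) l z = gC l z.
    by case: ifP => _; [exact: B'b|exact: fDb].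
  rewrite /= dcompA; congr (gC l _); case: z {bz} => z1 z2 /=; congr pair.
  rewrite -[LHS]dcomp_id; congr dcomp; apply: dhom_ext => v; apply: val_inj.
  have [] := ord3_val j => E; move: j2; rewrite E ?eqxx // => _;
  by rewrite dcompE !dmkE /=; have [[-> _]|[-> _]] := ord2_val v.
- move=> j e j2 /(congr1 val); rewrite /= face_val.
  have [] := ord3_val j => E; move: j2; rewrite E ?eqxx //= => _;
    have [[-> _]|[-> _]] := ord2_val e => // _.
  by rewrite -D1; apply: pmap_ext.
exists (pmap_comp Psi (prism_map m (face vx2))); rewrite !at_vertex_map; split.
- have -> : face vx2 ord0 = face vx1 ord0 by apply: val_inj; rewrite /= !face_val.
  by rewrite -at_vertex_map QE.
- have -> : face vx2 ord_max = face vx0 ord0 by apply: val_inj; rewrite /= !face_val.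
  by rewrite -at_vertex_map QE //; apply: pmap_ext.
- move=> l z bz; rewrite [LHS](Qb l (z.1, dcomp (face vx2) z.2) bz).
  have -> : pmap_comp (spres G g) b l z.1 = gC l (z.1, dcst l ord0) by rewrite gCE Cc0 cb.
  change (gC l (z.1, dcomp (codegen vx0) (dcomp (face vx2) z.2)) = gC l (z.1, dcst l ord0)).
  congr (gC l (_, _)); rewrite dcompA -(cst_dcomp z.2); congr dcomp.
  apply: dhom_ext => v; apply: val_inj.
  by rewrite dcompE !dmkE /=; have [[-> _]|[-> _]] := ord2_val v.
Qed.

End Correction.

(** * Pulling back along a local fibration *)

(** Pullback squares are described by elements, independently of [fprod_ob], because [Ex_inf] of a
    fibre product is one only up to isomorphism. *)
Record pullback (P J F G : sset) (p : pmap J G) (f : pmap F G)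
    (q1 : pmap P J) (q2 : pmap P F) : Prop := Pullback {
  pb_comm : forall n (x : P n), p n (q1 n x) = f n (q2 n x);
  pb_inj : forall n (x y : P n), q1 n x = q1 n y -> q2 n x = q2 n y -> x = y;
  pb_ex : forall n (y : J n) (z : F n), p n y = f n z ->
    exists x : P n, q1 n x = y /\ q2 n x = z }.

Lemma bd_map n (K L : sset) (f : pmap K L) (s t : pmap (simplex n) K) k (a : simplex n.+1 k) :
  f k (bd s t a) = bd (pmap_comp f s) (pmap_comp f t) a.
Proof. by rewrite /bd /glue; case: pselect. Qed.

Lemma pmap_compA (K L M N : sset) (f : pmap M N) (g : pmap L M) (h : pmap K L) :
  pmap_comp f (pmap_comp g h) = pmap_comp (pmap_comp f g) h.
Proof. exact: pmap_ext. Qed.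

Lemma relhom_loc (C : category) (F : spresheaf C) U V (g : hom U V) n
    (s t : pmap (simplex n) (F V)) :
  relhom s t -> relhom (pmap_comp (spres F g) s) (pmap_comp (spres F g) t).
Proof. exact: relhom_comp. Qed.

Lemma bd_const_loc (C : category) (F : spresheaf C) U V (g : hom U V) n (x : F V 0)
    (s : pmap (simplex n) (F V)) :
  bd_const x s -> bd_const (spres F g 0 x) (pmap_comp (spres F g) s).
Proof. by move=> h l a ba; rewrite /= h // degen_map. Qed.

Lemma bd_const_comp (K L : sset) (f : pmap K L) n (x : K 0) (s : pmap (simplex n) K) :
  bd_const x s -> bd_const (f 0 x) (pmap_comp f s).
Proof. by move=> h l a ba; rewrite /= h // degen_map. Qed.

Section Pullback.
Variables (C : site) (P J F G : spresheaf C) (p : spmap J G) (f : spmap F G).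
Variables (q1 : spmap P J) (q2 : spmap P F).
Hypotheses (kJ : forall U, kan (J U)) (kF : forall U, kan (F U)) (kG : forall U, kan (G U)).
Hypotheses (hp : horn_lifting p) (hf : pi_local_iso f).
Hypothesis pb : forall U, pullback (p U) (f U) (q1 U) (q2 U).

Lemma pb_simplex U n (j : pmap (simplex n) (J U)) (s : pmap (simplex n) (F U)) :
  pmap_comp (p U) j = pmap_comp (f U) s ->
  exists q, pmap_comp (q1 U) q = j /\ pmap_comp (q2 U) q = s.
Proof.
move=> e; have [|x [x1 x2]] := pb_ex (pb U) (y := j n (did n)) (z := s n (did n)).
  exact: (congr1 (fun h : pmap (simplex n) (G U) => h n (did n)) e).
by exists (yoneda x); rewrite !yoneda_map x1 x2 !yonedaK.
Qed.

(** The homotopy is reversed so as to start at the image of [b], and is lifted locally from [b],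
    stationary over the boundary. *)
Lemma lift_relhom X n (s : pmap (simplex n) (G X)) (b : pmap (simplex n) (J X)) :
  relhom s (pmap_comp (p X) b) ->
  locally (fun U (g : hom U X) => exists2 j : pmap (simplex n) (J U),
    pmap_comp (p U) j = pmap_comp (spres G g) s & relhom j (pmap_comp (spres J g) b)).
Proof.
move=> /(relhom_sym (@kG X)) [H [H0 H1 Hb]].
have [|||S cS SP] := hep_lift (i := ord0) (s := b) (psi := H) hp
  (nat_on_pmap (pmap_comp b (prism_fst n 1))).
- by [].
- by move=> l a; have := congr1 (fun h : pmap (simplex n) (G X) => h l a) H0.
- by move=> l c bc; rewrite Hb.
exists S => // U g /SP[Phi [P0 Pb Pp]]; exists (at_vertex Phi ord_max).
  rewrite -H1; apply: pmap_ext => l a.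
  exact: (congr1 (fun h : pmap (prism n 1) (G U) => h l (a, dcst l ord_max)) Pp).
apply: (relhom_sym (@kJ U)); exists Phi; split=> // l c bc; exact: Pb.
Qed.

(** The lift of the homotopy ends at a simplex of [J] over the image of [s], which pairs with [s].
    There is no condition on the boundary, since the lemma serves both for spheres and for the
    simplices encoding homotopies. *)
Lemma pullback_pi_surj X m (b : pmap (simplex m) (J X)) (s : pmap (simplex m) (F X)) :
  relhom (pmap_comp (f X) s) (pmap_comp (p X) b) ->
  locally (fun U (g : hom U X) => exists q : pmap (simplex m) (P U),
    relhom (pmap_comp (q1 U) q) (pmap_comp (spres J g) b) /\
    pmap_comp (q2 U) q = pmap_comp (spres F g) s).
Proof.
move=> /lift_relhom /locally_mono; apply=> U g [j pj jb].
have [|q [qj qs]] := pb_simplex (j := j) (s := pmap_comp (spres F g) s).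
  by rewrite pj pmap_compA -spfunE -pmap_compA.
by exists q; rewrite qj.
Qed.

(** The homotopies in [F] and [J] become simplices [c] and [h] of dimension [m.+1], whose images in
    [G] have the same boundary. After [correction], [pullback_pi_surj] gives a simplex of [P] with
    boundary [bd s t], which is turned back into a homotopy. *)
Lemma pullback_pi_inj m X (x : P X 0) (s t : pmap (simplex m) (P X)) :
  bd_const x s -> bd_const x t -> relhom (pmap_comp (q1 X) s) (pmap_comp (q1 X) t) ->
  locally (fun U (g : hom U X) =>
    relhom (pmap_comp (spres P g) s) (pmap_comp (spres P g) t)).
Proof.
move=> sx tx st.
have fst : relhom (pmap_comp (f X) (pmap_comp (q2 X) s)) (pmap_comp (f X) (pmap_comp (q2 X) t)).
  have e r : pmap_comp (f X) (pmap_comp (q2 X) r) =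
      pmap_comp (p X) (pmap_comp (q1 X) r) :> pmap (simplex m) _.
    by apply: pmap_ext => l a; rewrite /= (pb_comm (pb _)).
  by rewrite !e; exact: relhom_comp.
have L := pi_inj hf (bd_const_comp (q2 X) sx) (bd_const_comp (q2 X) tx) fst.
apply: (locally_bind L) => U g Fst.
have [c cb] := homotopy_simplex (@kF U) Fst.
have [h hb] := homotopy_simplex (@kJ U) (relhom_loc g st).
have [|S cS SP] := correction kF kG hf (c := c) (b := pmap_comp (p U) h) (ltn0Sn m).
- move=> l a ba; rewrite cb //= hb // !bd_map; congr (bd _ _ a); apply: pmap_ext => k z /=;
    by rewrite !spfunEx (pb_comm (pb _)).
apply: (@locally_bind _ _ (fun U g => S U g)); first by exists S.
move=> V k /SP[c' c'b] /(relhom_sym (@kG V)).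
have -> : pmap_comp (spres G k) (pmap_comp (p U) h) = pmap_comp (p V) (pmap_comp (spres J k) h).
  by rewrite pmap_compA -spfunE -pmap_compA.
move=> /pullback_pi_surj /locally_mono; apply=> W o [w [w1 w2]].
have E (K : spresheaf C) (q : spmap P K) r : pmap_comp (spres K o) (pmap_comp (spres K k)
    (pmap_comp (spres K g) (pmap_comp (q X) r))) =
    pmap_comp (q W) (pmap_comp (spres P (g \c (k \c o))) r) :> pmap (simplex m) _.
  by apply: pmap_ext => l a; rewrite /= !spresMx !spfunEx.
have stb l (a : simplex m l) : boundary a -> s l a = t l a by move=> ba; rewrite sx // tx.
apply: (@simplex_homotopy _ _ _ _ w) => l a ba; first by rewrite /= stb.
apply: (pb_inj (pb _)).
  have -> : q1 W l (w l a) = pmap_comp (q1 W) w l a by [].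
  by rewrite (relhom_boundary w1 ba) /= hb // !bd_map !E.
have -> : q2 W l (w l a) = pmap_comp (q2 W) w l a by [].
by rewrite w2 /= c'b // cb // !bd_map !E.
Qed.

Lemma pullback_pi_local_iso : pi_local_iso q1.
Proof.
split; last exact: pullback_pi_inj.
- move=> X b; apply: (locally_bind (pi_surj0 hf (pmap_comp (p X) b))) => U g [s].
  rewrite pmap_compA -spfunE -pmap_compA => /pullback_pi_surj /locally_mono; apply=> V h [q [qb _]].
  by exists q; rewrite spresM -pmap_compA.
- move=> m m0 X x b bx.
  have pbx : bd_const (f X 0 (q2 X 0 x)) (pmap_comp (p X) b).
    by rewrite -(pb_comm (pb _)); exact: bd_const_comp.
  apply: (locally_bind (pi_surj hf m0 pbx)) => U g [s sx].
  rewrite pmap_compA -spfunE -pmap_compA => sb.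
  apply: (locally_mono (pullback_pi_surj sb)) => V h [q [qb qs]]; exists q; last first.
    by rewrite spresM -pmap_compA.
  move=> l a ba; apply: (pb_inj (pb _)).
    have -> : q1 V l (q l a) = pmap_comp (q1 V) q l a by [].
    rewrite (relhom_boundary qb ba) degen_map spfunEx spresMx.
    exact: (bd_const_loc h (bd_const_loc g bx)).
  have -> : q2 V l (q l a) = pmap_comp (q2 V) q l a by [].
  by rewrite qs degen_map spfunEx spresMx; exact: (bd_const_loc h sx).
Qed.

End Pullback.

(** * Subdivision and [Ex] *)

Section InitialChain.
Variable n : nat.

Lemma initial_chain_subproof :
  sd_chain [ffun i : 'I_n.+1 => [set x : 'I_n.+1 | x <= i]].
Proof.
apply/sd_chainP; split=> [i|i j ij]; rewrite !ffunE.
  by apply/set0Pn; exists i; rewrite inE.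
by apply/subsetP => x; rewrite !inE => /leq_trans; apply.
Qed.

(** The chain {0} ⊂ {0,1} ⊂ ... of initial segments. Its last vertices are 0, ..., n, so evaluation
    at it undoes [Ex_unit] on [n]-simplices. *)
Definition initial_chain : sd n n := exist (fun c => is_true (sd_chain c)) _ initial_chain_subproof.

Lemma last_initial_chain : last_vertex n n initial_chain = did n.
Proof.
apply: dhom_ext => i; rewrite !dmkE ffunE; apply: val_inj; rewrite /= set_last_val.
apply/eqP; rewrite eqn_leq; apply/andP; split; last first.
  by apply: (bigmax_sup i) => //; rewrite inE.
by apply/bigmax_leqP => x; rewrite inE.
Qed.

End InitialChain.

Lemma Ex_unit_inj (K : sset) n (x y : K n) : Ex_unit K n x = Ex_unit K n y -> x = y.
Proof.
move=> /(congr1 (fun h : pmap (sd n) K => h n (initial_chain n))).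
change (res K (last_vertex n n (initial_chain n)) x = res K (last_vertex n n (initial_chain n)) y
  -> x = y).
by rewrite last_initial_chain; rewrite (@pres1 Delta K n x) (@pres1 Delta K n y).
Qed.

Lemma sd0_unique m (c d : sd 0 m) : c = d.
Proof.
have one (e : sd 0 m) i : sval e i = [set: 'I_1].
  have /sd_chainP[/(_ i)/set0Pn[x xe] _] := svalP e.
  by apply/setP => y; rewrite inE (_ : y = x) ?xe // [y]ord1 [x]ord1.
by apply: sd_ext => i; rewrite !one.
Qed.

Lemma Ex_unit_vertex (K : sset) (y : Ex K 0) : exists x, Ex_unit K 0 x = y.
Proof.
exists (y 0 (initial_chain 0)); apply: pmap_ext => m c /=.
by rewrite -resE; congr (y m _); exact: sd0_unique.
Qed.

(** * Horns of [Ex] and Kan's filler *)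

Section Horn.
Variables (n : nat) (k : 'I_n.+1).

Definition horn_set (A : {set 'I_n.+1}) : bool := [exists j, (j != k) && (j \notin A)].

Lemma horn_set_sub (A B : {set 'I_n.+1}) : A \subset B -> horn_set B -> horn_set A.
Proof.
move=> /subsetP AB /existsP[j /andP[jk jB]]; apply/existsP; exists j.
by rewrite jk (contra (AB j)).
Qed.

Lemma horn_setN (A : {set 'I_n.+1}) j : ~~ horn_set A -> j != k -> j \in A.
Proof. by move=> /existsPn /(_ j); rewrite negb_and !negbK => /orP[->|]. Qed.

Lemma in_horn_image m (a : dhom m n) : in_horn k a <-> horn_set [set a x | x : 'I_m.+1].
Proof.
split=> [[j [/eqP jk h]]|/existsP[j /andP[/eqP jk h]]].
  apply/existsP; exists j; rewrite jk; apply/negP => /imsetP[x _ e]; exact: (h x).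
by exists j; split=> // x e; move: h; rewrite -e imset_f.
Qed.

(** Each [x] goes to the largest element of [A] below or equal to it, or to the minimum [b] of [A]
    if there is none. *)
Lemma retraction_ex (A : {set 'I_n.+1}) : A != set0 ->
  exists r : dhom n n, (forall x, x \in A -> r x = x) /\ (forall x, r x \in A).
Proof.
case/set0Pn => a0 a0A.
have [b [bA bm]] : exists b, b \in A /\ forall y, y \in A -> b <= y.
  have [b bA bm] := @arg_minnP _ a0 (mem A) (fun x : 'I_n.+1 => x : nat) a0A.
  by exists b.
pose below (x : 'I_n.+1) := [set y in A | (y <= x) || (y == b)].
have mono (x y : 'I_n.+1) : x <= y -> set_last (below x) <= set_last (below y).
  move=> xy; apply: set_lastS; apply/subsetP => z; rewrite !inE => /andP[-> /=].
  by case/orP=> [/leq_trans -> //|->]; rewrite orbT.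
have below0 x : below x != set0 by apply/set0Pn; exists b; rewrite !inE bA eqxx orbT.
exists (dmk mono); split=> x.
  move=> xA; rewrite dmkE; apply: val_inj; apply/eqP; rewrite eqn_leq; apply/andP; split.
    have := set_last_in (below0 x); rewrite inE => /andP[yA /orP[//|/eqP ->]]; exact: bm.
  by apply: set_last_max; rewrite !inE xA leqnn.
by rewrite dmkE; have := set_last_in (below0 x); rewrite inE => /andP[].
Qed.

Definition sd_top m (c : sd n m) : {set 'I_n.+1} := sval c ord_max.

Lemma sd_sub m (c : sd n m) (i j : 'I_m.+1) : i <= j -> sval c i \subset sval c j.
Proof. by have /sd_chainP[_] := svalP c; apply. Qed.

Lemma sd_neq0 m (c : sd n m) i : sval c i != set0.
Proof. by have /sd_chainP[h _] := svalP c. Qed.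

Lemma sd_sub_top m (c : sd n m) i : sval c i \subset sd_top c.
Proof. by apply: sd_sub; rewrite -ltnS. Qed.

Lemma sd_map_fix m (c : sd n m) (r : dhom n n) :
  (forall x, x \in sd_top c -> r x = x) -> sd_map r m c = c.
Proof.
move=> h; apply: sd_ext => i; rewrite ffunE; apply/setP => y; apply/imsetP/idP.
  by case=> x xc ->; rewrite h // (subsetP (sd_sub_top c i)).
by move=> yc; exists y => //; rewrite h // (subsetP (sd_sub_top c i)).
Qed.

Hypothesis n0 : 0 < n.

Lemma in_horn_cst : in_horn k (dcst n k).
Proof.
exists (lift k (Ordinal n0)); split=> [|i]; rewrite ?dmkE => /eqP.
  by rewrite eq_sym (negbTE (neq_lift _ _)).
by rewrite (negbTE (neq_lift _ _)).
Qed.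

(** A monotone retraction onto the face [A], seen as a simplex of the horn. All simplices of the
    horn are restrictions of these finitely many, which live in the single dimension [n]. The
    constant [k] is a default for sets that are not faces of the horn. *)
Definition horn_retraction (A : {set 'I_n.+1}) : horn k n :=
  if pselect (exists r : horn k n, (forall x, x \in A -> dfun (sval r) x = x) /\
    (forall x, dfun (sval r) x \in A)) is left h
  then sval (cid h)
  else exist _ (dcst n k) in_horn_cst.

Lemma horn_retractionP (A : {set 'I_n.+1}) : A != set0 -> horn_set A ->
  (forall x, x \in A -> dfun (sval (horn_retraction A)) x = x) /\
  (forall x, dfun (sval (horn_retraction A)) x \in A).
Proof.
move=> A0 hA; rewrite /horn_retraction; case: pselect => [h|nh]; first exact: (svalP (cid h)).
exfalso; apply: nh.
have [r [r1 r2]] := retraction_ex A0.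
have hr : in_horn k r.
  by apply/in_horn_image; apply: horn_set_sub hA; apply/subsetP => _ /imsetP[x _ ->].
by exists (exist _ r hr).
Qed.

Variables (K : sset) (u : pmap (horn k) (Ex K)).

(* A map from the horn to [Ex K] is a map to [K] from the subdivided horn, that is,
   from the chains of [sd n] with top in [horn_set]. *)
Definition sd_horn_map m (c : sd n m) : K m := u n (horn_retraction (sd_top c)) m c.

Lemma Ex_resE (L : sset) l m (t : dhom l m) (g : Ex L m) : res (Ex L) t g = pmap_comp g (sd_map t).
Proof. by []. Qed.

(** The value does not depend on the face used to compute it: for [A] inside [B], the retraction
    onto [A] factors through the one onto [B] and fixes the chain. *)
Lemma sd_horn_mapE l (a : horn k l) m (e : sd l m) :
  sd_horn_map (sd_map (sval a) m e) = u l a m e.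
Proof.
set c := sd_map _ _ _; set A := sd_top c; pose B := [set dfun (sval a) x | x : 'I_l.+1].
have hB : horn_set B by apply/in_horn_image; exact: svalP a.
have B0 : B != set0 by apply/set0Pn; exists (dfun (sval a) ord0); exact: imset_f.
have AB : A \subset B.
  by rewrite /A /sd_top ffunE; apply/subsetP => _ /imsetP[x _ ->]; exact: imset_f.
have [A1 A2] := horn_retractionP (sd_neq0 c ord_max) (horn_set_sub AB hB).
have [B1 B2] := horn_retractionP B0 hB.
have eA : horn_retraction A = res (horn k) (sval (horn_retraction A)) (horn_retraction B).
  apply: sig_ext; apply: dhom_ext => x /=; rewrite dcompE B1 //.
  by apply: (subsetP AB); exact: A2.
have ea : a = res (horn k) (sval a) (horn_retraction B).
  by apply: sig_ext; apply: dhom_ext => x /=; rewrite dcompE B1 // imset_f.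
rewrite /sd_horn_map -/A [in RHS]ea [in LHS]eA !resE !Ex_resE.
change (u n (horn_retraction B) m (sd_map (sval (horn_retraction A)) m c) =
  u n (horn_retraction B) m c).
by rewrite sd_map_fix.
Qed.

Lemma sd_horn_map_nat : nat_on (fun m (c : sd n m) => horn_set (sd_top c)) sd_horn_map.
Proof.
move=> l m t c hc.
have [r1 r2] := horn_retractionP (sd_neq0 c ord_max) hc.
have cE : sd_map (sval (horn_retraction (sd_top c))) m c = c by exact: sd_map_fix.
have -> : sd_horn_map (res (sd n) t c) =
    sd_horn_map (sd_map (sval (horn_retraction (sd_top c))) l (res (sd n) t c)).
  by rewrite resE cE.
by rewrite sd_horn_mapE resE.
Qed.

End Horn.

Section KanExtension.
Variables (K : sset) (n : nat) (k : 'I_n.+1).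
Hypothesis n0 : 0 < n.
Variable u : pmap (horn k) (Ex K).

(** Vertex map behind Kan's filler. On faces of the horn it is the last vertex; the whole simplex
    and the face opposite to [k] are sent to [k]. It induces a map from the double subdivision of
    the simplex to the subdivided horn. *)
Definition horn_last (A : {set 'I_n.+1}) : 'I_n.+1 := if horn_set k A then set_last A else k.

Lemma sd2_subproof m (c : sd n m) q (d : sd m q) :
  sd_chain [ffun i => [set horn_last (sval c j) | j in sval d i]].
Proof.
apply/sd_chainP; split=> [i|i j ij]; rewrite !ffunE; last by apply: imsetS; exact: sd_sub.
have /set0Pn[x xd] := sd_neq0 d i.
by apply/set0Pn; exists (horn_last (sval c x)); exact: imset_f.
Qed.

Definition sd2_chain m (c : sd n m) q (d : sd m q) : sd n q :=
  exist (fun c => is_true (sd_chain c)) _ (sd2_subproof c d).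

(* A vertex of [sd (sd n)] is a chain of subsets; the largest of them which is in
   the horn misses some [j <> k], and so do the last vertices of all the others. *)
Lemma sd2_horn m (c : sd n m) q (d : sd m q) : horn_set k (sd_top (sd2_chain c d)).
Proof.
rewrite /sd_top ffunE.
have [h|h] := boolP [exists i, horn_set k (sval c i)]; last first.
  apply/existsP; exists (lift k (Ordinal n0)); rewrite eq_sym neq_lift /=.
  apply/negP => /imsetP[j _]; move/existsPn: h => /(_ j) hj.
  by rewrite /horn_last (negbTE hj) => /eqP; rewrite eq_sym (negbTE (neq_lift _ _)).
have [i hi him] : exists2 i, horn_set k (sval c i) &
    forall i', horn_set k (sval c i') -> i' <= i.
  case/existsP: h => i0 hi0.
  have [i hi him] := @arg_maxnP _ i0 (fun i => horn_set k (sval c i))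
    (fun i : 'I_m.+1 => i : nat) hi0.
  by exists i.
case/existsP: hi => j /andP[jk jc]; apply/existsP; exists j; rewrite jk /=.
apply/negP => /imsetP[i' _]; rewrite /horn_last; case: ifPn => [hi' e|_ e].
  move: jc; rewrite e (subsetP (sd_sub c (him _ hi'))) //.
  by apply: set_last_in; exact: sd_neq0.
by rewrite e eqxx in jk.
Qed.

Lemma Ex2_inner_nat m (c : sd n m) l q (t : dhom l q) (d : sd m q) :
  sd_horn_map n0 u (sd2_chain c (res (sd m) t d)) =
  res K t (sd_horn_map n0 u (sd2_chain c d)).
Proof.
rewrite -sd_horn_map_nat; last exact: sd2_horn.
by congr sd_horn_map; apply: sd_ext => i; rewrite !ffunE.
Qed.

Definition Ex2_inner m (c : sd n m) : Ex K m :=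
  @PMap Delta (sd m) K (fun q d => sd_horn_map n0 u (sd2_chain c d)) (@Ex2_inner_nat m c).

Lemma Ex2_outer_nat l m (t : dhom l m) (c : sd n m) :
  Ex2_inner (res (sd n) t c) = res (Ex K) t (Ex2_inner c).
Proof.
apply: pmap_ext => q d /=; congr sd_horn_map; apply: sd_ext => i.
rewrite !ffunE -imset_comp; apply: eq_imset => j /=; by rewrite ffunE.
Qed.

Definition Ex2_filler : Ex (Ex K) n := @PMap Delta (sd n) (Ex K) Ex2_inner Ex2_outer_nat.

Lemma Ex2_fillerE m (a : horn k m) :
  res (Ex (Ex K)) (sval a) Ex2_filler = Ex_unit (Ex K) m (u m a).
Proof.
apply: pmap_ext => q c; apply: pmap_ext => r d /=.
rewrite -sd_horn_mapE; congr sd_horn_map; apply: sd_ext => i.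
rewrite !ffunE -imset_comp; apply: eq_imset => j; rewrite ffunE /horn_last /=.
have -> : horn_set k [set dfun (sval a) x | x in sval c j].
  have /in_horn_image := svalP a; apply: horn_set_sub.
  by apply/subsetP => _ /imsetP[x _ ->]; exact: imset_f.
by rewrite set_last_imset ?sd_neq0 // dmkE.
Qed.

End KanExtension.

(** * Collapse of the subdivided simplex onto the subdivided horn *)

Section SubdividedHorn.
Variables (n : nat) (k : 'I_n.+1).
Local Notation T := {set 'I_n.+1}.

(** Failure of reflexivity at the empty set is what keeps it out of all chains. *)
Definition sd_le : rel T := fun A B => (A != set0) && (A \subset B).

Definition sd_vt m (c : sd n m) (i : 'I_m.+1) : T := sval c i.

Lemma sd_model : chain_model sd_le sd_vt.
Proof.
split.
- by move=> B A C /andP[A0 AB] /andP[_ BC]; rewrite /sd_le A0 (subset_trans AB).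
- by move=> A B /andP[_ AB] /andP[_ BA]; apply/eqP; rewrite eqEsubset AB.
- by move=> l m t c i; rewrite /sd_vt ffunE.
- by move=> m c d h; exact: sd_ext.
- by move=> m c i j ij; rewrite /sd_le /sd_vt sd_neq0 sd_sub.
- move=> m h hm; have hc : sd_chain (finfun h).
    apply/sd_chainP; split=> [i|i j /hm/andP[_]]; rewrite !ffunE //.
    by have /andP[] := hm i i (leqnn i).
  by exists (exist (fun c => is_true (sd_chain c)) _ hc) => i; rewrite /sd_vt /= ffunE.
Qed.

Definition sd_horn (S : {set T}) : bool := [forall A in S, horn_set k A].

Lemma sd_hornP m (c : sd n m) : sd_horn (vertices sd_vt c) <-> horn_set k (sd_top c).
Proof.
split=> [/forall_inP|h]; first by apply; exact: imset_f.
apply/forall_inP => _ /imsetP[i _ ->]; apply: horn_set_sub h; exact: sd_sub_top.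
Qed.

Let W : {set T} := [set A : T | k \notin A].
Let v (P : {set T}) : T := k |: \bigcup_(A in P) A.

(** In a chain the sets without [k] lie below those with [k], and the pivot, the union of the former
    with [k] added, fits in between. If the pivot itself was outside the horn, the largest set
    without [k] already contains every [j] other than [k], so it is outside the horn too and
    survives the deletion. *)
Lemma sd_pivot (S : {set T}) : 0 < n -> chain sd_le S -> ~~ sd_horn S ->
  [/\ v (S :&: W) \notin W, chain sd_le (v (S :&: W) |: S) &
    ~~ sd_horn (S :\ v (S :&: W))].
Proof.
move=> n0 /chainP cS nS.
have S0 (A : T) : A \in S -> A != set0 by move=> AS; have := cS A A AS AS; rewrite orbb => /andP[].
have v0 P : v P != set0 by apply/set0Pn; exists k; rewrite !inE eqxx.
have WA (A : T) : A \in S :&: W -> A \subset v (S :&: W).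
  by move=> AS; apply: subset_trans (subsetUr _ _); exact: (bigcup_sup A).
have vcmp (A : T) : A \in S -> sd_le A (v (S :&: W)) || sd_le (v (S :&: W)) A.
  move=> AS; have [kA|kA] := boolP (k \in A); apply/orP; [right|left]; last first.
    by rewrite /sd_le S0 // WA // !inE AS.
  rewrite /sd_le v0 subUset sub1set kA /=; apply/bigcupsP => B; rewrite !inE => /andP[BS kB].
  have /orP[/andP[_]|/andP[_ //]] := cS A B AS BS.
  by move=> /subsetP/(_ k kA); rewrite (negbTE kB).
split.
- by rewrite !inE eqxx.
- apply/chainP => A B /setU1P[->|AS] /setU1P[->|BS].
  + by rewrite /sd_le v0 subxx.
  + by rewrite orbC; exact: vcmp.
  + exact: vcmp.
  + exact: cS.
- case/forall_inPn: nS => B BS nB.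
  have [Bv|Bv] := eqVneq B (v (S :&: W)); last first.
    by apply/forall_inPn; exists B; rewrite // !inE Bv.
  have inW j : j != k -> exists2 Z, Z \in S :&: W & j \in Z.
    move=> jk; have := horn_setN nB jk; rewrite Bv !inE (negbTE jk) /=.
    by case/bigcupP => Z ZS jZ; exists Z.
  have [Y0 Y0W _] := inW (lift k (Ordinal n0)) (ltac:(by rewrite eq_sym neq_lift)).
  have [Y [YW Ym]] : exists Y, Y \in S :&: W /\ forall Z, Z \in S :&: W -> #|Z| <= #|Y|.
    have [Y YW Ym] := @arg_maxnP _ Y0 (mem (S :&: W)) (fun A : {set 'I_n.+1} => #|A|) Y0W.
    by exists Y.
  move: (YW); rewrite !inE => /andP[YS kY].
  apply/forall_inPn; exists Y.
    by rewrite !inE YS andbT; apply: contra kY => /eqP ->; rewrite !inE eqxx.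
  apply/existsPn => j; rewrite negb_and !negbK; case: eqVneq => //= jk.
  have [Z ZW jZ] := inW j jk; move: (ZW); rewrite !inE => /andP[ZS _].
  have /orP[/andP[_ /subsetP]|/andP[_ YZ]] := cS Z Y ZS YS; first exact.
  by have /eqP -> : Y == Z by rewrite eqEcard YZ Ym.
Qed.

End SubdividedHorn.

Program Definition Ex_sp (C : category) (F : spresheaf C) : spresheaf C :=
  @SPresheaf C (fun U => Ex (F U)) (fun U V g => Ex_map (spres F g)) _ _.
Next Obligation. by move=> C F U; rewrite /= spres1; apply: pmap_ext => m x; exact: pmap_ext. Qed.
Next Obligation. by move=> *; rewrite /= spresM; apply: pmap_ext => m x; exact: pmap_ext. Qed.

Program Definition Ex_spmap (C : category) (F G : spresheaf C) (f : spmap F G) :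
    spmap (Ex_sp F) (Ex_sp G) :=
  @SPMap C (Ex_sp F) (Ex_sp G) (fun U => Ex_map (f U)) _.
Next Obligation.
by move=> *; apply: pmap_ext => m x; apply: pmap_ext => l c; rewrite /= spfunEx.
Qed.

(** A simplex of [Ex] is a map out of [sd n], so a horn problem for [Ex] is an extension problem
    from the subdivided horn to [sd n], which [sd_pivot] makes a collapse. *)
Lemma Ex_horn_lifting (C : site) (J G : spresheaf C) (p : spmap J G) :
  horn_lifting p -> horn_lifting (Ex_spmap p).
Proof.
move=> hp n k X n0 u w uw.
have As (S S' : {set {set 'I_n.+1}}) : S' \subset S -> sd_horn k S -> sd_horn k S'.
  by move=> /subsetP ss /forall_inP h; apply/forall_inP => A /ss; exact: h.
have A0 : sd_horn k set0 by apply/forall_inP => A; rewrite inE.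
have [||S cS SP] := collapse_lift (sd_model n) As A0 (fun S => @sd_pivot n k S n0) hp
  (phi := sd_horn_map n0 u) (psi := w).
- by move=> l m t c /sd_hornP; exact: sd_horn_map_nat.
- move=> m c /sd_hornP hc.
  have [r1 r2] := horn_retractionP n0 (sd_neq0 c ord_max) hc.
  have := congr1 (fun h : pmap (sd n) (G X) => h m c) (uw n (horn_retraction k n0 (sd_top c))).
  rewrite [RHS](_ : _ = w m (sd_map (sval (horn_retraction k n0 (sd_top c))) m c)) //.
  by rewrite sd_map_fix.
exists S => // U g /SP[Phi [h1 h2]]; exists Phi; split=> [m a|].
  apply: pmap_ext => l e.
  change (Phi l (sd_map (sval a) l e) = spres J g l (u m a l e)).
  rewrite h1 ?sd_horn_mapE //; apply/sd_hornP; rewrite /sd_top ffunE.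
  have /in_horn_image := svalP a; apply: horn_set_sub.
  by apply/subsetP => _ /imsetP[x _ ->]; exact: imset_f.
by apply: pmap_ext => l e; exact: h2.
Qed.

Lemma Ex_iter_map_nat (C : category) (F G : spresheaf C) (f : spmap F G) k U V (g : hom U V) :
  pmap_comp (Ex_iter_map (f U) k) (Ex_iter_map (spres F g) k) =
  pmap_comp (Ex_iter_map (spres G g) k) (Ex_iter_map (f V) k).
Proof. by apply: pmap_ext => m x; rewrite /= -!Ex_iter_map_comp spfunE. Qed.

Program Definition Ex_iter_sp (C : category) (F : spresheaf C) k : spresheaf C :=
  @SPresheaf C (fun U => iter k Ex (F U)) (fun U V g => Ex_iter_map (spres F g) k) _ _.
Next Obligation. by move=> C F k U; apply: pmap_ext => m x; rewrite /= spres1 Ex_iter_map_id. Qed.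
Next Obligation. by move=> *; apply: pmap_ext => m x; rewrite /= spresM Ex_iter_map_comp. Qed.

Definition Ex_iter_spmap (C : category) (F G : spresheaf C) (f : spmap F G) k :
    spmap (Ex_iter_sp F k) (Ex_iter_sp G k) :=
  @SPMap C (Ex_iter_sp F k) (Ex_iter_sp G k) (fun U => Ex_iter_map (f U) k)
    (Ex_iter_map_nat f k).

Lemma Ex_iter_horn_lifting (C : site) (J G : spresheaf C) (p : spmap J G) k :
  horn_lifting p -> horn_lifting (Ex_iter_spmap p k).
Proof.
move=> hp; elim: k => [|k IH]; first exact: hp.
exact: (Ex_horn_lifting IH).
Qed.

(** * The colimit [Ex_inf] *)

Section Stages.
Variable K : sset.

Definition stage k : pmap (iter k Ex K) (Ex_inf K) :=
  @PMap Delta (iter k Ex K) (Ex_inf K) (fun n x => class _ (@tow K n k x))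
    (fun m n t x => ltac:(rewrite /= quot_mapE; [reflexivity|exact: tower_res_rel])).

Lemma stage_unit k n (x : iter k Ex K n) :
  stage k.+1 n (Ex_unit (iter k Ex K) n x) = stage k n x.
Proof. by apply/esym/class_rel; exists k, x. Qed.

Let shift n (a : tower K n) : tower K n :=
  @tow K n (tag a).+1 (Ex_unit (iter (tag a) Ex K) n (tagged a)).

Lemma tow_inj n k (x y : iter k Ex K n) : tow x = tow y -> x = y.
Proof. by apply: Eqdep_dec.inj_pair2_eq_dec => a b; exact: (decP (a =P b)). Qed.

Lemma shift_inj n i k (x y : iter k Ex K n) :
  iter i (@shift n) (tow x) = iter i (@shift n) (tow y) -> x = y.
Proof.
elim: i k x y => [|i IH] k x y; first exact: tow_inj.
rewrite !iterSr => /(IH k.+1); exact: Ex_unit_inj.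
Qed.

Lemma tag_shift n i (a : tower K n) : tag (iter i (@shift n) a) = i + tag a.
Proof. by elim: i => //= i ->. Qed.

(** Identified elements coincide after [i] and [j] applications of the unit. The resulting stages
    are [i + k] and [j + k], so [i = j], and injectivity of [Ex_unit] cancels them. *)
Lemma stage_inj k n (x y : iter k Ex K n) : stage k n x = stage k n y -> x = y.
Proof.
move=> /classP E.
have [i [j]] : exists i j, iter i (@shift n) (tow x) = iter j (@shift n) (tow y).
  elim: E => {x y} [a b [l [z [-> ->]]]|a|a b _ [i [j e]]|a b c _ [i [j e]] _ [i' [j' e']]].
  - by exists 1, 0.
  - by exists 0, 0.
  - by exists j, i.
  - by exists (i' + i), (j + j'); rewrite iterD e -iterD addnC iterD e' -iterD.
move=> e; have /eqP := congr1 (@tag _ _) e; rewrite !tag_shift eqn_add2r => /eqP ij.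
by subst j; exact: shift_inj e.
Qed.

Lemma stage_mono k l n (x : Ex_inf K n) : k <= l ->
  (exists y, stage k n y = x) -> exists y, stage l n y = x.
Proof.
move=> kl [y <-]; rewrite -(subnK kl); elim: (l - k) => [|i [z zE]]; first by exists y.
by exists (Ex_unit (iter (i + k) Ex K) n z); rewrite -zE; exact: stage_unit.
Qed.

Lemma stage_ex n (x : Ex_inf K n) : exists k, exists y, stage k n y = x.
Proof. by elim/quot_ind: x => [[k y]]; exists k, y. Qed.

(* A horn has finitely many nondegenerate simplices, hence lies in a finite stage. *)
Lemma horn_stage n (k : 'I_n.+1) (u : pmap (horn k) (Ex_inf K)) : 0 < n ->
  exists N, forall M, N <= M ->
  exists u' : pmap (horn k) (iter M Ex K), u = pmap_comp (stage M) u'.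
Proof.
move=> n0; pose st A := sval (cid (stage_ex (u n (horn_retraction k n0 A)))).
exists (\max_A st A) => M NM.
have uM m (a : horn k m) : exists y, stage M m y = u m a.
  pose B := [set dfun (sval a) x | x : 'I_m.+1].
  have B0 : B != set0 by apply/set0Pn; exists (dfun (sval a) ord0); exact: imset_f.
  have hB : horn_set k B by apply/in_horn_image; exact: svalP a.
  have [B1 _] := horn_retractionP n0 B0 hB.
  have ea : a = res (horn k) (sval a) (horn_retraction k n0 B).
    by apply: sig_ext; apply: dhom_ext => x /=; rewrite dcompE B1 // imset_f.
  have [y yE] : exists y, stage M n y = u n (horn_retraction k n0 B).
    apply: (@stage_mono (st B)); last by rewrite /st; case: cid.
    by apply: leq_trans NM; exact: leq_bigmax.
  by exists (res (iter M Ex K) (sval a) y); rewrite resE yE [in RHS]ea resE.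
pose u' m a := sval (cid (uM m a)).
have u'E m a : stage M m (u' m a) = u m a by rewrite /u'; case: cid.
have u'n l m (t : dhom l m) a : u' l (res (horn k) t a) = res (iter M Ex K) t (u' m a).
  by apply: stage_inj; rewrite u'E !resE u'E.
by exists (@PMap Delta (horn k) (iter M Ex K) u' u'n); apply: pmap_ext => m a; rewrite /= -u'E.
Qed.

Lemma Ex_inf_kan : kan (Ex_inf K).
Proof.
move=> n k n0 u; have [N hN] := horn_stage u n0.
(* Stage [N.+1] is of the form [Ex L], as Kan's filler requires; the filler itself lies one stage
   further. *)
have [u' ->] := hN N.+1 (leqnSn N).
exists (stage N.+2 n (Ex2_filler n0 u')) => m a.
rewrite -resE [X in stage _ _ X](Ex2_fillerE n0 u' a); exact: stage_unit.
Qed.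

(** [sd 0] is a point, so no stage adds vertices. *)
Lemma Ex_inf_vertex (x : Ex_inf K 0) : exists y, Ex_inf_unit K 0 y = x.
Proof.
have [k [y <-]] := stage_ex x; elim: k y => [|k IH] y; first by exists y.
have [z <-] := Ex_unit_vertex y; have [y' E] := IH z.
by exists y'; rewrite E -stage_unit.
Qed.

End Stages.

Lemma stage_nat (K L : sset) (f : pmap K L) k n (x : iter k Ex K n) :
  Ex_inf_map f n (stage K k n x) = stage L k n (Ex_iter_map f k n x).
Proof. by rewrite /= quot_mapE //; exact: tower_map_rel. Qed.

(** The horn and the simplex below it are brought to one stage, where injectivity of the stages of
    [G] makes the square commute. *)
Lemma Ex_inf_horn_lifting (C : site) (J G : spresheaf C) (p : spmap J G) :
  horn_lifting p -> horn_lifting (Ex_inf_spmap p).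
Proof.
move=> hp n k X n0 u w uw.
have [N hN] := horn_stage u n0; have [M hM] := stage_ex w.
have [u' uE] := hN _ (leq_maxl N M).
have [w' wE] := stage_mono (leq_maxr N M) hM.
have [m a|S cS SP] := @Ex_iter_horn_lifting _ _ _ _ (maxn N M) hp n k X n0 u' w'.
  apply: stage_inj; rewrite -stage_nat resE wE -uw uE //.
exists S => // U g /SP[l [l1 l2]]; exists (stage (J U) (maxn N M) n l); split=> [m a|].
  by rewrite -resE l1 uE -stage_nat.
by rewrite -wE [LHS]stage_nat [X in stage _ _ _ X]l2 -stage_nat.
Qed.

Lemma Ex_pullback (P J F G : sset) (p : pmap J G) (f : pmap F G)
    (q1 : pmap P J) (q2 : pmap P F) :
  pullback p f q1 q2 -> pullback (Ex_map p) (Ex_map f) (Ex_map q1) (Ex_map q2).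
Proof.
move=> pb; split=> n.
- by move=> x; apply: pmap_ext => m c; rewrite /= (pb_comm pb).
- move=> x y e1 e2; apply: pmap_ext => m c; apply: (pb_inj pb).
    exact: (congr1 (fun h : pmap (sd n) J => h m c) e1).
  exact: (congr1 (fun h : pmap (sd n) F => h m c) e2).
- move=> y z yz; have ex m (c : sd n m) : exists x, q1 m x = y m c /\ q2 m x = z m c.
    apply: (pb_ex pb); exact: (congr1 (fun h : pmap (sd n) G => h m c) yz).
  pose x m c := sval (cid (ex m c)).
  have xE m c : q1 m (x m c) = y m c /\ q2 m (x m c) = z m c by rewrite /x; case: cid.
  have xn l m (t : dhom l m) (c : sd n m) : x l (res (sd n) t c) = res P t (x m c).
    apply: (pb_inj pb); rewrite resE; first by rewrite !(proj1 (xE _ _)) resE.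
    by rewrite !(proj2 (xE _ _)) resE.
  by exists (@PMap Delta (sd n) P x xn); split; apply: pmap_ext => m c; case: (xE m c).
Qed.

Lemma Ex_inf_pullback (P J F G : sset) (p : pmap J G) (f : pmap F G)
    (q1 : pmap P J) (q2 : pmap P F) :
  pullback p f q1 q2 ->
  pullback (Ex_inf_map p) (Ex_inf_map f) (Ex_inf_map q1) (Ex_inf_map q2).
Proof.
move=> pb; have pbk k : pullback (Ex_iter_map p k) (Ex_iter_map f k) (Ex_iter_map q1 k)
    (Ex_iter_map q2 k).
  by elim: k => [//|k IH]; exact: (Ex_pullback IH).
split=> n.
- move=> x; have [k [y <-]] := stage_ex x.
  by rewrite !stage_nat (pb_comm (pbk k)).
- move=> x y; have [k hk] := stage_ex x; have [l hl] := stage_ex y.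
  have [x' <-] := stage_mono (leq_maxl k l) hk; have [y' <-] := stage_mono (leq_maxr k l) hl.
  rewrite !stage_nat => /stage_inj e1 /stage_inj e2; congr (stage _ _ n _).
  exact: (pb_inj (pbk _)).
- move=> y z; have [k hk] := stage_ex y; have [l hl] := stage_ex z.
  have [y' <-] := stage_mono (leq_maxl k l) hk; have [z' <-] := stage_mono (leq_maxr k l) hl.
  rewrite !stage_nat => /stage_inj /(pb_ex (pbk _)) [x [<- <-]].
  by exists (stage P _ n x); rewrite !stage_nat.
Qed.

Program Definition fprod_snd (C : category) (J F G : spresheaf C) (p : spmap J G)
    (f : spmap F G) : spmap (fprod p f) F :=
  @SPMap C (fprod p f) F (fun U =>
    @PMap Delta (fprod_ob (p U) (f U)) (F U) (fun n x => (sval x).2) _) _.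
Next Obligation. by []. Qed.
Next Obligation. by move=> *; apply: pmap_ext. Qed.

Lemma fprod_pullback (C : category) (J F G : spresheaf C) (p : spmap J G)
    (f : spmap F G) (U : C) :
  pullback (p U) (f U) (fprod_fst p f U) (fprod_snd p f U).
Proof.
split=> n /=.
- by case=> [[x y] /= e].
- by move=> [[x y] e] [[x' y'] e'] /= e1 e2; apply: sig_ext; rewrite /= e1 e2.
- by move=> y z e; exists (exist (fun x : J U n * F U n => p U n x.1 = f U n x.2) (y, z) e).
Qed.

(** * Homotopy classes *)

(** On a Kan complex [relhom] is already an equivalence relation. *)
Lemma pi_classP n (K : sset) (x : K 0) (s t : sphere n x) : kan K ->
  class (@homotopic n K x) s = class (@homotopic n K x) t <-> relhom (sval s) (sval t).
Proof.
move=> hK; split=> [/classP|[H [H0 H1 Hb]]].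
  elim=> [a b [H [H0 H1 Hb]]|a|a b _|a b c _ h1 _ h2].
  - exists H; split; try exact: pmap_ext.
    by move=> l [z w] bz; rewrite Hb // (svalP a).
  - exact: relhom_refl.
  - exact: relhom_sym.
  - exact: relhom_trans h2.
apply: class_rel; exists H; split=> [m a|m a|m a b ba].
- by rewrite -H0.
- by rewrite -H1.
- by rewrite Hb // (svalP s).
Qed.

Lemma pi0_relP (K : sset) (x y : K 0) : pi0_rel x y <-> relhom (yoneda x) (yoneda y).
Proof.
have d0 (a : dhom 0 0) : a = did 0.
  by apply: dhom_ext => i; rewrite [LHS]ord1 [RHS]ord1.
split=> [[e [e0 e1]]|[H [H0 H1 _]]].
  pose snd : pmap (prism 0 1) (simplex 1) := @PMap Delta (prism 0 1) (simplex 1)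
    (fun _ c => c.2) (fun _ _ _ _ => erefl).
  have E v (m : Delta) (a : simplex 0 m) : at_vertex (pmap_comp (yoneda e) snd) v m a =
      res K a (res K (dcst 0 v) e).
    by rewrite /= -resM; congr (res K _ e); rewrite cst_dcomp.
  exists (pmap_comp (yoneda e) snd); split.
  - by apply: pmap_ext => m a; rewrite E e0.
  - by apply: pmap_ext => m a; rewrite E e1.
  - by move=> l c [j jc]; case: (jc ord0); rewrite [LHS]ord1 [RHS]ord1.
have E v : res K (dcst 0 v) (H 1 (dcst 1 ord0, did 1)) = at_vertex H v 0 (did 0).
  rewrite -resE /=; congr (H 0 (_, _)); first by rewrite cst_dcomp; exact: d0.
  by rewrite dcomp_id.
by exists (H 1 (dcst 1 ord0, did 1)); rewrite !E H0 H1 !yoneda_id.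
Qed.

Lemma pi0_classP (K : sset) (x y : K 0) : kan K ->
  class (@pi0_rel K) x = class (@pi0_rel K) y <-> relhom (yoneda x) (yoneda y).
Proof.
move=> hK; split=> [/classP|/pi0_relP h]; last exact: class_rel.
elim=> [a b /pi0_relP //|a|a b _|a b c _ h1 _ h2].
- exact: relhom_refl.
- exact: relhom_sym.
- exact: relhom_trans h2.
Qed.

(** An edge of [Ex K] is a map from the subdivided interval, that is, two edges of [K] going from
    the end points {0} and {1} to the middle vertex {0,1}. *)
Lemma pi0_Ex (K : sset) (x y : Ex K 0) :
  class (@pi0_rel (Ex K)) x = class (@pi0_rel (Ex K)) y ->
  class (@pi0_rel K) (x 0 (initial_chain 0)) = class (@pi0_rel K) (y 0 (initial_chain 0)).
Proof.
move=> /classP; elim=> {x y} [x y [e [ex ey]]|//|a b _ -> //|a b c _ -> _ -> //].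
have hc (v : 'I_2) : sd_chain [ffun i : 'I_2 => if i == ord0 then [set v] else [set: 'I_2]].
  apply/sd_chainP; split=> [i|i j ij]; rewrite !ffunE.
    by case: ifP => _; apply/set0Pn; exists v; rewrite !inE.
  have [[-> _]|[ei _]] := ord2_val i; first by case: ifP => // _; rewrite subsetT.
  have [[ej _]|[-> _]] := ord2_val j; first by rewrite ei ej in ij.
  by rewrite ei.
pose c v : sd 1 1 := exist (fun c => is_true (sd_chain c)) _ (hc v).
pose top := e 0 (res (sd 1) (dcst 0 ord_max) (c ord0)).
have E (v : 'I_2) : class (@pi0_rel K) (res (Ex K) (dcst 0 v) e 0 (initial_chain 0)) = class _ top.
  apply: class_rel; exists (e 1 (c v)); rewrite -!resE; split; congr (e 0 _);
    apply: sd_ext => i; rewrite !ffunE dmkE ?ffunE //=.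
  apply/setP => z; rewrite inE; apply/eqP/imsetP => [->|[w _ ->]]; last by rewrite dmkE.
  by exists ord0; rewrite ?inE ?dmkE.
by rewrite -ex -ey !E.
Qed.

Lemma pi0_stage (K : sset) k (a b : iter k Ex K 0) (x y : K 0) :
  class (@pi0_rel (iter k Ex K)) a = class (@pi0_rel (iter k Ex K)) b ->
  stage K k 0 a = Ex_inf_unit K 0 x -> stage K k 0 b = Ex_inf_unit K 0 y ->
  class (@pi0_rel K) x = class (@pi0_rel K) y.
Proof.
elim: k a b => [|k IH] a b ab; first by move=> /(@stage_inj K 0) <- /(@stage_inj K 0) <-.
have [a' ea] := Ex_unit_vertex a; have [b' eb] := Ex_unit_vertex b.
have E (z : iter k Ex K 0) : Ex_unit (iter k Ex K) 0 z 0 (initial_chain 0) = z.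
  change (res (iter k Ex K) (last_vertex 0 0 (initial_chain 0)) z = z).
  by rewrite last_initial_chain; exact: (@pres1 Delta _ 0 z).
rewrite -ea -eb !stage_unit; apply: IH.
by have := pi0_Ex ab; rewrite -ea -eb !E.
Qed.

Lemma pi0_Ex_inf (K : sset) (x y : K 0) :
  class (@pi0_rel K) x = class (@pi0_rel K) y <->
  class (@pi0_rel (Ex_inf K)) (Ex_inf_unit K 0 x) = class (@pi0_rel (Ex_inf K)) (Ex_inf_unit K 0 y).
Proof.
split=> [E|/classP E]; first by rewrite -!pi0_mapE E.
(* The end points become arbitrary vertices of [Ex_inf K] with given preimages, so that the
   induction passes through intermediate vertices, which [Ex_inf_vertex] lifts to [K]. *)
have : forall x' y' : K 0, Ex_inf_unit K 0 x = Ex_inf_unit K 0 x' ->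
    Ex_inf_unit K 0 y = Ex_inf_unit K 0 y' -> class (@pi0_rel K) x' = class (@pi0_rel K) y'.
  elim: E => {x y} [a b [e [ea eb]] x y ax ay|a x y -> /(@stage_inj K 0) -> //|
    a b _ IH x y ax ay|a b c _ IH1 _ IH2 x y ax ay].
  - have [k [e' ee]] := stage_ex e.
    apply: (@pi0_stage K k (res (iter k Ex K) (dcst 0 ord0) e')
      (res (iter k Ex K) (dcst 0 ord_max) e')).
    + by apply: class_rel; exists e'.
    + by rewrite resE ee ea.
    + by rewrite resE ee eb.
  - by rewrite (IH y x).
  - by have [z bz] := Ex_inf_vertex b; rewrite (IH1 x z) // (IH2 z y).
exact.
Qed.

(** * Local weak equivalences in terms of spheres *)

Lemma slice_locally (C : site) (X : C) (a : slice X)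
    (P : forall b : slice X, @hom (slice X) b a -> Prop) :
  locally P <-> locally (fun V (g : hom V (sdom a)) =>
    P (@SliceOb C X V (sto a \c g)) (exist _ g erefl)).
Proof.
split=> [[S cS SP]|[S cS SP]].
  by exists (slice_push S) => // V g; exact: SP.
pose S' : @sieve (slice X) a := @Sieve (slice X) a (fun b g => S (sdom b) (sval g))
  (fun b c g h => @sarrM _ _ S _ _ (sval g) (sval h)).
exists S' => [|b g].
  by rewrite /=; suff -> : slice_push S' = S by []; exact: sieve_ext.
have key V (k : hom V (sdom a)) s (e : sto a \c k = s) :
    S V k -> P (@SliceOb C X V s) (exist _ k e) by case: _ / e; exact: SP.
by case: b g => V s [k e]; exact: key.
Qed.

Section WeakEquivalence.
Variables (C : site) (F G : spresheaf C) (f : spmap F G).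
Let EF := Ex_inf_sp F.
Let EG := Ex_inf_sp G.
Let Ef : spmap EF EG := Ex_inf_spmap f.

Lemma vertex_of_simplex0 (K : sset) (s : pmap (simplex 0) (Ex_inf K)) :
  exists x, s = yoneda (Ex_inf_unit K 0 x).
Proof.
have [x xs] := Ex_inf_vertex (s 0 (did 0)); exists x.
by rewrite xs yonedaK.
Qed.

Lemma unit_loc (F' : spresheaf C) U V (g : hom U V) (x : F' V 0) :
  spres (Ex_inf_sp F') g 0 (Ex_inf_unit (F' V) 0 x) = Ex_inf_unit (F' U) 0 (spres F' g 0 x).
Proof. exact: Ex_inf_unit_nat. Qed.

Lemma unit_map U (x : F U 0) :
  Ef U 0 (Ex_inf_unit (F U) 0 x) = Ex_inf_unit (G U) 0 (f U 0 x).
Proof. exact: Ex_inf_unit_nat. Qed.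

Lemma relhom_unit (K : sset) (x y : K 0) :
  relhom (yoneda (Ex_inf_unit K 0 x)) (yoneda (Ex_inf_unit K 0 y)) <->
  class (@pi0_rel K) x = class (@pi0_rel K) y.
Proof.
apply: iff_trans (iff_sym (pi0_Ex_inf x y)); apply: iff_sym; exact: pi0_classP (@Ex_inf_kan K).
Qed.

Lemma pi0_surjP : loc_surj (pi0_pmap f) <-> pi0_loc_surj Ef.
Proof.
split=> h X.
  move=> b; have [y ->] := vertex_of_simplex0 b.
  apply: (locally_mono (h X (class _ y))) => U g [q].
  elim/quot_ind: q => x; rewrite /= !pi0_mapE => xy.
  by exists (yoneda (Ex_inf_unit (F U) 0 x)); rewrite !yoneda_map unit_map unit_loc relhom_unit.
elim/quot_ind => y; apply: (locally_mono (h X (yoneda (Ex_inf_unit (G X) 0 y)))) => U g [s].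
have [x ->] := vertex_of_simplex0 s; rewrite !yoneda_map unit_map unit_loc relhom_unit => xy.
by exists (class _ x); rewrite /= !pi0_mapE.
Qed.

Lemma pi0_injP : loc_inj (pi0_pmap f) <-> pi_loc_inj Ef 0.
Proof.
split=> h X.
  move=> x s t _ _; have [a ->] := vertex_of_simplex0 s; have [b ->] := vertex_of_simplex0 t.
  rewrite !yoneda_map !unit_map relhom_unit -!pi0_mapE => /h /locally_mono; apply=> U g.
  by rewrite /= !pi0_mapE !yoneda_map !unit_loc relhom_unit.
elim/quot_ind => x; elim/quot_ind => y; rewrite /= !pi0_mapE -relhom_unit -!unit_map -!yoneda_map.
have bd0 (K : sset) (z : K 0) (s : pmap (simplex 0) K) : bd_const z s.
  by move=> l a [j ja]; case: (ja ord0); rewrite [LHS]ord1 [RHS]ord1.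
move=> /(h X (Ex_inf_unit (F X) 0 x) _ _ (bd0 _ _ _) (bd0 _ _ _)) /locally_mono; apply=> U g.
by rewrite !yoneda_map !unit_loc relhom_unit !pi0_mapE.
Qed.

(** From left to right, the presheaf on the slice is used at the identity of [X], and every base
    point in [Ex_inf] comes from [F]. From right to left, an object [a] of the slice is handled by
    restricting the base point to [sdom a]. *)
Lemma pi_surjP m : (forall X (x : F X 0),
  loc_surj (pi_pmap m Ef (Ex_inf_unit (F X) 0 x))) <-> pi_loc_surj Ef m.
Proof.
split=> h X.
- move=> x0 b; have [x <-] := Ex_inf_vertex x0; move: (Ex_inf_unit _ _ x) (h X x) => z hz bz.
  have bz' : bd_const (spres EG (idm X) 0 (Ef X 0 z)) b by rewrite spres1x.
  pose a : slice X := @SliceOb C X X (idm X).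
  have /slice_locally := hz a (class _ (exist (bd_const _) b bz')).
  move=> /locally_mono; apply=> U g [q]; elim/quot_ind: q => s.
  rewrite /= !pi_mapE => /pi_classP - /(_ (@Ex_inf_kan _)) /= sb.
  exists (sval s) => // l w bw.
  have e : spres EF (idm X \c g) 0 z = spres EF g 0 z by rewrite comp1m.
  exact: etrans (svalP s l w bw) (congr1 (fun y => degen y l) e).
- move=> x a q; elim/quot_ind: q => b; apply/slice_locally.
  set z := Ex_inf_unit _ _ x in b *.
  have bz : bd_const (Ef (sdom a) 0 (spres EF (sto a) 0 z)) (sval b).
    by rewrite spfunEx; exact: svalP b.
  apply: (locally_mono (h _ _ _ bz)) => U g [s sz sb].
  have sz' : bd_const (spres EF (sto a \c g) 0 z) s by rewrite spresMx.
  exists (class _ (exist (bd_const _) s sz')).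
  by rewrite /= !pi_mapE; apply/pi_classP => //; exact: Ex_inf_kan.
Qed.

Lemma pi_injP m : (forall X (x : F X 0),
  loc_inj (pi_pmap m Ef (Ex_inf_unit (F X) 0 x))) <-> pi_loc_inj Ef m.
Proof.
split=> h X.
- move=> x0 s t; have [x <-] := Ex_inf_vertex x0.
  move: (Ex_inf_unit _ _ x) (h X x) => z hz sz tz st.
  have E r : bd_const z r -> bd_const (spres EF (idm X) 0 z) r by rewrite spres1x.
  pose a : slice X := @SliceOb C X X (idm X).
  have [|S cS SP] := (proj1 (slice_locally _)) (hz a (class _ (exist (bd_const _) s (E _ _ sz)))
    (class _ (exist (bd_const _) t (E _ _ tz))) _).
    by rewrite /= !pi_mapE; apply/pi_classP => //; exact: Ex_inf_kan.
  exists S => // U g /SP; rewrite /= !pi_mapE => /pi_classP; apply; exact: Ex_inf_kan.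
- move=> x a q r; elim/quot_ind: q => s; elim/quot_ind: r => t.
  rewrite /= !pi_mapE => /pi_classP - /(_ (@Ex_inf_kan _)) /= st; apply/slice_locally.
  apply: (locally_mono (h _ _ _ _ (svalP s) (svalP t) st)) => U g.
  by rewrite !pi_mapE => ?; apply/pi_classP => //; exact: Ex_inf_kan.
Qed.

Lemma local_weqP : local_weq f <-> pi_local_iso Ef.
Proof.
split=> [[/sheaf_isoP[/pi0_injP i0 /pi0_surjP s0] h]|[s0 s i]].
  split=> [//|m m0|m].
    by apply/pi_surjP => X x; have /sheaf_isoP[] := h X x m m0.
  have [->//|m0] := posnP m.
  by apply/pi_injP => X x; have /sheaf_isoP[] := h X x m m0.
split=> [|X x m m0]; apply/sheaf_isoP; split.
- exact/pi0_injP/i.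
- exact/pi0_surjP.
- by move: X x; apply/pi_injP/i.
- by move: X x; apply/pi_surjP/s.
Qed.

End WeakEquivalence.

Theorem proposition7p1 (C : site) (F G J : spresheaf C)
  (f : spmap F G) (p : spmap J G) :
  local_weq f -> local_fibration p -> local_weq (fprod_fst p f).
Proof.
move=> /local_weqP hf /local_fibration_horn_lifting/Ex_inf_horn_lifting hp.
apply/local_weqP; apply: (@pullback_pi_local_iso C _ _ _ _ _ _ _
  (Ex_inf_spmap (fprod_snd p f)) _ _ _ hp hf) => U; try exact: Ex_inf_kan.
exact: Ex_inf_pullback (fprod_pullback p f U).
Qed.
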